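(* Let $X$ be a thick locally finite building of finite rank and type $(W,S)$, and let $G<\mathrm{Aut}(X)$ be a closed type-preserving subgroup acting Weyl-transitively. Every unitary representation of $G$ weakly contained in the regular representation is mixing.
   Context: Buildings. $(W,S)$ is a Coxeter system with word length $\ell$. A building $X$ of type $(W,S)$ is a set $\mathrm{Ch}(X)$ of chambers with a Weyl distance $\delta\colon \mathrm{Ch}(X)\times\mathrm{Ch}(X)\to W$ such that: $\delta(C,D)=e$ iff $C=D$; if $\delta(C,D)=w$ and $\delta(C',C)=s\in S$ then $\delta(C',D)\in\{sw,w\}$, with $\delta(C',D)=sw$ if $\ell(sw)=\ell(w)+1$; and if $\delta(C,D)=w$ then for each $s\in S$ there is $C'$ with $\delta(C',C)=s$ and $\delta(C',D)=sw$. An $s$-panel is a set $\{D:\delta(C,D)\in\{e,s\}\}$. $X$ has finite rank if $S$ is finite, is thick if every panel has at least $3$ chambers, and is locally finite if every panel is finite. $\mathrm{Aut}(X)$ carries the topology of pointwise convergence on chambers. A type-preserving subgroup $G$ (one preserving $\delta$) acts Weyl-transitively if for each $w\in W$ it is transitive on ordered pairs of chambers $(C,D)$ with $\delta(C,D)=w$. Unitary representations are strongly continuous. The regular representation is the left regular representation $\lambda_G$ on $L^2(G)$; weak containment is in the sense of Fell. A unitary representation is mixing if all its matrix coefficients $g\mapsto\langle\pi(g)\xi,\eta\rangle$ lie in $C_0(G)$. *)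

(* Defs.v *)
From HB Require Import structures.
From mathcomp Require Import all_boot all_order all_algebra.
From mathcomp Require Import sesquilinear ring_quotient complex.
From mathcomp Require Import all_classical all_reals all_analysis.
From mathcomp Require Import measurable_realfun.

Set Implicit Arguments.
Unset Strict Implicit.
Unset Printing Implicit Defensive.

Import Order.TTheory GRing.Theory Num.Theory.
Import numFieldNormedType.Exports.

Local Open Scope classical_set_scope.
Local Open Scope group_scope.

HB.mixin Record isTopGroup G of Group G & Topological G := {
  mulg_continuous : continuous (fun x : G * G => (x.1 * x.2)%g);
  invg_continuous : continuous (fun x : G => x^-1%g)
}.

#[short(type="topGroupType")]
HB.structure Definition TopGroup :=
  {G of Group G & PointedTopological G & isTopGroup G}.

Section Subgroup.
Variables (T : topGroupType) (G : groupClosed T).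

Definition subgrp : Type := set_type [set` G].

HB.instance Definition _ := Topological.on subgrp.
HB.instance Definition _ := SubChoice.on subgrp.

Let subgrp_closed : group_closed (fun x : T => x \in [set` G]).
Proof.
split=> [|x y]; rewrite !inE /=; first exact: gpred1.
by move=> xG yG; apply: gpredM => //; rewrite gpredV.
Qed.
HB.instance Definition _ := SubChoice_isSubGroup.Build T _ subgrp subgrp_closed.
HB.instance Definition _ := isPointed.Build subgrp (1 : subgrp).

Let subgrp_mul_continuous : continuous (fun x : subgrp * subgrp => x.1 * x.2).
Proof.
apply: (@continuous_comp_initial _ _ T val) => x.
apply: (@continuous_comp (subgrp * subgrp)%type (T * T)%type T
  (fun x => (val x.1, val x.2)) (fun x => x.1 * x.2)).
  apply: (@cvg_pair _ _ _ _ (nbhs (val x.1)) (nbhs (val x.2))).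
    by apply: (@cvg_comp _ _ _ fst val); [exact: cvg_fst|exact: initial_continuous].
  by apply: (@cvg_comp _ _ _ snd val); [exact: cvg_snd|exact: initial_continuous].
exact: mulg_continuous.
Qed.

Let subgrp_inv_continuous : continuous (fun x : subgrp => x^-1).
Proof.
apply: (@continuous_comp_initial _ _ T val) => x.
apply: (@continuous_comp subgrp T T val (fun x => x^-1)).
  exact: initial_continuous.
exact: invg_continuous.
Qed.

HB.instance Definition _ :=
  isTopGroup.Build subgrp subgrp_mul_continuous subgrp_inv_continuous.

End Subgroup.

Definition is_word (W : groupType) (S : set W) (n : nat) (w : W) :=
  exists s : seq W, [/\ size s = n, {in s, forall x, S x} & \prod_(x <- s) x = w].

(* The length of [w] with respect to [S]; the default value [0] is used only
   when [w] is not a product of elements of [S]. *)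
Definition word_length (W : groupType) (S : set W) (w : W) : nat :=
  xget 0%N [set n | is_word S n w /\ forall m, is_word S m w -> (n <= m)%N].

(* [cox_pres] is the universal property of the presentation
   <S | (s t)^m(s, t) = 1 whenever s t has finite order m(s, t)>: only the values
   of [f] on [S] matter, and the case [n = 0] is trivial. *)
Record is_coxeter_system (W : groupType) (S : set W) : Prop := {
  cox_invol : forall s, S s -> s != 1 /\ s * s = 1;
  cox_gen : forall w, exists n, is_word S n w;
  cox_pres : forall (H : groupType) (f : W -> H),
    (forall s t, S s -> S t ->
      forall n, (s * t) ^+ n = 1 -> (f s * f t) ^+ n = 1) ->
    exists2 phi : W -> H,
      {morph phi : x y / x * y} & forall s, S s -> phi s = f s
}.

Record coxeterSystem := CoxeterSystem {
  cox_group :> groupType;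
  cox_gens : set cox_group;
  cox_systemP : is_coxeter_system cox_gens
}.

Arguments cox_gens : clear implicits.

Record building (W : coxeterSystem) := Building {
  chamber :> choiceType;
  wdist : chamber -> chamber -> W;
  wdist_eq1 : forall C D, wdist C D = 1 <-> C = D;
  wdist_adj : forall C C' D s, cox_gens W s -> wdist C' C = s ->
    let w := wdist C D in
    (wdist C' D = s * w \/ wdist C' D = w) /\
    (word_length (cox_gens W) (s * w) = (word_length (cox_gens W) w).+1 ->
       wdist C' D = s * w);
  wdist_ex : forall C D s, cox_gens W s ->
    exists C', wdist C' C = s /\ wdist C' D = s * wdist C D
}.

Section Building.
Variables (W : coxeterSystem) (X : building W).
Local Notation S := (cox_gens W).

Definition panel (s : W) (C : X) : set X :=
  [set D | wdist C D = 1 \/ wdist C D = s].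

Definition finite_rank := finite_set S.

Definition thick := forall s (C : X), S s ->
  exists D1 D2 D3, [/\ panel s C D1, panel s C D2, panel s C D3 &
                       [/\ D1 <> D2, D1 <> D3 & D2 <> D3]].

Definition locally_finite := forall s (C : X), S s -> finite_set (panel s C).

(* An automorphism of [X] may permute the types: it preserves the Weyl distance
   up to an automorphism [sigma] of the Coxeter system. *)
Definition is_automorphism (f : X -> X) := bijective f /\
  exists sigma : W -> W,
    [/\ bijective sigma, {morph sigma : x y / x * y}, sigma @` S = S &
        forall C D, wdist (f C) (f D) = sigma (wdist C D)].

(* Topologized as a subspace of the functions [X -> X] with the topology of
   pointwise convergence, [X] being discrete. *)
Definition building_aut : Type :=
  set_type [set f : {ptws X -> discrete_topology X} | is_automorphism f].

HB.instance Definition _ := Topological.on building_aut.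

Definition aut_fun (g : building_aut) : X -> X := val g.
Coercion aut_fun : building_aut >-> Funclass.

Lemma autP (g : building_aut) : is_automorphism g.
Proof. exact: set_valP. Qed.

Lemma aut_inj (g h : building_aut) : (forall C, g C = h C) -> g = h.
Proof. by move=> gh; apply/val_inj/funext. Qed.

Lemma id_is_automorphism : is_automorphism id.
Proof.
split; first by exists id.
exists id; split => //; first by exists id.
by rewrite image_id.
Qed.

Lemma comp_is_automorphism f g :
  is_automorphism f -> is_automorphism g -> is_automorphism (f \o g).
Proof.
move=> [bf [sf [bsf mf Sf df]]] [bg [sg [bsg mg Sg dg]]].
split; first exact: bij_comp.
exists (sf \o sg); split => [|x y||C D]; first exact: bij_comp.
- by rewrite /= mg mf.
- by rewrite -image_comp Sg Sf.
- by rewrite /= df dg.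
Qed.

Lemma inv_is_automorphism f g :
  cancel f g -> cancel g f -> is_automorphism f -> is_automorphism g.
Proof.
move=> fK gK [_ [s [[t sK tK] ms Ss ds]]]; split; first by exists f.
exists t; split; first by exists s.
- by move=> x y; apply: (can_inj sK); rewrite ms !tK.
- by rewrite -{1}Ss image_comp (_ : t \o s = id) ?image_id //; exact/funext.
- by move=> C D; rewrite -{2}(gK C) -{2}(gK D) ds sK.
Qed.

Lemma aut_inv_ex (g : building_aut) : exists h : X -> X, cancel g h /\ cancel h g.
Proof. by have [[h gK hK] _] := autP g; exists h. Qed.

Definition mk_aut (f : X -> X) (fP : is_automorphism f) : building_aut :=
  exist (fun f => f \in [set f | is_automorphism f]) f (mem_set fP).

Definition aut_one : building_aut := mk_aut id_is_automorphism.
Definition aut_mul (g h : building_aut) : building_aut :=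
  mk_aut (comp_is_automorphism (autP g) (autP h)).
Definition aut_inv (g : building_aut) : building_aut :=
  let: exist h hP := cid (aut_inv_ex g) in
  mk_aut (inv_is_automorphism (proj1 hP) (proj2 hP) (autP g)).

Lemma aut_invK (g : building_aut) : cancel g (aut_inv g).
Proof. by rewrite /aut_inv; case: cid => h [? ?] ?. Qed.

Lemma aut_invVK (g : building_aut) : cancel (aut_inv g) g.
Proof. by rewrite /aut_inv; case: cid => h [? ?] ?. Qed.

Let aut_mulA : associative aut_mul. Proof. by move=> f g h; exact: aut_inj. Qed.
Let aut_mul1 : left_id aut_one aut_mul. Proof. by move=> f; exact: aut_inj. Qed.
Let aut_1mul : right_id aut_one aut_mul. Proof. by move=> f; exact: aut_inj. Qed.
Let aut_mulV : left_inverse aut_one aut_inv aut_mul.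
Proof. by move=> g; apply: aut_inj => C; exact: (aut_invK g C). Qed.
Let aut_Vmul : right_inverse aut_one aut_inv aut_mul.
Proof. by move=> g; apply: aut_inj => C; exact: (aut_invVK g C). Qed.

HB.instance Definition _ :=
  isGroup.Build building_aut aut_mulA aut_mul1 aut_1mul aut_mulV aut_Vmul.
HB.instance Definition _ := isPointed.Build building_aut (1 : building_aut).

Lemma aut_mulE (g h : building_aut) C : (g * h : building_aut) C = g (h C).
Proof. by []. Qed.
Lemma aut_invE (g : building_aut) : g^-1 = aut_inv g. Proof. by []. Qed.

Lemma aut_near (g : building_aut) (C : X) :
  nbhs g [set h : building_aut | h C = g C].
Proof.
have c : continuous (fun h : building_aut => (h C : discrete_topology X)).
  move=> h; apply: (@continuous_comp building_aut {ptws X -> discrete_topology X} _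
    (val : building_aut -> _) (fun f => f C)).
    exact: initial_continuous.
  exact: (@proj_continuous X (fun=> discrete_topology X)).
apply: (c g [set g C]).
exact: (@discrete_set1 (discrete_topology X)).
Qed.

Lemma cvg_aut (T : topologicalType) (h : T -> building_aut) (t : T) :
  (forall C, nbhs t [set u | h u C = h t C]) -> h u @[u --> t] --> h t.
Proof.
move=> hC U [_ /= [[V oV <-] Vht]] VU; apply: (filterS VU) => /=.
suff : (val \o h) u @[u --> t] --> (val (h t) : {ptws X -> discrete_topology X}).
  by apply; exact: open_nbhs_nbhs.
apply/cvg_sup => C A [_ [[B oB <-] BC]] BA /=.
by apply: filterS (hC C) => u huC; apply: BA; rewrite /= [X in B X]huC.
Qed.

Let aut_mul_continuous :
  continuous (fun x : building_aut * building_aut => x.1 * x.2).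
Proof.
move=> [g h]; apply: cvg_aut => C /=.
exists ([set g' | aut_fun g' (aut_fun h C) = aut_fun g (aut_fun h C)],
  [set h' | aut_fun h' C = aut_fun h C]).
  by split; exact: aut_near.
by move=> [g' h'] [] /= e1 e2; rewrite !aut_mulE e2.
Qed.

Let aut_inv_continuous : continuous (fun x : building_aut => x^-1).
Proof.
move=> g; apply: cvg_aut => C.
apply: filterS (aut_near g (aut_inv g C)) => h /=.
by rewrite aut_invVK !aut_invE => e; rewrite -{1}e aut_invK.
Qed.

HB.instance Definition _ :=
  isTopGroup.Build building_aut aut_mul_continuous aut_inv_continuous.

End Building.

Section BuildingGroups.
Variables (W : coxeterSystem) (X : building W).

Definition type_preserving (G : groupClosed (building_aut X)) :=
  forall g : building_aut X, g \in G -> forall C D, wdist (g C) (g D) = wdist C D.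

Definition weyl_transitive (G : groupClosed (building_aut X)) :=
  forall (w : W) (C D C' D' : X), wdist C D = w -> wdist C' D' = w ->
    exists2 g : building_aut X, g \in G & g C = C' /\ g D = D'.

End BuildingGroups.

Local Close Scope group_scope.
Local Open Scope ring_scope.
Local Open Scope complex_scope.
Local Open Scope quotient_scope.

Local Notation Re := (@complex.Re _).
Local Notation Im := (@complex.Im _).

HB.mixin Record hasInner (R : realType) H of GRing.Lmodule R[i] H := {
  inner : {dot H for @Num.conj R[i]}
}.

#[short(type="prehilbertType")]
HB.structure Definition PreHilbert (R : realType) :=
  {H of GRing.Lmodule R[i] H & hasInner R H}.

(* A Hilbert space is an inner product space (linear in the first variable) that is
   complete for the norm sqrt <x, x>. *)
HB.mixin Record isHilbert (R : realType) H
    of PreHilbert R H & CompleteNormedModule R[i] H := {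
  inner_norm : forall x : H, inner x x = `|x| ^+ 2
}.

#[short(type="hilbertType")]
HB.structure Definition Hilbert (R : realType) :=
  {H of PreHilbert R H & CompleteNormedModule R[i] H & isHilbert R H}.

Section L2.
Context d (T : measurableType d) (R : realType).
Variable mu : {measure set T -> \bar R}.

Definition cintegral (f : T -> R[i]) : R[i] :=
  (\int[mu]_x Re (f x))%R +i* (\int[mu]_x Im (f x))%R.

Definition sqint : {pred T -> R[i]} :=
  mem [set f : T -> R[i] | (Re \o f \in Lfun mu 2%:E) /\ (Im \o f \in Lfun mu 2%:E)].

Lemma Lfun2_lin (a : R) (f g : T -> R) :
  f \in Lfun mu 2%:E -> g \in Lfun mu 2%:E -> a \*: f \+ g \in Lfun mu 2%:E.
Proof. by move=> fL gL; apply: (Lfun_submod_closed mu (lee1n 2)).2. Qed.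

Lemma Lfun2_0 : cst 0 \in Lfun mu 2%:E.
Proof. exact: (Lfun_submod_closed mu (lee1n 2)).1. Qed.

Lemma sqint_submod_closed : submod_closed sqint.
Proof.
split=> [|a f g]; rewrite !inE /=.
  by split; rewrite (_ : _ \o _ = cst 0) //; exact: Lfun2_0.
move=> [fr fi] [gr gi]; split.
  rewrite (_ : _ \o _ =
    Re a \*: (Re \o f) \+ (- Im a \*: (Im \o f) \+ (Re \o g))).
    by apply: Lfun2_lin => //; apply: Lfun2_lin.
  apply/funext => x /=; rewrite -[LHS]/(Re (a * f x + g x)).
  by case: a (f x) (g x) => [? ?] [? ?] [? ?] /=; rewrite scaleNr addrA.
rewrite (_ : _ \o _ =
  Re a \*: (Im \o f) \+ (Im a \*: (Re \o f) \+ (Im \o g))).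
  by apply: Lfun2_lin => //; apply: Lfun2_lin.
apply/funext => x /=; rewrite -[LHS]/(Im (a * f x + g x)).
by case: a (f x) (g x) => [? ?] [? ?] [? ?] /=; rewrite addrA.
Qed.

HB.instance Definition _ :=
  GRing.isSubmodClosed.Build R[i] (T -> R[i]) sqint sqint_submod_closed.

Definition sqintType : Type := {f : T -> R[i] | f \in sqint}.
HB.instance Definition _ := SubChoice.on sqintType.
HB.instance Definition _ := [SubChoice_isSubLmodule of sqintType by <:].

Definition sqint_fun (f : sqintType) : T -> R[i] := val f.
Coercion sqint_fun : sqintType >-> Funclass.

Definition ae_zero : {pred sqintType} :=
  mem [set f : sqintType | \forall x \ae mu, f x = 0].

Lemma ae_zero_submod_closed : submod_closed ae_zero.
Proof.
split=> [|a f g]; rewrite !inE /=; first exact/aeW.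
apply: filterS2 => x /= fx gx.
by rewrite -[LHS]/(a * sqint_fun f x + sqint_fun g x) fx gx mulr0 addr0.
Qed.

HB.instance Definition _ :=
  GRing.isSubmodClosed.Build R[i] sqintType ae_zero ae_zero_submod_closed.

(* Square-integrable complex functions modulo equality almost everywhere. *)
Definition L2 : Type := Quotient.quot ae_zero.
HB.instance Definition _ := GRing.Zmodule.on L2.
HB.instance Definition _ := EqQuotient.on L2.

Lemma L2_piP (f g : sqintType) :
  reflect (\forall x \ae mu, f x = g x) (\pi_L2 f == \pi_L2 g).
Proof.
rewrite /L2 -Quotient.idealrBE; apply: (iffP idP); rewrite inE /=.
  by apply: filterS => x /= /eqP; rewrite subr_eq0 => /eqP.
by apply: filterS => x /= fg; rewrite -[LHS]/(f x - g x) fg subrr.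
Qed.

Lemma L2_reprP (f : sqintType) :
  \forall x \ae mu, sqint_fun (repr (\pi_L2 f)) x = f x.
Proof. by apply/L2_piP; rewrite reprK. Qed.

Definition L2_scale (a : R[i]) (u : L2) : L2 := \pi_L2 (a *: repr u).

Lemma pi_L2_scale a f : L2_scale a (\pi_L2 f) = \pi_L2 (a *: f).
Proof.
apply/eqP/L2_piP; apply: filterS (L2_reprP f) => x /= e.
by rewrite -[LHS]/(a * sqint_fun (repr (\pi_L2 f)) x) e.
Qed.

Lemma pi_L2D f g : \pi_L2 (f + g) = \pi_L2 f + \pi_L2 g.
Proof. by rewrite !piE. Qed.

Let L2_scaleA a b u : L2_scale a (L2_scale b u) = L2_scale (a * b) u.
Proof. by rewrite -[u]reprK (pi_L2_scale b) !pi_L2_scale scalerA. Qed.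
Let L2_scale1 : left_id 1 L2_scale.
Proof. by move=> u; rewrite -[u]reprK !pi_L2_scale scale1r. Qed.
Let L2_scaleDr : right_distributive L2_scale +%R.
Proof.
move=> a u v.
by rewrite -[u]reprK -[v]reprK -pi_L2D !pi_L2_scale scalerDr pi_L2D.
Qed.
Let L2_scaleDl u : {morph L2_scale^~ u : a b / a + b}.
Proof. by move=> a b; rewrite -[u]reprK !pi_L2_scale scalerDl pi_L2D. Qed.

HB.instance Definition _ := GRing.Zmodule_isLmodule.Build R[i] L2
  L2_scaleA L2_scale1 L2_scaleDr L2_scaleDl.

Definition cintegrable (f : T -> R[i]) :=
  (Re \o f \in Lfun mu 1) /\ (Im \o f \in Lfun mu 1).

Lemma Lfun1_lin (a : R) (f g : T -> R) :
  f \in Lfun mu 1 -> g \in Lfun mu 1 -> a \*: f \+ g \in Lfun mu 1.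
Proof. by move=> fL gL; apply: (Lfun_submod_closed mu (lexx _)).2. Qed.

Lemma Rintegral_lin (a : R) (f g : T -> R) :
  f \in Lfun mu 1 -> g \in Lfun mu 1 ->
  (\int[mu]_x (a * f x + g x) = a * \int[mu]_x f x + \int[mu]_x g x)%R.
Proof.
move=> fL gL; rewrite RintegralD //; last exact/Lfun1_integrable.
  by rewrite RintegralZl //; exact/Lfun1_integrable.
have /Lfun1_integrable := Lfun1_lin a fL (Lfun_submod_closed mu (lexx 1%E)).1.
by congr integrable; apply/funext => x /=; rewrite addr0.
Qed.

Lemma cintegral_lin (a : R[i]) (f g : T -> R[i]) :
  cintegrable f -> cintegrable g ->
  cintegral (fun x => a * f x + g x) = a * cintegral f + cintegral g.
Proof.
move=> [fr fi] [gr gi]; rewrite /cintegral.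
have -> : (\int[mu]_x Re (a * f x + g x) =
    \int[mu]_x (Re a * Re (f x) + (- Im a * Im (f x) + Re (g x))))%R.
  apply: eq_Rintegral => x _.
  by case: a (f x) (g x) => [? ?] [? ?] [? ?] /=; rewrite mulNr addrA.
have -> : (\int[mu]_x Im (a * f x + g x) =
    \int[mu]_x (Re a * Im (f x) + (Im a * Re (f x) + Im (g x))))%R.
  apply: eq_Rintegral => x _.
  by case: a (f x) (g x) => [? ?] [? ?] [? ?] /=; rewrite addrA.
rewrite !(Rintegral_lin (Re a)) ?(Rintegral_lin (- Im a)) ?(Rintegral_lin (Im a)) //.
- by case: a => ? ? /=; apply/eqP; rewrite eq_complex /= !addrA mulNr !eqxx.
- exact: Lfun1_lin.
- exact: Lfun1_lin.
Qed.

Lemma cintegral_conj (f : T -> R[i]) : cintegrable f ->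
  cintegral (fun x => (f x)^*) = (cintegral f)^*.
Proof.
move=> [fr fi]; rewrite /cintegral /=.
have -> : (\int[mu]_x Re (f x)^* = \int[mu]_x Re (f x))%R.
  by apply: eq_Rintegral => x _; case: (f x).
have -> : (\int[mu]_x Im (f x)^* = \int[mu]_x ((-1) * Im (f x)))%R.
  by apply: eq_Rintegral => x _; case: (f x) => ? ? /=; rewrite mulN1r.
by rewrite RintegralZl ?mulN1r //; exact/Lfun1_integrable.
Qed.

Lemma Lfun1_meas (f : T -> R) : f \in Lfun mu 1 -> measurable_fun setT f.
Proof. by move=> /Lfun1_integrable /measurable_int /measurable_EFinP. Qed.

Lemma ae_eq_cintegral (f g : T -> R[i]) : cintegrable f -> cintegrable g ->
  (\forall x \ae mu, f x = g x) -> cintegral f = cintegral g.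
Proof.
move=> [fr fi] [gr gi] fg; rewrite /cintegral /Rintegral.
congr (fine _ +i* fine _); apply: ae_eq_integral => //.
- exact/measurable_EFinP/Lfun1_meas.
- exact/measurable_EFinP/Lfun1_meas.
- by apply: filterS fg => x -> _.
- exact/measurable_EFinP/Lfun1_meas.
- exact/measurable_EFinP/Lfun1_meas.
- by apply: filterS fg => x -> _.
Qed.

Lemma sqintP (f : sqintType) :
  (Re \o f \in Lfun mu 2%:E) /\ (Im \o f \in Lfun mu 2%:E).
Proof. by have := valP f; rewrite inE. Qed.

Lemma sqint_mul (f g : sqintType) : cintegrable (fun x => f x * (g x)^*).
Proof.
have [fr fi] := sqintP f; have [gr gi] := sqintP g.
have L0 := (Lfun_submod_closed mu (lexx 1%E)).1.
split.
  rewrite (_ : _ \o _ = 1 \*: ((Re \o f) \* (Re \o g)) \+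
                       (1 \*: ((Im \o f) \* (Im \o g)) \+ cst 0)).
    by do 2! [apply: Lfun1_lin; first exact: Lfun2_mul_Lfun1].
  apply/funext => x /=; rewrite addr0 !scale1r.
  by case: (f x) (g x) => [? ?] [? ?] /=; rewrite mulrN opprK.
rewrite (_ : _ \o _ = (-1) \*: ((Re \o f) \* (Im \o g)) \+
                     (1 \*: ((Im \o f) \* (Re \o g)) \+ cst 0)).
  by do 2! [apply: Lfun1_lin; first exact: Lfun2_mul_Lfun1].
apply/funext => x /=; rewrite addr0 scaleN1r scale1r.
by case: (f x) (g x) => [? ?] [? ?] /=; rewrite mulrN.
Qed.

Definition L2_inner (u v : L2) : R[i] :=
  cintegral (fun x => sqint_fun (repr u) x * (sqint_fun (repr v) x)^*).

Lemma L2_innerE (f g : sqintType) :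
  L2_inner (\pi_L2 f) (\pi_L2 g) = cintegral (fun x => f x * (g x)^*).
Proof.
apply: ae_eq_cintegral; [exact: sqint_mul|exact: sqint_mul|].
by apply: filterS2 (L2_reprP f) (L2_reprP g) => x -> ->.
Qed.

Let L2_inner_lin a u v w :
  L2_inner (a *: u + v) w = a * L2_inner u w + L2_inner v w.
Proof.
rewrite -[u]reprK -[v]reprK -[w]reprK -[_ *: _]/(L2_scale _ _) pi_L2_scale.
rewrite -pi_L2D !L2_innerE -cintegral_lin; try exact: sqint_mul.
congr cintegral; apply/funext => x.
by rewrite mulrA -mulrDl.
Qed.

Let L2_inner_herm u v :
  L2_inner u v = (-1) ^+ false * @Num.conj R[i] (L2_inner v u).
Proof.
rewrite expr0 mul1r -[RHS]/((L2_inner v u)^*) -cintegral_conj.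
  congr cintegral; apply/funext => x.
  by rewrite rmorphM /= conjcK mulrC.
exact: sqint_mul.
Qed.

Let L2_inner_bilinear :
  bilinear_for *%R (@Num.conj R[i] \; *%R) L2_inner.
Proof.
split=> [w a u v|w a u v]; first exact: L2_inner_lin.
rewrite L2_inner_herm L2_inner_lin expr0 mul1r rmorphD rmorphM /=.
by rewrite (L2_inner_herm w u) (L2_inner_herm w v) !expr0 !mul1r.
Qed.

HB.instance Definition _ :=
  bilinear_isBilinear.Build R[i] L2 L2 R[i] *%R (@Num.conj R[i] \; *%R)
    L2_inner L2_inner_bilinear.

HB.instance Definition _ :=
  @isHermitianSesquilinear.Build R[i] L2 false (@Num.conj R[i])
    L2_inner L2_inner_herm.

Let L2_inner_gt0 u : u != 0 -> 0 < L2_inner u u.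
Proof.
rewrite -{1}[u]reprK; set f : sqintType := repr u => u0.
have [fr fi] := sqintP f.
have e : L2_inner u u = (\int[mu]_x (Re (f x) ^+ 2 + Im (f x) ^+ 2))%R%:C.
  rewrite /L2_inner /cintegral -/f.
  congr (_ +i* _).
    apply: eq_Rintegral => x _.
    by case: (f x) => ? ? /=; rewrite mulrN opprK !expr2.
  rewrite (_ : 0 = \int[mu]_x (cst 0 x))%R; last by rewrite Rintegral_cst ?mul0r.
  apply: eq_Rintegral => x _.
  by case: (f x) => a b /=; rewrite mulrN mulrC addrC subrr.
have int2 : mu.-integrable setT
    (EFin \o (fun x => Re (f x) ^+ 2 + Im (f x) ^+ 2)).
  have := integrableD measurableT
    (Lfun2_integrable_sqr fr) (Lfun2_integrable_sqr fi).
  by congr integrable; apply/funext.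
rewrite e ltcR lt_neqAle; apply/andP; split; last first.
  by apply: Rintegral_ge0 => x _; rewrite addr_ge0 ?sqr_ge0.
apply: contra u0 => /eqP i0.
rewrite -[0 in X in _ == X](_ : \pi_L2 0 = 0); last by rewrite !piE.
apply/L2_piP.
have : (\int[mu]_x `|(Re (f x) ^+ 2 + Im (f x) ^+ 2)%:E| = 0)%E.
  rewrite -[RHS](_ : (0 : R)%:E = 0%E) // i0 /Rintegral fineK.
    by apply: eq_integral => x _; rewrite gee0_abs // lee_fin addr_ge0 ?sqr_ge0.
  exact: integrable_fin_num.
move/ae_eq_integral_abs => /(_ measurableT (measurable_int _ int2)).
apply: filterS => x /(_ I) /(congr1 fine) /= e0; move/eqP: e0.
rewrite paddr_eq0 ?sqr_ge0 // !sqrf_eq0 => /andP[/eqP r0 /eqP im0].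
rewrite -[RHS]/(0 : R[i]).
by move: r0 im0; case: (f x) => ? ? /= -> ->.
Qed.
HB.instance Definition _ :=
  @isDotProduct.Build R[i] L2 L2_inner L2_inner_gt0.

HB.instance Definition _ :=
  hasInner.Build R L2 (L2_inner : {dot L2 for @Num.conj R[i]}).

End L2.

(* A homomorphism from [G] to the unitary operators of an inner product space; no
   completeness and no continuity is required. *)
Record unitary_action (R : realType) (G : groupType) (H : prehilbertType R) :=
  UnitaryAction {
    act :> G -> {linear H -> H};
    act1 : forall x, act 1%g x = x;
    actM : forall g h x, act (g * h)%g x = act g (act h x);
    act_inner : forall g x y, inner (act g x) (act g y) = inner x y
  }.

Record unitary_rep (R : realType) (G : topGroupType) (H : hilbertType R) :=
  UnitaryRep {
    rep_action :> unitary_action G H;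
    rep_continuous : forall x : H, continuous (fun g => rep_action g x)
  }.

Definition coefficient (R : realType) (G : groupType) (H : prehilbertType R)
    (pi : unitary_action G H) (x y : H) : G -> R[i] :=
  fun g => inner (pi g x) y.

(* Fell's weak containment: every function of positive type associated with [pi] is
   a limit, uniformly on compact sets, of finite sums of functions of positive type
   associated with [rho]. *)
Definition weakly_contained (R : realType) (G : topGroupType)
    (H K : prehilbertType R)
    (pi : unitary_action G H) (rho : unitary_action G K) :=
  forall (x : H) (Q : set G) (e : R), compact Q -> 0 < e ->
    exists s : seq K, forall g, Q g ->
      `|coefficient pi x x g - \sum_(y <- s) coefficient rho y y g| < e%:C.

Definition C0 (R : realType) (G : topologicalType) (f : G -> R[i]) :=
  continuous (f : G -> R[i]^o) /\
  forall e : R, 0 < e ->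
    exists2 Q : set G, compact Q & forall g, ~ Q g -> `|f g| < e%:C.

Definition mixing (R : realType) (G : topGroupType) (H : prehilbertType R)
    (pi : unitary_action G H) := forall x y : H, C0 (coefficient pi x y).

Definition borel (G : ptopologicalType) := g_sigma_algebraType (@open G).

(* A left Haar measure: a nonzero left-invariant Radon measure. *)
Record haar_measure (R : realType) (G : topGroupType) := HaarMeasure {
  haar :> {measure set (borel G) -> \bar R};
  haar_left_invariant : forall (g : G) (A : set (borel G)), measurable A ->
    haar [set (g * x)%g | x in A] = haar A;
  haar_neq0 : haar [set: G] <> 0%E;
  haar_compact : forall Q : set G, compact Q -> (haar Q < +oo)%E;
  haar_outer_regular : forall A : set (borel G), measurable A ->
    haar A = ereal_inf [set haar U | U in [set U : set G | open U /\ A `<=` U]];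
  haar_inner_regular : forall U : set G, open U ->
    haar U = ereal_sup
      [set haar Q | Q in [set Q : set G | compact Q /\ Q `<=` U]]
}.

Section RegularRep.
Variables (R : realType) (G : topGroupType) (mu : haar_measure R G).

Definition ltrans (T : Type) (g : G) (f : G -> T) : G -> T :=
  fun x => f (g^-1 * x)%g.

Lemma lmul_measurable (g : G) :
  measurable_fun [set: borel G] ((fun x => g * x)%g : borel G -> borel G).
Proof.
apply: (@measurability _ _ (borel G) (borel G) setT _ (@open G)) => // _ [U oU <-].
apply: sub_sigma_algebra; rewrite setTI.
apply: (open_comp _ oU) => x _.
apply: (@continuous_comp G (G * G)%type G (fun x => (g, x))
  (fun y => (y.1 * y.2)%g)); last exact: mulg_continuous.
by apply: cvg_pair; [exact: cvg_cst|exact: cvg_id].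
Qed.

Lemma haar_lpreimage g (A : set (borel G)) : measurable A ->
  mu ((fun x => (g * x)%g : borel G) @^-1` A) = mu A.
Proof.
move=> mA; rewrite -(@haar_left_invariant _ _ mu g^-1%g A mA); congr (mu _).
apply/seteqP; split=> x /=.
  by move=> gxA; exists (g * x)%g => //; rewrite mulKg.
by move=> [y yA <-]; rewrite mulVKg.
Qed.

Lemma ge0_integral_ltrans g (f : borel G -> \bar R) :
  measurable_fun setT f -> (forall x, 0 <= f x)%E ->
  (\int[mu]_x f (g * x)%g = \int[mu]_x f x)%E.
Proof.
move=> mf f0.
have := ge0_integral_pushforward (lmul_measurable g) mu measurableT mf
  (fun x _ => f0 x).
rewrite preimage_setT => <-.
by apply: eq_measure_integral => [|mt A mA _];
  [exact: lmul_measurable|exact: haar_lpreimage].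
Qed.

Lemma Lfun2_ltrans g (f : borel G -> R) :
  f \in Lfun mu 2%:E -> ltrans g f \in Lfun mu 2%:E.
Proof.
rewrite !inE => /andP[]; rewrite !inE /= => mf; rewrite /finite_norm => nf.
have mgf : measurable_fun [set: borel G] (ltrans g f).
  by apply: (measurableT_comp mf); exact: lmul_measurable.
apply/andP; rewrite !inE /=; split => //.
apply: le_lt_trans nf; rewrite unlock.
pose F (x : borel G) := (`|(f x)%:E| `^ 2)%E.
rewrite -[X in (_ <= X `^ _)%E](@ge0_integral_ltrans g^-1%g F) //.
  by apply: (measurableT_comp (@measurable_poweR R 2));
     apply: (measurableT_comp (@abse_measurable R setT)); exact/measurable_EFinP.
by move=> x; exact: poweR_ge0.
Qed.

Lemma integral_ltrans g (f : borel G -> \bar R) : measurable_fun setT f ->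
  (\int[mu]_x f (g * x)%g = \int[mu]_x f x)%E.
Proof.
move=> mf; rewrite integralE [RHS]integralE; congr (_ - _)%E.
  by rewrite -(@ge0_integral_ltrans g (f^\+)%E) //;
    [apply: eq_integral => x _; rewrite !funeposE|exact: measurable_funepos].
by rewrite -(@ge0_integral_ltrans g (f^\-)%E) //;
    [apply: eq_integral => x _; rewrite !funenegE|exact: measurable_funeneg].
Qed.

Lemma sqint_ltrans g (f : borel G -> R[i]) :
  f \in sqint mu -> ltrans g f \in sqint mu.
Proof.
rewrite !inE /= => -[fr fi].
by split; [exact: (Lfun2_ltrans g fr)|exact: (Lfun2_ltrans g fi)].
Qed.

Lemma ae_ltrans g (P : set (borel G)) :
  (\forall x \ae mu, P x) -> (\forall x \ae mu, P (g * x)%g).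
Proof.
move=> [N [mN N0 PN]].
exists ((fun x => (g * x)%g : borel G) @^-1` N); split.
- by rewrite -[X in measurable X]setTI; exact: lmul_measurable.
- by rewrite haar_lpreimage.
- by move=> x /= nP; apply: PN.
Qed.

Definition sqint_ltransf g (f : sqintType mu) : sqintType mu :=
  exist (fun f => f \in sqint mu) (ltrans g (sqint_fun f)) (sqint_ltrans g (valP f)).

Definition reg_act (g : G) (u : L2 mu) : L2 mu :=
  \pi_(L2 mu) (sqint_ltransf g (repr u)).

Lemma reg_actE g (f : sqintType mu) :
  reg_act g (\pi f) = \pi_(L2 mu) (sqint_ltransf g f).
Proof. by apply/eqP/L2_piP; apply: ae_ltrans (L2_reprP f). Qed.

Let reg_act_linear g : linear (reg_act g).
Proof.
move=> a u v; rewrite -[u]reprK -[v]reprK !reg_actE.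
rewrite -![_ *: _]/(L2_scale _ _) !pi_L2_scale -!pi_L2D reg_actE.
by congr (\pi _); apply/val_inj/funext.
Qed.

HB.instance Definition _ g :=
  GRing.isLinear.Build R[i] (L2 mu) (L2 mu) *:%R (reg_act g) (reg_act_linear g).

Let reg_act1 u : reg_act 1%g u = u.
Proof.
rewrite -[u]reprK reg_actE; congr (\pi _); apply/val_inj/funext => x.
by rewrite /= /ltrans invg1 mul1g.
Qed.

Let reg_actM g h u : reg_act (g * h)%g u = reg_act g (reg_act h u).
Proof.
rewrite -[u]reprK (reg_actE h) !reg_actE.
congr (\pi _); apply/val_inj/funext => x.
by rewrite /= /ltrans /sqint_fun /= /ltrans invgM -mulgA.
Qed.

Let reg_act_inner g u v : inner (reg_act g u) (reg_act g v) = inner u v.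
Proof.
rewrite -[u]reprK -[v]reprK !reg_actE.
rewrite -[LHS]/(L2_inner _ _) -[RHS]/(L2_inner _ _) !L2_innerE.
have [ir ii] := sqint_mul (repr u) (repr v).
rewrite /cintegral /Rintegral; congr (fine _ +i* fine _).
  apply: (@integral_ltrans g^-1%g
    (fun x => (Re (sqint_fun (repr u) x * (sqint_fun (repr v) x)^*))%:E)).
  by apply/measurable_EFinP; exact: (Lfun1_meas ir).
apply: (@integral_ltrans g^-1%g
    (fun x => (Im (sqint_fun (repr u) x * (sqint_fun (repr v) x)^*))%:E)).
by apply/measurable_EFinP; exact: (Lfun1_meas ii).
Qed.

Definition regular_rep : unitary_action G (L2 mu) :=
  @UnitaryAction R G (L2 mu) (fun g => reg_act g : {linear L2 mu -> L2 mu})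
    reg_act1 reg_actM reg_act_inner.

End RegularRep.

(* Main.v *)
Require Import Defs.
From HB Require Import structures.
From mathcomp Require Import all_boot all_order all_algebra perm.
From mathcomp Require Import generic_quotient complex.
From mathcomp Require Import finmap all_classical all_reals all_analysis.
From mathcomp Require Import measurable_realfun.
From mathcomp Require Import ring lra.

Set Implicit Arguments.
Unset Strict Implicit.
Unset Printing Implicit Defensive.

Import Order.TTheory GRing.Theory Num.Theory.
Import numFieldNormedType.Exports.

(* Let K be the stabiliser of finitely many chambers, C among them, and almost
   fixing a given vector x. By weak containment the coefficient of x at g is, up
   to a small error, a sum of coefficients of the regular representation on
   K g K; replacing the L2-functions by their absolute values only enlarges these,
   and then all terms are nonnegative, so that one may average over the double
   coset of the whole stabiliser B of C. The averaged coefficient is that of the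
   B-invariant vectors, i.e. of functions on chambers, and is governed by the
   operator averaging over all D with delta(., D) = delta(C, g C). For a reduced
   word this operator is the product of the averages over the letters, so it
   suffices that every sufficiently long reduced word contracts l2 by a fixed
   factor. That follows from a spectral gap: if the generators J generate an
   infinite residue (J minimal), no function on chambers is almost invariant under
   all of them. To see the gap, combine the averages over the residues of the
   finite types K in J, evaluated at gates, with signs (-1)^|K|: the contributions
   cancel and leave a multiple of the total mass whose coefficient, an Euler sum of
   the (-1)^|K| / |R_K|, is nonzero by reduction modulo a prime dividing one of the valencies. *)

(** * Words and word length in a Coxeter system *)

Section Words.
Variables (W : coxeterSystem) (I : finType) (e : I -> W).
Hypothesis eS : forall i, cox_gens W (e i).
Hypothesis e_onto : forall s, cox_gens W s -> exists i, e i = s.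
Local Open Scope group_scope.

(** In general [x] is fixed by no open subgroup, and K may be much smaller than B. The approximants
    given by weak containment, in contrast, depend on [g]. What is uniform is their total norm,
    controlled by evaluating at the identity; the index of their own invariance group cancels,
    because the lower bound holds on all of K g K.

    The gap is proved in l1, where picking gates can be compared with averaging over residues, and
    carried to l2 by squaring. It reaches words through their length alone: a reduced word longer
    than every reduced word over a spherical set has letters generating an infinite residue, and if
    it hardly shrinks [f], then [f] is almost invariant under each of its letters.

    The presentation of the Coxeter group enters through the parity of lengths; the exchange
    condition is then read off the thick building. *)

Definition wlen (v : W) : nat := word_length (cox_gens W) v.
Definition word_val (w : seq I) : W := \prod_(i <- w) e i.
Definition reduced (w : seq I) : bool := wlen (word_val w) == size w.

Lemma word_val_nil : word_val [::] = 1.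
Proof. by rewrite /word_val big_nil. Qed.

Lemma word_val_cons i w : word_val (i :: w) = e i * word_val w.
Proof. by rewrite /word_val big_cons. Qed.

Lemma word_val_cat u w : word_val (u ++ w) = word_val u * word_val w.
Proof. by rewrite /word_val big_cat. Qed.

Lemma gen_sq i : e i * e i = 1.
Proof. by have [] := cox_invol (cox_systemP W) (eS i). Qed.

Lemma gen_neq1 i : e i != 1.
Proof. by have [] := cox_invol (cox_systemP W) (eS i). Qed.

Lemma gen_inv i : (e i)^-1 = e i.
Proof. by rewrite -[RHS]mulg1 -(mulgV (e i)) mulgA gen_sq mul1g. Qed.

Lemma gen_mulK i v : e i * (e i * v) = v.
Proof. by rewrite mulgA gen_sq mul1g. Qed.

Lemma word_val_rev w : word_val (rev w) = (word_val w)^-1.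
Proof.
elim: w => [|i w IH]; first by rewrite /= word_val_nil invg1.
by rewrite rev_cons -cats1 word_val_cat IH !word_val_cons word_val_nil mulg1
  invgM gen_inv.
Qed.

Lemma is_wordP n v :
  is_word (cox_gens W) n v <-> exists2 w, size w = n & word_val w = v.
Proof.
split=> [[s [<- sS <-]]|[w <- <-]].
  elim: s sS => [|x s IH] sS; first by exists [::]; rewrite // word_val_nil big_nil.
  have [|w ws wv] := IH; first by move=> y ys; apply: sS; rewrite inE ys orbT.
  have [i ix] := e_onto (sS x (mem_head _ _)).
  by exists (i :: w); rewrite /= ?ws // word_val_cons big_cons wv ix.
exists (map e w); split; first by rewrite size_map.
  by move=> x /mapP[i _ ->].
by rewrite /word_val big_map.
Qed.

Lemma wlenP v : is_word (cox_gens W) (wlen v) v /\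
  forall m, is_word (cox_gens W) m v -> (wlen v <= m)%N.
Proof.
rewrite /wlen /word_length; case: xgetP => [n _ //|].
have ex : exists n, `[< is_word (cox_gens W) n v >].
  by have [n ?] := cox_gen (cox_systemP W) v; exists n; apply/asboolP.
move=> /(_ (ex_minn ex)) []; case: ex_minnP => n /asboolP nv nmin.
by split=> // m mv; apply: nmin; apply/asboolP.
Qed.

Lemma wlen_word_val w : (wlen (word_val w) <= size w)%N.
Proof. by apply: (wlenP _).2; apply/is_wordP; exists w. Qed.

Lemma ex_reduced v : exists2 w, reduced w & word_val w = v.
Proof.
have /is_wordP[w ws wv] := (wlenP v).1.
by exists w => //; rewrite /reduced wv ws.
Qed.

Lemma wlen1 : wlen 1 = 0.
Proof. by apply/eqP; rewrite -leqn0 -word_val_nil wlen_word_val. Qed.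

Lemma wlen_eq0 v : wlen v = 0 -> v = 1.
Proof.
have [w /eqP r <-] := ex_reduced v; rewrite r => /size0nil ->.
exact: word_val_nil.
Qed.

Lemma wlen_inv v : wlen v^-1 = wlen v.
Proof.
suff H x : (wlen x^-1 <= wlen x)%N.
  by apply/eqP; rewrite eqn_leq H /= -{1}[v]invgK H.
have [w /eqP r <-] := ex_reduced x; rewrite r -word_val_rev.
by rewrite (leq_trans (wlen_word_val _)) ?size_rev.
Qed.

Lemma wlenM u v : (wlen (u * v) <= wlen u + wlen v)%N.
Proof.
have [x /eqP rx <-] := ex_reduced u; have [y /eqP ry <-] := ex_reduced v.
by rewrite rx ry -word_val_cat -size_cat; exact: wlen_word_val.
Qed.

Lemma wlen_gen i : wlen (e i) = 1%N.
Proof.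
apply/eqP; rewrite eqn_leq; apply/andP; split.
  by rewrite (leq_trans _ (wlen_word_val [:: i])) // word_val_cons word_val_nil mulg1.
rewrite lt0n; apply/eqP => /wlen_eq0 /eqP; rewrite (negbTE (gen_neq1 i)); by [].
Qed.

Lemma reduced_catl u w : reduced (u ++ w) -> reduced u.
Proof.
move=> /eqP; rewrite word_val_cat size_cat => h.
rewrite /reduced eqn_leq wlen_word_val /=.
have := wlenM (word_val u) (word_val w); rewrite h.
by move=> /leq_trans /(_ (leq_add (leqnn _) (wlen_word_val w))); rewrite leq_add2r.
Qed.

Lemma reduced_catr u w : reduced (u ++ w) -> reduced w.
Proof.
move=> /eqP; rewrite word_val_cat size_cat => h.
rewrite /reduced eqn_leq wlen_word_val /=.
have := wlenM (word_val u) (word_val w); rewrite h.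
by move=> /leq_trans /(_ (leq_add (wlen_word_val u) (leqnn _))); rewrite leq_add2l.
Qed.

Lemma reduced_behead i w : reduced (i :: w) -> reduced w.
Proof. exact: (@reduced_catr [:: i]). Qed.

Lemma reduced_rev w : reduced (rev w) = reduced w.
Proof. by rewrite /reduced word_val_rev wlen_inv size_rev. Qed.

(** The sign character: by [cox_pres], sending every generator to one and the same transposition
    extends to a homomorphism. *)
Lemma odd_wlen w : odd (wlen (word_val w)) = odd (size w).
Proof.
have [phi phiM phiS] : exists2 phi : W -> {perm bool},
    {morph phi : x y / x * y} & forall s, cox_gens W s -> phi s = tperm false true.
  apply: (cox_pres (cox_systemP W) (f := fun=> tperm false true)) => s t _ _ n _.
  by rewrite tperm2 expg1n.
have phi1 : phi 1 = 1 by apply: (mulgI (phi 1)); rewrite -phiM !mulg1.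
have phiW u : odd (size u) = odd_perm (phi (word_val u)).
  elim: u => [|i u IH]; first by rewrite word_val_nil phi1 odd_perm1.
  by rewrite word_val_cons phiM (phiS _ (eS i)) odd_permM odd_tperm /= IH.
have [u /eqP r uw] := ex_reduced (word_val w).
by rewrite phiW -uw r phiW.
Qed.

End Words.

Lemma subseq_delete (T : eqType) (x w : seq T) : subseq x w ->
  size w = (size x).+1 ->
  exists w1 j w2, w = w1 ++ j :: w2 /\ x = w1 ++ w2.
Proof.
elim: w x => [|j w IH] [|k x] //=.
  by move=> _ [/size0nil ->]; exists [::], j, [::].
case: eqP => [->|_] sx [sz].
  by have [w1 [l [w2 [-> ->]]]] := IH _ sx sz; exists (j :: w1), l, w2.
exists [::], j, w; split => //=; apply/eqP.
by rewrite -(size_subseq_leqif sx).2 /= sz.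
Qed.

(** * Galleries and the exchange condition *)

Section Galleries.
Variables (W : coxeterSystem) (X : building W) (I : finType) (e : I -> W).
Hypothesis eS : forall i, cox_gens W (e i).
Hypothesis e_onto : forall s, cox_gens W s -> exists i, e i = s.
Local Open Scope group_scope.
Local Notation val := (word_val e).
Local Notation red := (reduced e).

Lemma wdistxx (C : X) : wdist C C = 1.
Proof. exact/wdist_eq1. Qed.

Lemma wdist_step i (C D E : X) : wdist C D = e i ->
  wdist C E = e i * wdist D E \/ wdist C E = wdist D E.
Proof. by move=> CD; have [] := @wdist_adj _ X D C E _ (eS i) CD. Qed.

Lemma wdist_up i (C D E : X) : wdist C D = e i ->
  wlen (e i * wdist D E) = (wlen (wdist D E)).+1 -> wdist C E = e i * wdist D E.
Proof. by move=> CD; have [] := @wdist_adj _ X D C E _ (eS i) CD. Qed.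

Lemma wdist_gen_sym i (C D : X) : wdist C D = e i -> wdist D C = e i.
Proof.
move=> CD; have [] := wdist_step C CD; rewrite wdistxx => h.
  by rewrite -[LHS](gen_mulK eS i) -h mulg1.
by move/esym/wdist_eq1: h CD => <-; rewrite wdistxx => h; move: (gen_neq1 eS i); rewrite -h eqxx.
Qed.

Fixpoint gallery (w : seq I) (C D : X) : Prop :=
  if w is i :: w' then exists2 E, wdist C E = e i & gallery w' E D else C = D.

Lemma gallery_cat u w C D :
  gallery (u ++ w) C D <-> exists2 E, gallery u C E & gallery w E D.
Proof.
elim: u C => [|i u IH] C /=.
  by split=> [|[E -> //]]; exists C.
split=> [[E CE /IH[F ? ?]]|[F [E CE ?] ?]].
  by exists F => //; exists E.
by exists E => //; apply/IH; exists F.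
Qed.

Lemma gallery_rev w C D : gallery w C D -> gallery (rev w) D C.
Proof.
elim: w C => [|i w IH] C /=; first by move=> ->.
move=> [E CE /IH ?]; rewrite rev_cons -cats1; apply/gallery_cat.
by exists E => //; exists C => //; apply: wdist_gen_sym.
Qed.

(** Going back along the gallery, each step either multiplies the Weyl distance to [E] by its letter
    or leaves it unchanged; [w'] collects the letters of the first kind. *)
Lemma gallery_subseq w (C D E : X) : gallery w C D ->
  exists2 w', subseq w' w & wdist C E = val w' * wdist D E.
Proof.
elim: w C => [|i w IH] C /=.
  by move=> ->; exists [::]; rewrite // word_val_nil mul1g.
move=> [F CF /IH[w' sw' h]]; have [] := wdist_step E CF => ->; rewrite h.
  by exists (i :: w'); rewrite /= ?eqxx // word_val_cons mulgA.
by exists w' => //; exact: (subseq_trans sw' (subseq_cons _ _)).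
Qed.

Lemma wdist_gallery w (C D : X) v : wdist C D = val w * v ->
  exists2 E, gallery w C E & wdist E D = v.
Proof.
elim: w C => [|i w IH] C; first by rewrite word_val_nil mul1g; exists C.
rewrite word_val_cons -mulgA => CD.
have [F [FC]] := wdist_ex C D (eS i).
rewrite CD gen_mulK // => /IH[E FE ED].
by exists E => //; exists F => //; apply: wdist_gen_sym.
Qed.

Lemma wdist_gallery1 w (C D : X) : wdist C D = val w -> gallery w C D.
Proof.
rewrite -[val w]mulg1 => /wdist_gallery[E ? /wdist_eq1 ED]; by rewrite -ED.
Qed.

Lemma gallery_wdist w (C D : X) : gallery w C D -> red w -> wdist C D = val w.
Proof.
elim: w C => [|i w IH] C /=; first by move=> -> _; rewrite wdistxx word_val_nil.
move=> [E CE ED] r; have rw := reduced_behead eS e_onto r.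
rewrite word_val_cons -(IH E) //; apply: wdist_up => //.
by rewrite (IH E) // -word_val_cons (eqP r) (eqP rw).
Qed.

(** Not an axiom of [building]: reverse a gallery of reduced type. *)
Lemma wdistV (C D : X) : wdist D C = (wdist C D)^-1.
Proof.
have [w r wv] := ex_reduced eS e_onto (wdist C D).
rewrite -wv -(word_val_rev eS); apply: gallery_wdist; last by rewrite reduced_rev.
exact/gallery_rev/wdist_gallery1.
Qed.

Lemma ex_wdist (D : X) v : exists C : X, wdist D C = v.
Proof.
have [w r wv] := ex_reduced eS e_onto v.
have : wdist D D = val w * (val w)^-1 by rewrite mulgV wdistxx.
move=> /wdist_gallery[E DE _]; exists E; rewrite -wv; exact: gallery_wdist.
Qed.

Hypothesis thickX : thick X.
Variable C0 : X.

(* Two chambers [C1 <> C2] of one panel at the same distance [word_val w] from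
   [D]: comparing along a gallery of type [w] from [C1] to [D], [C2] must lose
   exactly one letter. *)
Lemma exchange i w : red w -> ~~ red (i :: w) ->
  exists w1 j w2, w = w1 ++ j :: w2 /\ val w = e i * val (w1 ++ w2).
Proof.
move=> rw niw; set v := val w.
have lv : wlen (e i * v) < wlen v.
  have h1 : wlen (e i * v) <= (wlen v).+1.
    by rewrite (leq_trans (wlenM eS e_onto _ _)) // wlen_gen.
  have h2 : odd (wlen (e i * v)) = ~~ odd (wlen v).
    by rewrite -word_val_cons !odd_wlen.
  have h3 : wlen (e i * v) != (wlen v).+1.
    by move: niw; rewrite /reduced word_val_cons /= -(eqP rw).
  rewrite ltn_neqAle -ltnS ltn_neqAle h3 h1 !andbT.
  by apply/eqP => h; move: h2; rewrite h; case: odd.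
(* [C] is the chamber of its [i]-panel nearest to [C0], so all other chambers of the panel are at
   distance [v]; by thickness there are two of them. *)
have [C C0C] := ex_wdist C0 (e i * v)^-1.
have CC0 : wdist C C0 = e i * v by rewrite wdistV C0C invgK.
have up E : wdist C E = e i -> wdist E C0 = v.
  move=> /wdist_gen_sym EC; rewrite (wdist_up EC) CC0 gen_mulK //.
  apply/eqP; rewrite eqn_leq lv andbT.
  have := wlenM eS e_onto (e i) (e i * v).
  by rewrite gen_mulK // wlen_gen // add1n.
have [C1 [C2 [C1i C2i C12]]] : exists C1 C2 : X,
    [/\ wdist C C1 = e i, wdist C C2 = e i & C1 <> C2].
  have [D1 [D2 [D3 [P1 P2 P3 [n12 n13 n23]]]]] := thickX C (eS i).
  have P D : panel (e i) C D -> C = D \/ wdist C D = e i.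
    by move=> [/wdist_eq1|]; [left|right].
  case: (P _ P1) => [e1|d1]; case: (P _ P2) => [e2|d2]; case: (P _ P3) => [e3|d3];
    try (by case: n12; rewrite -e1 -e2); try (by case: n13; rewrite -e1 -e3);
    try (by case: n23; rewrite -e2 -e3);
    [by exists D2, D3|by exists D1, D3|by exists D1, D2|by exists D1, D2].
have C21 : wdist C2 C1 = e i.
  have [|->//] := wdist_step C1 (wdist_gen_sym C2i).
  by rewrite C1i gen_sq // => /wdist_eq1 /esym /C12.
have g1 := gallery_rev (wdist_gallery1 (up _ C1i)).
have [u su] := gallery_subseq C2 g1.
rewrite [RHS](_ : _ = val (rcons u i)); last first.
  by rewrite -cats1 word_val_cat word_val_cons word_val_nil mulg1 (wdist_gen_sym C21).
rewrite wdistV (up _ C2i) => vu.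
have {}vu : v = e i * val (rev u).
  by rewrite -[v]invgK vu -word_val_rev // rev_rcons word_val_cons.
have {su} : subseq (rev u) w by rewrite -[w]revK subseq_rev.
move: (rev u) vu => {g1} x vx sx.
have [|w1 [j [w2 [e1 e2]]]] := subseq_delete sx; last first.
  by exists w1, j, w2; rewrite -e2 -vx.
(* [x] misses at most one letter since [w] is reduced, and at least one by parity. *)
apply/eqP; rewrite eqn_leq; apply/andP; split.
  by rewrite -(eqP rw) -/v vx -word_val_cons wlen_word_val.
rewrite ltn_neqAle (size_subseq sx) andbT; apply/eqP => xw.
have := odd_wlen eS e_onto (i :: x).
by rewrite word_val_cons -vx (eqP rw) -xw /=; case: odd.
Qed.

End Galleries.

Lemma cat_eq_split (T : Type) (a b c d : seq T) j : a ++ b = c ++ j :: d ->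
  (exists2 x, a = c ++ j :: x & d = x ++ b) \/
  (exists2 x, b = x ++ j :: d & c = a ++ x).
Proof.
elim: a c => [|k a IH] [|l c] //=.
- by move=> ->; right; exists [::].
- by move=> ->; right; exists (l :: c).
- by move=> [-> <-]; left; exists a.
move=> [-> /IH[[x -> ->]|[x -> ->]]]; [left|right]; by exists x.
Qed.

(** * Residues, gates and descents *)

Section Residues.
Variables (W : coxeterSystem) (X : building W) (I : finType) (e : I -> W).
Hypothesis eS : forall i, cox_gens W (e i).
Hypothesis e_onto : forall s, cox_gens W s -> exists i, e i = s.
Hypothesis thickX : thick X.
Variable C0 : X.
Local Open Scope classical_set_scope.
Local Open Scope group_scope.
Local Notation val := (word_val e).
Local Notation red := (reduced e).
Local Notation gal := (gallery e).

Definition dist (C D : X) : nat := wlen (wdist C D).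

Lemma distxx C : dist C C = 0%N.
Proof. by rewrite /dist wdistxx (wlen1 eS e_onto). Qed.

Lemma dist_eq0 C D : dist C D = 0%N -> C = D.
Proof. by move=> /(wlen_eq0 eS e_onto) /wdist_eq1. Qed.

Lemma dist_sym C D : dist C D = dist D C.
Proof. by rewrite /dist (wdistV eS e_onto) (wlen_inv eS e_onto). Qed.

Lemma dist_gallery w C D : gal w C D -> dist C D <= size w.
Proof.
move=> /(gallery_subseq eS D)[w' sw]; rewrite /dist wdistxx mulg1 => ->.
exact: leq_trans (wlen_word_val eS e_onto _) (size_subseq sw).
Qed.

Lemma ex_gallery C D : exists w, [/\ red w, gal w C D & size w = dist C D].
Proof.
have [w r wv] := ex_reduced eS e_onto (wdist C D).
exists w; split => //; first exact: wdist_gallery1.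
by rewrite /dist -wv (eqP r).
Qed.

Definition residue (K : {set I}) (C : X) : set X :=
  [set D | exists2 w, all (mem K) w & gal w C D].

Lemma residue_refl K C : residue K C C.
Proof. by exists [::]. Qed.

Lemma residue_sym K C D : residue K C D -> residue K D C.
Proof.
by move=> [w Kw /(gallery_rev eS) ?]; exists (rev w); rewrite ?all_rev.
Qed.

Lemma residue_trans K D C E : residue K C D -> residue K D E -> residue K C E.
Proof.
move=> [u Ku gu] [v Kv gv]; exists (u ++ v); first by rewrite all_cat Ku.
by apply/gallery_cat; exists D.
Qed.

Lemma residue_eq K C D : residue K C D -> residue K C = residue K D.
Proof.
move=> CD; apply/seteqP; split=> E; last exact: residue_trans.
exact/residue_trans/residue_sym.
Qed.

Lemma residueS (K L : {set I}) C : K \subset L -> residue K C `<=` residue L C.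
Proof.
move=> /fintype.subsetP KL D [w Kw ?]; exists w => //.
by apply: sub_all Kw => i /=; exact: KL.
Qed.

Lemma residue1 (K : {set I}) i C D : i \in K -> wdist C D = e i -> residue K C D.
Proof. by move=> iK CD; exists [:: i]; rewrite /= ?iK //; exists D. Qed.

(** The deletion condition: at the shortest non-reduced suffix [exchange] removes two letters and
    brings in none, so the induction stays over [K]. *)
Lemma reduced_word (K : {set I}) w : all (mem K) w ->
  exists w', [/\ all (mem K) w', red w' & val w' = val w].
Proof.
have [n] := ubnP (size w); elim: n w => // n IH w; rewrite ltnS => wn Kw.
have [r|] := boolP (red w); first by exists w.
elim: w wn Kw => [|i w IHw] /=; first by rewrite /reduced word_val_nil (wlen1 eS e_onto).
move=> wn /andP[Ki Kw] nr.
have [r|nrw] := boolP (red w).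
  have [w1 [j [w2 [ew h]]]] := exchange eS e_onto thickX C0 r nr.
  have [||w' [Kw' rw' vw']] := IH (w1 ++ w2).
  - by rewrite (leq_trans _ wn) // ew !size_cat /= addnS.
  - by move: Kw; rewrite ew !all_cat /= => /and3P[-> _ ->].
  by exists w'; split => //; rewrite vw' word_val_cons h gen_mulK.
have [w' [Kw' rw' vw']] := IHw (ltnW wn) Kw nrw.
have [||w'' [? ? h]] := IH (i :: w').
- rewrite /= -(eqP rw') vw' (leq_trans _ wn) // ltnS ltn_neqAle.
  by rewrite wlen_word_val // andbT; exact: nrw.
- by rewrite /= Ki.
by exists w''; split => //; rewrite h !word_val_cons vw'.
Qed.

Lemma residue_word K C D : residue K C D ->
  exists w, [/\ all (mem K) w, red w, gal w C D & wdist C D = val w].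
Proof.
move=> [w Kw /(gallery_subseq eS D)[w' sw]]; rewrite wdistxx mulg1 => wv.
have [|v [Kv rv vv]] := @reduced_word K w'.
  by apply/allP => x xw; apply: (allP Kw); exact: (mem_subseq sw).
exists v; split => //; rewrite ?vv //; apply: wdist_gallery1 => //.
by rewrite vv.
Qed.

(** [D] is the projection of [C] to the [K]-residue that contains [D]. *)
Definition is_gate (K : {set I}) (C D : X) : Prop :=
  forall E, residue K D E -> dist C D <= dist C E.

(** Prepend the letters of [u] to [v] one at a time. If reducedness fails, [exchange] deletes a
    letter of [u], which [ru] forbids, or a letter of [v], which yields a chamber of the residue
    nearer to [C] than [D]. *)
Lemma gate_reduced K C D u v : is_gate K C D -> red u -> wdist C D = val u ->
  all (mem K) v -> red v -> red (u ++ v).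
Proof.
move=> gD ru CD Kv rv.
suff H u2 u1 : u = u1 ++ u2 -> red (u2 ++ v) by exact: (H u [::]).
elim: u2 u1 => [//|i u2 IH] u1 eu; have {}IH := IH (rcons u1 i).
rewrite cat_rcons in IH; have {}IH := IH eu.
apply/negPn/negP => nr.
have [w1 [j [w2 [ew h]]]] := exchange eS e_onto thickX C0 IH nr.
have ri : red (i :: u2) by apply: (@reduced_catr _ _ _ eS e_onto u1); rewrite -eu.
have [[x eu2 ew2]|[x ev ew1]] := cat_eq_split ew.
  move: h; rewrite ew2 catA word_val_cat [in RHS]word_val_cat mulgA => /mulIg h.
  have := wlen_word_val eS e_onto (w1 ++ x).
  rewrite -(gen_mulK eS i (val (w1 ++ x))) -h -word_val_cons (eqP ri) /= eu2.
  by rewrite !size_cat /= addnS ltnNge leqnSn.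
have {}h : e i * val u2 = val u2 * val (x ++ w2) * val (rev v).
  rewrite (word_val_rev eS); apply: (mulIg (val v)); rewrite mulgVK.
  by rewrite -[LHS]mulgA -(word_val_cat e u2 v) h ew1 gen_mulK // -catA word_val_cat.
(* The chamber [D'] extracted from this factorisation is reached from [D] by letters of [v] only and
   joined to [C] by [u] without the letter [i]. *)
have : wdist D C = val (rev ((x ++ w2) ++ rev v)) * val (rev (u1 ++ u2)).
  rewrite !(word_val_rev eS) -invgM (wdistV eS e_onto) CD; congr (_^-1).
  by rewrite eu word_val_cat word_val_cons h !word_val_cat !mulgA.
move=> /(wdist_gallery eS)[D' gD' D'C].
have : dist C D <= dist C D'.
  apply: gD; exists (rev ((x ++ w2) ++ rev v)) => //; rewrite all_rev.
  by move: Kv; rewrite ev !all_cat all_rev all_cat /= => /and3P[-> -> ->].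
rewrite [dist C D']dist_sym /dist D'C CD (eqP ru).
move=> /leq_trans /(_ (wlen_word_val eS e_onto _)).
by rewrite size_rev eu !size_cat /= addnS ltnn.
Qed.

Lemma gate_wdist K C D E : is_gate K C D -> residue K D E ->
  wdist C E = wdist C D * wdist D E /\ dist C E = (dist C D + dist D E)%N.
Proof.
move=> gD /residue_word[v [Kv rv gv vv]].
have [u ru vu] := ex_reduced eS e_onto (wdist C D).
have ruv := gate_reduced gD ru (esym vu) Kv rv.
have CE : wdist C E = val (u ++ v).
  apply: (gallery_wdist eS e_onto) ruv; apply/gallery_cat; exists D => //.
  exact: wdist_gallery1.
by rewrite /dist CE (eqP ruv) -vu vv (eqP ru) (eqP rv) word_val_cat size_cat.
Qed.

Lemma gate_uniq K C D E : is_gate K C D -> is_gate K C E -> residue K D E -> D = E.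
Proof.
move=> gD gE DE; apply: dist_eq0; have [_ h] := gate_wdist gD DE.
have := gE _ (residue_sym DE); rewrite h -[X in _ <= X]addn0 leq_add2l leqn0.
by move/eqP.
Qed.

Lemma gate_ex K C D : exists2 E, residue K D E & is_gate K C E.
Proof.
have ex : exists n, `[< exists2 E, residue K D E & dist C E = n >].
  by exists (dist C D); apply/asboolP; exists D => //; exact: residue_refl.
case: (ex_minnP ex) => n /asboolP[E DE <-] nmin; exists E => // F EF.
by apply: nmin; apply/asboolP; exists F => //; apply: residue_trans EF.
Qed.

Lemma gateS (K L : {set I}) C D : K \subset L -> is_gate L C D -> is_gate K C D.
Proof. by move=> KL gD E /(residueS KL) /gD. Qed.

Lemma gate_up i C D E : is_gate [set i] C D -> wdist D E = e i ->
  wdist C E = wdist C D * e i /\ dist C E = (dist C D).+1.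
Proof.
move=> gD DE; have [|-> ->] := gate_wdist gD (E := E).
  by apply: residue1 DE; rewrite inE.
by rewrite /dist DE (wlen_gen eS e_onto) addn1.
Qed.

(** If the gate [E] of the residue is not [D], the last letter of a reduced gallery from [E] to [D]
    is a generator of [K] whose panel through [D] contains a chamber nearer to [C]. *)
Lemma gate_local (K : {set I}) C D : (forall i, i \in K -> is_gate [set i] C D) -> is_gate K C D.
Proof.
move=> gi; have [E DE gE] := gate_ex K C D.
have [v [Kv rv gv _]] := residue_word (residue_sym DE).
case: (lastP v) Kv rv gv => [|w i]; first by move=> _ _ /= <-.
rewrite -cats1 all_cat /= andbT => /andP[Kw Ki] r /gallery_cat[F EF [G FD /= GD]].
rewrite {G}GD in FD.
have [_ h1] := gate_wdist gE (residue_sym DE).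
have [|_ h2] := gate_wdist gE (E := F); first by exists w.
have DF : residue [set i] D F.
  by apply: residue1 (wdist_gen_sym eS FD); rewrite inE.
have := gi _ Ki _ DF; rewrite h1 h2 leq_add2l.
have -> : dist E D = (size w).+1.
  rewrite /dist (@gallery_wdist _ _ _ _ eS e_onto (w ++ [:: i])) ?(eqP r) ?size_cat ?addn1 //.
  by apply/gallery_cat; exists F => //; exists D.
by move=> /leq_trans /(_ (dist_gallery EF)); rewrite ltnn.
Qed.

(** The gate of the [i]-panel through [D] is then another chamber, one step nearer to [C]. *)
Lemma nongate_descent i C D : ~ is_gate [set i] C D ->
  wlen (e i * wdist D C) < wlen (wdist D C).
Proof.
move=> ng; have [E DE gE] := gate_ex [set i] C D.
have ED : E <> D by move=> ED; apply: ng; rewrite -ED.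
have [v [vi rv gv ev]] := residue_word DE.
have wi : wdist D E = e i.
  case: v vi rv gv ev => [|j [|k v]] /=.
  - by move=> _ _ /esym.
  - by rewrite !inE andbT => /eqP -> _ _ ->; rewrite word_val_cons word_val_nil mulg1.
  rewrite !inE => /and3P[/eqP -> /eqP -> _]; rewrite /reduced !word_val_cons gen_mulK //.
  move=> /eqP h; have := wlen_word_val eS e_onto v; rewrite h /=.
  by rewrite ltnNge leqnSn.
have [h1 h2] := gate_up gE (wdist_gen_sym eS wi).
rewrite -/(dist D C) dist_sym h2 ltnS (wdistV eS e_onto) h1 invgM (gen_inv eS).
by rewrite gen_mulK // (wlen_inv eS e_onto).
Qed.

(* If every generator in [J] is a descent from [D] to [C], every reduced word over
   [J] is a prefix of a reduced word from [D] to [C]. *)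
Lemma descents_bounded (J : {set I}) C D : (forall i, i \in J -> ~ is_gate [set i] C D) ->
  forall E, residue J D E -> dist D E <= dist D C.
Proof.
move=> desc E /residue_word[v [Jv rv _ ev]].
rewrite /dist ev (eqP rv).
suff [u ruv <-] : exists2 u, red (v ++ u) & val (v ++ u) = wdist D C.
  by rewrite (eqP ruv) size_cat leq_addr.
elim: v Jv rv {E ev} => [|i v IH] /=.
  by move=> _ _; have [u ? ?] := ex_reduced eS e_onto (wdist D C); exists u.
move=> /andP[Ji Jv] riv; have [//||u ru vu] := IH; first exact: reduced_behead riv.
have lt := nongate_descent (desc _ Ji).
have nr : ~~ red (i :: (v ++ u)).
  apply/negP => /eqP h; move: lt; rewrite -vu -word_val_cons h (eqP ru) /=.
  by rewrite ltnNge leqW.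
have [w1 [j [w2 [ew h]]]] := exchange eS e_onto thickX C0 ru nr.
(* Deleting a letter of [v] would contradict that [i :: v] is reduced, so the deleted letter lies in
   [u]. *)
have [[x ev ew2]|[x eu ew1]] := cat_eq_split ew.
  move: h; rewrite ew2 catA word_val_cat [in RHS]word_val_cat mulgA => /mulIg h.
  have := wlen_word_val eS e_onto (w1 ++ x).
  rewrite -(gen_mulK eS i (val (w1 ++ x))) -h -word_val_cons (eqP riv) /= ev.
  by rewrite !size_cat /= addnS ltnNge leqnSn.
exists (x ++ w2); last by rewrite -vu h ew1 -catA word_val_cons.
rewrite /reduced word_val_cons catA -ew1 -h (eqP ru) ew !size_cat /=.
by rewrite size_cat addnS.
Qed.

Hypothesis finX : locally_finite X.

Lemma finite_gallery w (C : X) : finite_set [set D | gal w C D].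
Proof.
elim: w C => [|i w IH] C /=.
  by rewrite (_ : [set D | _] = [set C]) //; apply/seteqP; split=> D //= ->.
rewrite (_ : [set D | _] =
    \bigcup_(E in [set E | wdist C E = e i]) [set D | gal w E D]).
  apply: bigcup_finite => //.
  by apply: sub_finite_set (finX C (eS i)) => E; right.
by apply/seteqP; split=> D [E ? ?]; exists E.
Qed.

Lemma finite_ball n C : finite_set [set D | dist C D <= n].
Proof.
apply: (@sub_finite_set _ _ (\bigcup_(m in `I_n.+1)
    \bigcup_(w in [set: m.-tuple I]) [set D | gal w C D])).
  move=> D /= CDn; have [w [_ gw sw]] := ex_gallery C D.
  exists (size w); first by rewrite /= ltnS sw.
  by exists (in_tuple w).
apply: bigcup_finite => // m _; apply: bigcup_finite => // w _.
exact: finite_gallery.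
Qed.

Lemma descents_finite (J : {set I}) C D : (forall i, i \in J -> ~ is_gate [set i] C D) ->
  finite_set (residue J D).
Proof.
move=> /descents_bounded h; exact: sub_finite_set h (finite_ball _ _).
Qed.

End Residues.

(** * Cardinalities of finite sets and double counting *)

Section Counting.
Local Open Scope classical_set_scope.
Local Open Scope fset_scope.

(** The default for infinite [A] is [0], since [fset_set] is then empty. *)
Definition set_card (T : choiceType) (A : set T) : nat := #|` fset_set A|.

Lemma set_cardE (T : choiceType) (A B : set T) : finite_set B -> (A `<=` B)%classic ->
  set_card A = (\sum_(x <- fset_set B) (x \in A))%N.
Proof.
move=> fB AB; have fA := sub_finite_set AB fB.
rewrite /set_card -sum1_size [RHS](eq_bigr (fun x => if x \in A then 1%N else 0%N)); last first.
  by move=> x _; case: (x \in A).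
rewrite -big_mkcond /= -[in RHS]big_filter; apply: perm_big.
apply: uniq_perm; rewrite ?fset_uniq ?filter_uniq ?fset_uniq // => x.
rewrite mem_filter !in_fset_set //; apply/idP/andP => [xA|[]//].
by split=> //; move: xA; rewrite !inE; exact: AB.
Qed.

Lemma double_count (T U : choiceType) (A : set T) (B : set U)
    (r : T -> U -> Prop) (k : nat) :
  finite_set A -> finite_set B ->
  (forall a, A a -> set_card (B `&` [set b | r a b])%classic = k) ->
  (forall b, B b -> set_card (A `&` [set a | r a b])%classic = 1%N) ->
  set_card B = (set_card A * k)%N.
Proof.
move=> fA fB hA hB.
have step (x : U) : B x ->
    (\sum_(a <- fset_set A) (`[< r a x >] : nat) = 1)%N.
  move=> Bx; rewrite -(hB x Bx) (@set_cardE _ _ A) //.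
  apply: eq_big_seq => a; rewrite in_fset_set // inE => Aa.
  by congr nat_of_bool; apply/asboolP/idP; rewrite inE /=; [split|case].
have step2 (x : T) : A x ->
    (\sum_(b <- fset_set B) (`[< r x b >] : nat) = k)%N.
  move=> Ax; rewrite -(hA x Ax) (@set_cardE _ _ B) //.
  apply: eq_big_seq => a; rewrite in_fset_set // inE => Aa.
  by congr nat_of_bool; apply/asboolP/idP; rewrite inE /=; [split|case].
rewrite /set_card -!sum1_size big_distrl /=.
rewrite (eq_big_seq (fun b => \sum_(a <- fset_set A) (`[< r a b >] : nat))%N); last first.
  by move=> b; rewrite in_fset_set // inE => Bb; rewrite step.
rewrite exchange_big /=; apply: eq_big_seq => a; rewrite in_fset_set // inE => Aa.
by rewrite mul1n step2.
Qed.

Lemma set_card_set1 (T : choiceType) (x : T) : set_card [set x]%classic = 1%N.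
Proof. by rewrite /set_card fset_set1 cardfs1. Qed.

Lemma set_card_image (T U : choiceType) (f : T -> U) (A : set T) :
  injective f -> finite_set A -> set_card (f @` A)%classic = set_card A.
Proof.
by move=> fI fA; rewrite /set_card fset_set_image // card_imfset.
Qed.

Lemma set_card_uniqP (T : choiceType) (A : set T) x : A x -> (forall y, A y -> y = x) ->
  set_card A = 1%N.
Proof.
move=> Ax h; rewrite -(set_card_set1 x); congr set_card.
by apply/seteqP; split=> y; [exact: h|move=> ->].
Qed.

Lemma set_card_fibers (T U : choiceType) (f : T -> U) (A : set T) : finite_set A ->
  set_card A = (\sum_(v <- fset_set (f @` A)) set_card (A `&` [set x | f x = v]))%N.
Proof.
move=> fA; have fB := finite_image f fA.
rewrite [LHS](set_cardE fA) // (eq_big_seq (fun v =>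
    \sum_(x <- fset_set A) ((f x == v) : nat))%N) => [|v _]; last first.
  rewrite (@set_cardE _ _ A) //.
  apply: eq_big_seq => a; rewrite in_fset_set // inE => Aa.
  by congr nat_of_bool; apply/idP/eqP; rewrite inE /=; [case|split].
rewrite exchange_big /=; apply: eq_big_seq => x; rewrite in_fset_set // => xA.
rewrite xA (bigD1_seq (f x)) ?fset_uniq //=; last first.
  by rewrite in_fset_set // inE; exists x => //; rewrite inE in xA.
by rewrite eqxx big1 // => v; rewrite eq_sym => /negbTE ->.
Qed.

End Counting.

(** * Counting spheres and residues in a homogeneous building *)

Section ResidueCount.
Variables (W : coxeterSystem) (X : building W) (I : finType) (e : I -> W).
Hypothesis eS : forall i, cox_gens W (e i).
Hypothesis e_onto : forall s, cox_gens W s -> exists i, e i = s.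
Hypothesis thickX : thick X.
Hypothesis finX : locally_finite X.
Hypothesis homX : forall C D : X, exists f : X -> X,
  [/\ bijective f, forall E F, wdist (f E) (f F) = wdist E F & f C = D].
Variable C0 : X.
Local Open Scope classical_set_scope.
Local Open Scope group_scope.
Local Notation gal := (gallery e).
Local Notation residue := (@residue W X I e).
Local Notation is_gate := (@is_gate W X I e).

Definition sphere (v : W) (C : X) : set X := [set D | wdist C D = v].
(** One less than the size of a panel, the parameter usually written q_i; by [homX] it does not
    depend on [C0]. *)
Definition valency (i : I) : nat := set_card (sphere (e i) C0).
Definition residue_card (K : {set I}) : nat := set_card (residue K C0).
(** Finiteness is put on the residue rather than on the subgroup generated by [K], because residues
    are what is summed over. *)
Definition spherical (K : {set I}) : Prop := finite_set (residue K C0).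

Lemma finite_sphere v C : finite_set (sphere v C).
Proof.
apply: sub_finite_set (finite_ball eS e_onto finX (wlen v) C) => D /= CD.
by rewrite /dist CD.
Qed.

Lemma gallery_iso (f : X -> X) : (forall E F, wdist (f E) (f F) = wdist E F) ->
  forall w C D, gal w C D -> gal w (f C) (f D).
Proof.
move=> fd; elim=> [|i w IH] C D /=; first by move=> ->.
by move=> [E CE /IH ?]; exists (f E); rewrite ?fd.
Qed.

Lemma residue_image (f g : X -> X) : cancel f g -> cancel g f ->
  (forall E F, wdist (f E) (f F) = wdist E F) ->
  forall K C, residue K (f C) = f @` residue K C.
Proof.
move=> fK gK fd K C; have gd E F : wdist (g E) (g F) = wdist E F.
  by rewrite -fd !gK.
apply/seteqP; split=> [D [w Kw gw]|_ [D [w Kw gw] <-]]; last first.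
  by exists w => //; exact: gallery_iso.
by exists (g D) => //; exists w => //; rewrite -(fK C); exact: gallery_iso.
Qed.

Lemma sphere_image (f g : X -> X) : cancel f g -> cancel g f ->
  (forall E F, wdist (f E) (f F) = wdist E F) ->
  forall v C, sphere v (f C) = f @` sphere v C.
Proof.
move=> fK gK fd v C.
apply/seteqP; split=> [D h|_ [D h <-]]; last by rewrite /sphere /= fd.
by exists (g D) => //; rewrite /sphere /= -fd gK.
Qed.

Lemma valencyE i C : set_card (sphere (e i) C) = valency i.
Proof.
have [f [[g fK gK] fd fC]] := homX C0 C.
rewrite -fC (sphere_image fK gK fd) set_card_image //; first exact: can_inj fK.
exact: finite_sphere.
Qed.

Lemma spherical_finite K C : spherical K -> finite_set (residue K C).
Proof.
have [f [[g fK gK] fd fC]] := homX C0 C.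
by move=> ?; rewrite -fC (residue_image fK gK fd); exact: finite_image.
Qed.

Lemma residue_cardE K C : spherical K -> set_card (residue K C) = residue_card K.
Proof.
have [f [[g fK gK] fd fC]] := homX C0 C.
move=> ?; rewrite -fC (residue_image fK gK fd) set_card_image //.
exact: can_inj fK.
Qed.

Lemma sphericalS (K L : {set I}) : K \subset L -> spherical L -> spherical K.
Proof. by move=> KL; apply: sub_finite_set; exact: residueS. Qed.

Lemma valency_gt1 i : (1 < valency i)%N.
Proof.
have [D1 [D2 [D3 [P1 P2 P3 [n12 n13 n23]]]]] := thickX C0 (eS i).
have P D : panel (e i) C0 D -> C0 = D \/ sphere (e i) C0 D.
  by move=> [/wdist_eq1|]; [left|right].
have H (D D' : X) : D <> D' -> sphere (e i) C0 D -> sphere (e i) C0 D' ->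
    (1 < valency i)%N.
  move=> DD' d d'; rewrite /valency /set_card.
  have <- : #|` [fset D; D']%fset | = 2%N by rewrite cardfs2; case: eqP.
  apply: fsubset_leq_card; apply/fsubsetP => E; rewrite !inE in_fset_set.
    by move=> /orP[] /eqP ->; rewrite inE.
  exact: finite_sphere.
case: (P _ P1) => [e1|d1]; case: (P _ P2) => [e2|d2]; case: (P _ P3) => [e3|d3];
  try (by case: n12; rewrite -e1 -e2); try (by case: n13; rewrite -e1 -e3);
  try (by case: n23; rewrite -e2 -e3);
  [exact: H n23 _ _|exact: H n13 _ _|exact: H n12 _ _|exact: H n12 _ _].
Qed.

Lemma residue_card_gt0 K : spherical K -> (0 < residue_card K)%N.
Proof.
move=> sK; rewrite cardfs_gt0; apply/fset0Pn; exists C0.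
by rewrite in_fset_set // inE; exact: residue_refl.
Qed.

(* A gallery of type [v] from [C] passes through exactly one chamber at
   Weyl distance [u] when [v = u * e i] is length-increasing. *)
Lemma sphere_step_uniq u i (C D : X) : wlen (u * e i) = (wlen u).+1 ->
  wdist C D = u * e i ->
  exists2 E, wdist C E = u /\ wdist E D = e i &
    forall F, wdist C F = u -> wdist F D = e i -> F = E.
Proof.
move=> ui CD.
have DC : wdist D C = word_val e [:: i] * u^-1.
  by rewrite (wdistV eS e_onto) CD invgM word_val_cons word_val_nil mulg1 (gen_inv eS).
have [E [E' DE /= EE'] EC] := wdist_gallery eS DC; rewrite {E'}EE' in DE.
have CE : wdist C E = u by rewrite (wdistV eS e_onto) EC invgK.
exists E; first by split=> //; exact: wdist_gen_sym.
move=> F CF FD; apply: contrapT => FE.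
have FE' : wdist F E = e i.
  have [|->//] := wdist_step eS E FD; rewrite (wdist_gen_sym eS (wdist_gen_sym eS DE)).
    by rewrite gen_sq // => /wdist_eq1.
have := wdist_up eS FE' (E := C); rewrite EC -(gen_inv eS i) -invgM !(wlen_inv eS e_onto).
move=> /(_ ui) h; move: (wdistV eS e_onto C F); rewrite h CF => /invg_inj.
move=> /(congr1 (@wlen W)); rewrite ui => /esym; exact: n_Sn.
Qed.

Lemma sphere_step_card u i (C : X) : wlen (u * e i) = (wlen u).+1 ->
  set_card (sphere (u * e i) C) = (set_card (sphere u C) * valency i)%N.
Proof.
move=> ui; apply: (double_count (r := fun E D => wdist E D = e i));
  [exact: finite_sphere|exact: finite_sphere| |].
- move=> E CE; rewrite -(valencyE i E); congr set_card.
  apply/seteqP; split=> [D []//|D /= ED]; split => //; rewrite /sphere /=.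
  apply: invg_inj; rewrite invgM (gen_inv eS) -(wdistV eS e_onto) -CE.
  rewrite -(wdistV eS e_onto); apply: (wdist_up eS (wdist_gen_sym eS ED)).
  rewrite (wdistV eS e_onto C E) CE -{1}(gen_inv eS i) -invgM.
  by rewrite !(wlen_inv eS e_onto).
- move=> D CD; have [E [CE ED] Euniq] := sphere_step_uniq ui CD.
  by apply: (@set_card_uniqP _ _ E) => // F [CF]; exact: Euniq.
Qed.

Lemma gate1P i (C D : X) : is_gate [set i] C D <->
  wlen (wdist C D * e i) = (wlen (wdist C D)).+1.
Proof.
split=> [gD|].
  have [E [ED _]] := wdist_ex D D (eS i).
  have [<- ] := gate_up eS e_onto thickX C0 gD (wdist_gen_sym eS ED).
  by [].
move=> h; apply: contrapT => /(nongate_descent eS e_onto thickX C0).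
rewrite (wdistV eS e_onto C D) -{1}(gen_inv eS i) -invgM !(wlen_inv eS e_onto) h.
by rewrite ltnNge leqnSn.
Qed.

(** By [gate_local] and [gate1P], being a gate is a condition on [wdist C D] alone. Hence the gates
    in a residue form a union of spheres. *)
Lemma gate_wdist_eq K (C D D' : X) : wdist C D = wdist C D' ->
  is_gate K C D -> is_gate K C D'.
Proof.
move=> CDD' gD; apply: (gate_local eS e_onto thickX C0) => i iK.
apply/gate1P; rewrite -CDD'; apply/gate1P; apply: gateS gD.
by rewrite finset.sub1set.
Qed.

Lemma residue_wdist_eq K (C D D' : X) : wdist C D = wdist C D' ->
  residue K C D -> residue K C D'.
Proof.
move=> CDD' /(residue_word eS e_onto thickX C0)[w [Kw _ _ h]].
by exists w => //; apply: wdist_gallery1 => //; rewrite -CDD'.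
Qed.

Definition gates (K L : {set I}) : set X := residue L C0 `&` is_gate K C0.

Lemma finite_gates K L : spherical L -> finite_set (gates K L).
Proof. by apply: sub_finite_set => D []. Qed.

(** The [K]-residues partition the [L]-residue, and each of them contains exactly one gate. *)
Lemma residue_card_gates (K L : {set I}) : K \subset L -> spherical L ->
  residue_card L = (set_card (gates K L) * residue_card K)%N.
Proof.
move=> KL sL; have sK := sphericalS KL sL.
apply: (double_count (r := fun E D => residue K E D)) => //.
- exact: finite_gates.
- move=> E [LE gE]; rewrite -(residue_cardE E sK); congr set_card.
  apply/seteqP; split=> [D []//|D /= ED]; split => //.
  by apply: residue_trans LE _; exact: residueS ED.
- move=> D LD; have [E DE gE] := gate_ex e K C0 D.
  apply: (@set_card_uniqP _ _ E) => [|F [[LF gF] FD]].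
    split; last exact: residue_sym.
    by split => //; apply: residue_trans LD _; exact: residueS DE.
  apply: (gate_uniq eS e_onto thickX C0 gF gE); exact: residue_trans DE.
Qed.

(* The gates other than [C0] lie on spheres [sphere (u * e i) C0] with
   [i \in L :\: K]. *)
Lemma gates_mod (p : nat) (K L : {set I}) : K \subset L -> spherical L ->
  (forall i, i \in L -> i \notin K -> p %| valency i) ->
  set_card (gates K L) = 1 %[mod p].
Proof.
move=> KL sL pK; have fG := finite_gates K sL.
have gC0 : is_gate K C0 C0 by move=> E _; rewrite (distxx eS e_onto).
rewrite (set_card_fibers (@wdist W X C0) fG) (bigD1_seq 1) ?fset_uniq //=; last first.
  rewrite in_fset_set; last exact: finite_image.
  by rewrite inE; exists C0; rewrite ?wdistxx //; split=> //; exact: residue_refl.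
rewrite (@set_card_uniqP _ _ C0); last 2 first.
- by split; [split=> //; exact: residue_refl|rewrite /= wdistxx].
- by move=> y [_ /wdist_eq1].
rewrite -[in RHS](addn0 1%N); apply/eqP; rewrite eqn_modDl mod0n.
rewrite -[_ == _]/(p %| _)%N big_seq_cond; apply: dvdn_sum => v /andP[].
rewrite in_fset_set; last exact: finite_image.
rewrite inE => -[D [LD gD] Dv] v1.
(* Otherwise [D] would be the gate of the whole [L]-residue, which is [C0]. *)
have [i [iL niD]] : exists i, i \in L /\ ~ is_gate [set i] C0 D.
  apply: contrapT => /forallNP nex.
  have gL : is_gate L C0 D.
    apply: (gate_local eS e_onto thickX C0) => i iL.
    by apply: contrapT => ng; apply: (nex i).
  have gC0L : is_gate L C0 C0 by move=> E _; rewrite (distxx eS e_onto).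
  move: v1; rewrite -Dv (gate_uniq eS e_onto thickX C0 gC0L gL LD) wdistxx.
  by rewrite eqxx.
have iK : i \notin K.
  by apply/negP => iK; apply: niD; apply: gateS gD; rewrite finset.sub1set.
have lt := nongate_descent eS e_onto thickX C0 niD.
rewrite (wdistV eS e_onto C0 D) Dv -{1}(gen_inv eS i) -invgM !(wlen_inv eS e_onto) in lt.
(* [v] arises from the shorter [v * e i] by the letter [i], so its sphere has a cardinality
   divisible by [valency i], hence by [p]. *)
have vE : v = v * e i * e i by rewrite -mulgA gen_sq // mulg1.
rewrite (_ : _ `&` _ = sphere v C0); last first.
  apply/seteqP; split=> [E []//|E Ev]; split => //; split.
    by apply: residue_wdist_eq LD; rewrite Dv.
  by apply: gate_wdist_eq gD; rewrite Dv.
rewrite {1}vE sphere_step_card; first by rewrite dvdn_mull // pK.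
rewrite -vE; apply/eqP; rewrite eqn_leq lt andbT.
have := wlenM eS e_onto (v * e i) (e i).
by rewrite -vE (wlen_gen eS e_onto) addn1.
Qed.

End ResidueCount.

(** Adding or removing [s] pairs the terms with opposite signs. *)
Lemma alternating_toggle (R : pzRingType) (I : finType) (J : {set I}) (s : I)
    (G : {set I} -> R) : s \in J -> (forall K, G (s |: K) = G K) ->
  (\sum_(K : {set I} | K \subset J) (-1) ^+ #|K| * G K = 0)%R.
Proof.
move=> sJ Gs; rewrite (bigID (fun K : {set I} => s \in K)) /=.
rewrite (reindex_onto (fun K => s |: K) (fun K => K :\ s)) /=; last first.
  by move=> K /andP[_ sK]; rewrite finset.setD1K.
rewrite (eq_bigl (fun K : {set I} => (K \subset J) && (s \notin K))); last first.
  move=> K; rewrite setU11 andbT finset.subUset finset.sub1set sJ /=; congr andb.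
  apply/eqP/idP => [<-|sK]; first by rewrite !inE eqxx.
  by rewrite finset.setU1K.
rewrite -big_split /= big1 // => K /andP[_ sK].
by rewrite Gs cardsU1 sK exprS mulN1r mulNr addNr.
Qed.

(** * The Euler sum over spherical subsets *)

Section EulerSum.
Variables (W : coxeterSystem) (X : building W) (I : finType) (e : I -> W).
Hypothesis eS : forall i, cox_gens W (e i).
Hypothesis e_onto : forall s, cox_gens W s -> exists i, e i = s.
Hypothesis thickX : thick X.
Hypothesis finX : locally_finite X.
Hypothesis homX : forall C D : X, exists f : X -> X,
  [/\ bijective f, forall E F, wdist (f E) (f F) = wdist E F & f C = D].
Variable C0 : X.
Local Notation spherical := (spherical e C0).
Local Notation residue_card := (residue_card e C0).
Local Notation gates := (gates e C0).
Local Notation valency := (valency e C0).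

(** A reduced word over [K] is the type of a gallery from [C0] inside the residue, and its size is
    the distance between the ends. *)
Lemma spherical_word_bound (K : {set I}) : spherical K ->
  exists n, forall w, all (mem K) w -> reduced e w -> (size w <= n)%N.
Proof.
move=> sK; exists (\max_(D <- fset_set (residue e K C0)) dist C0 D)%N => w Kw r.
have [D gD] : exists D : X, gallery e w C0 D.
  have [D CD] := ex_wdist eS e_onto C0 (word_val e w); exists D.
  exact: wdist_gallery1.
have <- : dist C0 D = size w.
  by rewrite /dist (gallery_wdist eS e_onto gD r) (eqP r).
by apply: leq_bigmax_seq => //; rewrite in_fset_set // inE; exists w.
Qed.

Local Open Scope ring_scope.

(* For a prime [p] dividing the valency of some [s0 \in J], let [L] drop from [J]
   all generators of valency divisible by [p]. Modulo [p] the terms of the sum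
   multiplied by [residue_card L] become [(-1) ^+ #|K| * d K] with [d K] depending
   only on [K :&: L]; toggling [s0] shows that they add up to minus the missing
   term [K = J], which is a unit. *)
Lemma euler_sum_neq0 (R : numFieldType) (J : {set I}) :
  ~ spherical J -> (forall K : {set I}, K \proper J -> spherical K) ->
  \sum_(K : {set I} | K \proper J) (-1) ^+ #|K| / (residue_card K)%:R != 0 :> R.
Proof.
move=> nJ sK.
have [s0 s0J] : exists s, s \in J.
  apply/set0Pn/eqP => J0; apply: nJ; rewrite J0.
  change (finite_set (residue e finset.set0 C0)).
  rewrite (_ : residue e _ C0 = [set C0]%classic); first exact: finite_set1.
  apply/seteqP; split=> [D [[|i w]] /= //|D ->]; last exact: residue_refl.
  by rewrite inE.
(* A prime divisor exists because thickness gives [valency s0 >= 2]. *)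
pose p := pdiv (valency s0).
have p_pr : prime p by rewrite pdiv_prime // valency_gt1.
pose L := [set i in J | ~~ (p %| valency i)%N].
have s0L : s0 \notin L by rewrite inE pdiv_dvd andbF.
have LJ : L \proper J.
  apply/properP; split; last by exists s0.
  by apply/fintype.subsetP => i; rewrite inE => /andP[].
have sL := sK _ LJ.
(* [residue_card L / residue_card K] equals [d K / c K], both cardinalities being multiples of that
   of [K :&: L]. Modulo [p] the denominator is [1]: generators in [K] outside [L] have valency
   divisible by [p]. *)
pose c (K : {set I}) := set_card (gates (K :&: L) K).
pose d (K : {set I}) := set_card (gates (K :&: L) L).
have cE (K : {set I}) : K \proper J -> residue_card K = (c K * residue_card (K :&: L))%N.
  move=> KJ; apply: residue_card_gates => //; last exact: sK.
  exact: finset.subsetIl.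
have dE (K : {set I}) : residue_card L = (d K * residue_card (K :&: L))%N.
  by apply: residue_card_gates => //; exact: finset.subsetIr.
have c1 (K : {set I}) : K \proper J -> c K = 1 %[mod p].
  move=> KJ; apply: gates_mod => //; [exact: finset.subsetIl|exact: sK|].
  move=> i iK; rewrite !inE iK /= (fintype.subsetP (fintype.proper_sub KJ) _ iK) /=.
  by rewrite negbK.
have d1 : d J = 1 %[mod p].
  apply: gates_mod => // [|i iL]; first exact: finset.subsetIr.
  by rewrite inE iL (fintype.subsetP (fintype.proper_sub LJ)).
have cgt0 (K : {set I}) : K \proper J -> (0 < c K)%N.
  move=> KJ; have := residue_card_gt0 (sK _ KJ); rewrite cE // muln_gt0.
  by case/andP.
have Ngt0 (K : {set I}) : K \proper J -> (0 < residue_card (K :&: L))%N.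
  move=> KJ; have := residue_card_gt0 (sK _ KJ); rewrite cE // muln_gt0.
  by case/andP.
apply/eqP => chi0.
(* Multiplying by all the [c K] clears denominators: [z] is an integer, vanishes together with the
   Euler sum, and can be reduced modulo [p]. *)
pose P (K : {set I}) := (\prod_(K' : {set I} | (K' \proper J) && (K' != K)) c K')%N.
pose z : int := \sum_(K : {set I} | K \proper J) (-1) ^+ #|K| * (d K * P K)%:R.
have z0 : z = 0.
  apply/eqP; rewrite -(intr_eq0 R) /z rmorph_sum /=; apply/eqP.
  transitivity ((\prod_(K : {set I} | K \proper J) c K)%N%:R * (residue_card L)%:R *
    \sum_(K : {set I} | K \proper J) (-1) ^+ #|K| / (residue_card K)%:R : R); last first.
    by rewrite chi0 mulr0.
  rewrite mulr_sumr; apply: eq_bigr => K KJ.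
  rewrite (bigD1 K) //= -/(P K) (dE K) (cE K) // rmorphM rmorphXn /= rmorphN rmorph1.
  rewrite rmorph_nat !natrM.
  have cn : (c K)%:R != 0 :> R by rewrite pnatr_eq0 -lt0n cgt0.
  have Nn : (residue_card (K :&: L))%:R != 0 :> R by rewrite pnatr_eq0 -lt0n Ngt0.
  by field; rewrite cn Nn.
have modp m : m = 1 %[mod p] -> m%:R = 1 :> 'F_p.
  by move=> m1; rewrite -[m%:R]Fp_nat_mod // m1 Fp_nat_mod.
have zp : \sum_(K : {set I} | K \proper J) (-1) ^+ #|K| * (d K)%:R = 0 :> 'F_p.
  rewrite -[RHS](_ : z%:~R = 0); last by rewrite z0.
  rewrite /z rmorph_sum /=; apply: eq_bigr => K KJ.
  rewrite rmorphM rmorphXn rmorphN rmorph1 rmorph_nat natrM natr_prod.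
  rewrite big1 ?mulr1 // => K' /andP[K'J _]; exact/modp/c1.
have := @alternating_toggle 'F_p I J s0 (fun K => (d K)%:R) s0J.
rewrite (bigD1 J) //= (eq_bigl (fun K : {set I} => K \proper J)); last first.
  by move=> K; rewrite finset.properEneq andbC.
rewrite zp addr0 modp // mulr1 => h.
suff /h/eqP : forall K : {set I}, (d (s0 |: K))%:R = (d K)%:R :> 'F_p.
  by rewrite signr_eq0.
move=> K; congr (set_card _)%:R.
rewrite finset.setIUl (_ : [set s0] :&: L = finset.set0) ?finset.set0U //.
apply/finset.setP => i; rewrite !inE.
by case: (eqVneq i s0) => // ->; move: s0L; rewrite inE => /negbTE.
Qed.

End EulerSum.

(** * Finitely supported functions and sums over a symmetric relation *)

Section FiniteSums.
Variables (R : realFieldType) (T : choiceType).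
Implicit Types (f g : T -> R) (A : set T) (r : T -> T -> Prop).
Local Open Scope classical_set_scope.
Local Open Scope ring_scope.

Definition fin_supp f := finite_set [set x | f x != 0].

(** The default is [0] when infinitely many terms are nonzero. *)
Definition ftotal f : R := \sum_(x \in [set: T]) f x.

Definition relsum r f (x : T) : R := \sum_(y \in [set y | r x y]) f y.

Lemma totalE A f : finite_set A -> (forall x, f x != 0 -> A x) ->
  ftotal f = \sum_(x <- fset_set A) f x.
Proof.
move=> fA fsub; rewrite /ftotal (fsbigTE (fset_set A)) // => x.
rewrite in_fset_set // => xA; apply/eqP; apply: contraNT xA => /fsub.
by rewrite inE.
Qed.

Lemma fin_suppS f g : (forall x, f x != 0 -> g x != 0) -> fin_supp g -> fin_supp f.
Proof. by move=> fg; apply: sub_finite_set => x; exact: fg. Qed.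

Lemma fin_suppMl f g : fin_supp f -> fin_supp (fun x => g x * f x).
Proof. by apply: fin_suppS => x; rewrite mulf_eq0 negb_or => /andP[]. Qed.

Lemma fin_suppMr f g : fin_supp f -> fin_supp (fun x => f x * g x).
Proof. by apply: fin_suppS => x; rewrite mulf_eq0 negb_or => /andP[]. Qed.

Lemma fin_suppD f g : fin_supp f -> fin_supp g -> fin_supp (fun x => f x + g x).
Proof.
move=> ff fg; have : finite_set ([set x | f x != 0] `|` [set x | g x != 0]).
  by rewrite finite_setU.
apply: sub_finite_set => x /=; have [->|] := eqVneq (f x) 0; last by left.
by rewrite add0r; right.
Qed.

Lemma fin_suppN f : fin_supp f -> fin_supp (fun x => - f x).
Proof. by apply: fin_suppS => x; rewrite oppr_eq0. Qed.

Lemma fin_supp_sum (I : Type) (s : seq I) (P : pred I) (F : I -> T -> R) :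
  (forall i, P i -> fin_supp (F i)) -> fin_supp (fun x => \sum_(i <- s | P i) F i x).
Proof.
move=> h; elim: s => [|i s IH].
  by apply: (@sub_finite_set _ _ set0) => // x /=; rewrite big_nil eqxx.
have [Pi|nPi] := boolP (P i).
  by apply: fin_suppS (fin_suppD (h i Pi) IH) => x; rewrite big_cons Pi.
by apply: fin_suppS IH => x; rewrite big_cons (negbTE nPi).
Qed.

Lemma totalD f g : fin_supp f -> fin_supp g ->
  ftotal (fun x => f x + g x) = ftotal f + ftotal g.
Proof.
move=> ff fg; pose A := [set x | f x != 0] `|` [set x | g x != 0].
have fA : finite_set A by rewrite finite_setU.
rewrite (@totalE A f) //; last by move=> x; left.
rewrite (@totalE A g) //; last by move=> x; right.
rewrite (@totalE A) ?big_split // => x.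
by have [->|] := eqVneq (f x) 0; [rewrite add0r; right|left].
Qed.

Lemma totalZ a f : ftotal (fun x => a * f x) = a * ftotal f.
Proof. by rewrite /ftotal mulr_fsumr. Qed.

Lemma totalN f : ftotal (fun x => - f x) = - ftotal f.
Proof.
rewrite -mulN1r -totalZ; congr ftotal; apply/funext => x.
by rewrite mulN1r.
Qed.

Lemma totalB f g : fin_supp f -> fin_supp g ->
  ftotal (fun x => f x - g x) = ftotal f - ftotal g.
Proof. by move=> ff fg; rewrite totalD ?totalN //; exact: fin_suppN. Qed.

Lemma total_sum (I : Type) (s : seq I) (P : pred I) (F : I -> T -> R) :
  (forall i, P i -> fin_supp (F i)) ->
  ftotal (fun x => \sum_(i <- s | P i) F i x) = \sum_(i <- s | P i) ftotal (F i).
Proof.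
move=> h; elim: s => [|i s IH].
  by rewrite big_nil /ftotal fsbig1 // => x _; rewrite big_nil.
rewrite big_cons -IH; case: ifPn => Pi.
  rewrite -totalD; [|exact: h|exact: fin_supp_sum].
  by congr ftotal; apply/funext => x; rewrite big_cons Pi.
by congr ftotal; apply/funext => x; rewrite big_cons (negbTE Pi).
Qed.

Lemma total_ge0 f : (forall x, 0 <= f x) -> 0 <= ftotal f.
Proof. by move=> f0; apply: fsumr_ge0 => x _; exact: f0. Qed.

Lemma ler_total f g : fin_supp f -> fin_supp g -> (forall x, f x <= g x) ->
  ftotal f <= ftotal g.
Proof.
move=> ff fg fgle; rewrite -subr_ge0 -totalB //; apply: total_ge0 => x.
by rewrite subr_ge0.
Qed.

Lemma ler_norm_total f : fin_supp f -> `|ftotal f| <= ftotal (fun x => `|f x|).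
Proof.
move=> ff; pose A := [set x | f x != 0].
rewrite !(@totalE A) //; first exact: ler_norm_sum.
by move=> x; rewrite normr_eq0.
Qed.

Variables (r : T -> T -> Prop).
Hypothesis r_sym : forall x y, r x y -> r y x.
Hypothesis r_fin : forall x, finite_set [set y | r x y].

Lemma relsumE A f x : finite_set A -> (forall y, r x y -> f y != 0 -> A y) ->
  relsum r f x = \sum_(y <- fset_set A) if `[< r x y >] then f y else 0.
Proof.
move=> fA fsub; rewrite /relsum fsbig_mkcond.
rewrite (fsbigTE (fset_set A)) // => y.
rewrite in_fset_set // /patch => yA; case: ifPn => //.
rewrite inE /= => rxy; apply/eqP; apply: contraNT yA => /(fsub _ rxy).
by rewrite inE.
Qed.

Lemma fin_supp_relsum f : fin_supp f -> fin_supp (relsum r f).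
Proof.
move=> ff; apply: (@sub_finite_set _ _
    (\bigcup_(y in [set y | f y != 0]) [set x | r y x])); last first.
  by apply: bigcup_finite.
move=> x /=; apply: contraNP => nx; apply/eqP.
rewrite /relsum fsbig1 // => y /= rxy; apply/eqP; apply: contrapT => /negP fy.
by apply: nx; exists y => //; exact: r_sym.
Qed.

(** Self-adjointness of summation over a symmetric relation. Finite support is asked of [f] alone,
    so that [g] can be a constant or the indicator of an infinite set of gates. *)
Lemma total_relsum f g : fin_supp f ->
  ftotal (fun x => relsum r f x * g x) = ftotal (fun x => f x * relsum r g x).
Proof.
move=> ff; pose A := [set x | f x != 0].
pose B := \bigcup_(y in A) [set x | r y x].
have fB : finite_set B by exact: bigcup_finite.
rewrite (@totalE A (fun x => f x * relsum r g x)) //; last first.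
  by move=> x; rewrite mulf_eq0 negb_or => /andP[].
rewrite (@totalE B) //; last first.
  move=> x; rewrite mulf_eq0 negb_or => /andP[+ _].
  apply: contraNP => nx; apply/eqP.
  rewrite /relsum fsbig1 // => y /= rxy; apply/eqP; apply: contrapT => /negP fy.
  by apply: nx; exists y => //; exact: r_sym.
rewrite (eq_bigr (fun x => \sum_(y <- fset_set A)
    if `[< r x y >] then f y * g x else 0)); last first.
  move=> x _; rewrite (@relsumE A) // mulr_suml; apply: eq_bigr => y _.
  by case: ifP; rewrite ?mul0r.
rewrite exchange_big /=; apply: eq_big_seq => y; rewrite in_fset_set // inE => Ay.
rewrite (@relsumE B) // ?mulr_sumr => [|x rxy _]; last by exists y.
apply: eq_bigr => x _; rewrite (_ : `[< r x y >] = `[< r y x >]).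
  by case: ifP; rewrite ?mulr0.
by apply/asboolP/asboolP; exact: r_sym.
Qed.

Lemma relsumD f g x : relsum r (fun y => f y + g y) x = relsum r f x + relsum r g x.
Proof. by rewrite /relsum fsbig_split. Qed.

Lemma relsumZ a f x : relsum r (fun y => a * f y) x = a * relsum r f x.
Proof. by rewrite /relsum mulr_fsumr. Qed.

Lemma relsum_cst a x : relsum r (fun=> a) x = (set_card [set y | r x y])%:R * a.
Proof.
rewrite /relsum fsbig_finite // big_const_seq count_predT iter_addr_0.
by rewrite mulr_natl.
Qed.

Lemma relsum_ge0 f x : (forall y, 0 <= f y) -> 0 <= relsum r f x.
Proof. by move=> f0; apply: fsumr_ge0 => y _; exact: f0. Qed.

Lemma ler_relsum f g x : (forall y, r x y -> f y <= g y) ->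
  relsum r f x <= relsum r g x.
Proof.
move=> fg; rewrite /relsum !fsbig_finite //; rewrite big_seq [leRHS]big_seq.
apply: ler_sum => y; by rewrite in_fset_set // inE => /fg.
Qed.

Lemma eq_relsum f g x : (forall y, r x y -> f y = g y) ->
  relsum r f x = relsum r g x.
Proof. by move=> fg; apply: eq_fsbigr => y; rewrite inE => /fg. Qed.

Lemma ler_norm_relsum f x : `|relsum r f x| <= relsum r (fun y => `|f y|) x.
Proof. by rewrite /relsum !fsbig_finite //; exact: ler_norm_sum. Qed.

Lemma relsum_geD1 f x y : (forall z, 0 <= f z) -> r x y -> f y <= relsum r f x.
Proof.
move=> f0 rxy; rewrite /relsum (fsbigD1 y) //= lerDl.
by apply: fsumr_ge0 => z _; exact: f0.
Qed.

Lemma total_relsum_cst (k : nat) f : fin_supp f ->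
  (forall x, set_card [set y | r x y] = k) ->
  ftotal (relsum r f) = k%:R * ftotal f.
Proof.
move=> ff hk; transitivity (ftotal (fun x => relsum r f x * 1)).
  by congr ftotal; apply/funext => x; rewrite mulr1.
rewrite total_relsum // -totalZ; congr ftotal; apply/funext => x.
by rewrite relsum_cst hk mulr1 mulrC.
Qed.

End FiniteSums.

(** * Dirichlet forms, oscillation and averages over residues *)

Section Gap.
Variables (R : realFieldType).
Variables (W : coxeterSystem) (X : building W) (I : finType) (e : I -> W).
Hypothesis eS : forall i, cox_gens W (e i).
Hypothesis e_onto : forall s, cox_gens W s -> exists i, e i = s.
Hypothesis thickX : thick X.
Hypothesis finX : locally_finite X.
Hypothesis homX : forall C D : X, exists f : X -> X,
  [/\ bijective f, forall E F, wdist (f E) (f F) = wdist E F & f C = D].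
Variable C0 : X.
Local Notation spherical := (spherical e C0).
Local Notation residue_card := (residue_card e C0).
Local Notation valency := (valency e C0).
Local Notation is_gate := (@is_gate W X I e).
Local Notation residue := (@residue W X I e).
Local Open Scope classical_set_scope.
Local Open Scope ring_scope.
Implicit Types f g Z : X -> R.

(** The Hecke operator of the generator [e i] on functions on chambers. *)
Definition nbr_sum i : (X -> R) -> X -> R := relsum (fun D E => wdist D E = e i).

Definition inner_prod f g : R := ftotal (fun D => f D * g D).

Local Notation q i := ((valency i)%:R : R).
Local Notation ip := inner_prod.

Let adj_sym i (D E : X) : wdist D E = e i -> wdist E D = e i.
Proof. exact: wdist_gen_sym. Qed.

Let adj_fin i (D : X) : finite_set [set E | wdist D E = e i].
Proof. exact: finite_sphere. Qed.

(** The quadratic relation of the Hecke algebra: adjacency in a panel is a complete graph on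
    [valency i + 1] chambers. *)
Lemma nbr_sum_nbr_sum i f D :
  nbr_sum i (nbr_sum i f) D = q i * f D + (q i - 1) * nbr_sum i f D.
Proof.
have step E : wdist D E = e i -> nbr_sum i f E = f D + nbr_sum i f D - f E.
  move=> DE; rewrite /nbr_sum /relsum.
  rewrite (fsbigD1 D) //=; last exact: adj_sym.
  rewrite [X in _ = _ + X - _](fsbigD1 E) //=.
  have -> : [set F | wdist E F = e i] `\ D = [set F | wdist D F = e i] `\ E.
    apply/seteqP; split=> F /= [EF nF]; split.
    - have [] := wdist_step eS F DE; rewrite EF ?gen_sq //.
      by move=> /wdist_eq1 /esym.
    - by move=> FE; move: EF; rewrite FE wdistxx => /esym/eqP; rewrite (negbTE (gen_neq1 eS i)).
    - have [] := wdist_step eS F (adj_sym DE); rewrite EF ?gen_sq //.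
      by move=> /wdist_eq1 /esym.
    - by move=> FD; move: EF; rewrite FD wdistxx => /esym/eqP; rewrite (negbTE (gen_neq1 eS i)).
  ring.
transitivity (relsum (fun D E => wdist D E = e i)
    (fun E => (f D + nbr_sum i f D) + (-1) * f E) D).
  apply: eq_relsum => E DE; rewrite step //.
  by rewrite mulN1r.
rewrite relsumD // relsumZ relsum_cst // -/(nbr_sum i f D).
rewrite [set_card _](valencyE eS e_onto finX homX C0 i D).
ring.
Qed.

Lemma fin_supp_nbr i f : fin_supp f -> fin_supp (nbr_sum i f).
Proof. by apply: fin_supp_relsum; [exact: adj_sym|exact: adj_fin]. Qed.

Lemma nbr_adj i f g : fin_supp f -> ip (nbr_sum i f) g = ip f (nbr_sum i g).
Proof. by apply: total_relsum; [exact: adj_sym|exact: adj_fin]. Qed.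

Lemma total_nbr i f : fin_supp f -> ftotal (nbr_sum i f) = q i * ftotal f.
Proof.
move=> ff; apply: (total_relsum_cst (@adj_sym i) (adj_fin i)) => // D.
exact: valencyE.
Qed.

Lemma ipDl f1 f2 g : fin_supp f1 -> fin_supp f2 ->
  ip (fun D => f1 D + f2 D) g = ip f1 g + ip f2 g.
Proof.
move=> h1 h2; rewrite /ip -totalD; try exact: fin_suppMr.
by congr ftotal; apply/funext => D; rewrite mulrDl.
Qed.

Lemma ipZl a f g : ip (fun D => a * f D) g = a * ip f g.
Proof. by rewrite /ip -totalZ; congr ftotal; apply/funext => D; rewrite mulrA. Qed.

Lemma ipC f g : ip f g = ip g f.
Proof. by rewrite /ip; congr ftotal; apply/funext => D; rewrite mulrC. Qed.

Lemma ip_ge0 f : 0 <= ip f f.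
Proof. by apply: total_ge0 => D; rewrite -expr2 sqr_ge0. Qed.

(** The quadratic form of the Laplacian [q i - nbr_sum i]; by [dirichletE] it is half the sum of
    squared differences over ordered pairs of [i]-adjacent chambers. *)
Definition dirichlet i f : R := q i * ip f f - ip (nbr_sum i f) f.

Lemma valency_gt0R i : 0 < q i.
Proof. by rewrite ltr0n (ltn_trans _ (valency_gt1 eS e_onto thickX finX C0 i)). Qed.

Lemma valency_gt1R i : 2 <= q i.
Proof. by rewrite ler_nat; exact: valency_gt1. Qed.

Lemma sqdiffE i f D :
  relsum (fun D E => wdist D E = e i) (fun E => (f D - f E) ^+ 2) D =
  q i * (f D * f D) + ((-2) * (nbr_sum i f D * f D) + nbr_sum i (fun D => f D * f D) D).
Proof.
rewrite (_ : relsum _ _ D = relsum (fun D E => wdist D E = e i)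
   (fun E => f D * f D + ((- 2 * f D) * f E + f E * f E)) D); last first.
  by apply: eq_relsum => E _; ring.
rewrite !relsumD // relsum_cst // relsumZ [set_card _](valencyE eS e_onto finX homX C0 i D).
rewrite -/(nbr_sum i f D) -/(nbr_sum i (fun E => f E * f E) D).
ring.
Qed.

Lemma fin_supp_sqdiff i f : fin_supp f -> fin_supp (fun D =>
  relsum (fun D E => wdist D E = e i) (fun E => (f D - f E) ^+ 2) D).
Proof.
move=> ff; have ff2 : fin_supp (fun D => f D * f D) by exact: fin_suppMr.
suff : fin_supp (fun D => q i * (f D * f D) + ((-2) * (nbr_sum i f D * f D) +
    nbr_sum i (fun D => f D * f D) D)).
  by apply: fin_suppS => D; rewrite sqdiffE.
apply: fin_suppD; first exact: fin_suppMl.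
apply: fin_suppD; last exact: fin_supp_nbr.
by apply: fin_suppMl; apply: fin_suppMl.
Qed.

Lemma dirichletE i f : fin_supp f ->
  dirichlet i f *+ 2 = ftotal (fun D =>
    relsum (fun D E => wdist D E = e i) (fun E => (f D - f E) ^+ 2) D).
Proof.
move=> ff; have ff2 : fin_supp (fun D => f D * f D) by exact: fin_suppMr.
transitivity (ftotal (fun D => q i * (f D * f D) + ((-2) * (nbr_sum i f D * f D) +
    nbr_sum i (fun D => f D * f D) D))); last first.
  by congr ftotal; apply/funext => D; rewrite sqdiffE.
rewrite totalD; [|exact: fin_suppMl|]; last first.
  by apply: fin_suppD; [apply: fin_suppMl; apply: fin_suppMl|exact: fin_supp_nbr].
rewrite totalD; [|by apply: fin_suppMl; apply: fin_suppMl|exact: fin_supp_nbr].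
rewrite !totalZ total_nbr // /dirichlet -!/(ip _ _); ring.
Qed.

Lemma dirichlet_ge0 i f : fin_supp f -> 0 <= dirichlet i f.
Proof.
move=> ff; rewrite -(pmulrn_lge0 _ (ltn0Sn 1)) dirichletE //; apply: total_ge0 => D.
by apply: relsum_ge0 => // E; rewrite sqr_ge0.
Qed.

Definition oscillation i f (D : X) : R :=
  relsum (fun D E => wdist D E = e i) (fun E => `|f D - f E|) D.

Lemma oscillation_ge0 i f D : 0 <= oscillation i f D.
Proof. by apply: relsum_ge0. Qed.

Lemma fin_supp_oscillation i f : fin_supp f -> fin_supp (oscillation i f).
Proof.
move=> ff.
have h : fin_supp (fun D => q i * `|f D| + nbr_sum i (fun E => `|f E|) D).
  apply: fin_suppD; first by apply: fin_suppMl; apply: fin_suppS ff => D; rewrite normr_eq0.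
  by apply: fin_supp_nbr; apply: fin_suppS ff => D; rewrite normr_eq0.
apply: fin_suppS h => D; apply: contraNN => /eqP h.
rewrite eq_le oscillation_ge0 andbT -h.
have := @ler_relsum R X _ (adj_fin i) (fun E => `|f D - f E|) (fun E => `|f D| + `|f E|) D.
rewrite relsumD // relsum_cst // [set_card _](valencyE eS e_onto finX homX C0 i D).
by apply => E _; rewrite ler_normB.
Qed.

(** Young's inequality with weight [t], applied to [|a^2 - b^2| = |a - b| |a + b|] on each pair of
    neighbours. It links the l1 oscillation of a square to the l2 quantities. *)
Lemma total_oscillation_sqr i f (t : R) : fin_supp f -> 0 < t ->
  ftotal (oscillation i (fun D => f D * f D)) <=
    dirichlet i f / t + 2 * t * q i * ip f f.
Proof.
move=> ff t0; have ff2 : fin_supp (fun D => f D * f D) by exact: fin_suppMr.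
have fs2 := fin_supp_sqdiff i ff.
pose h D := (2 * t)^-1 * relsum (fun D E => wdist D E = e i) (fun E => (f D - f E) ^+ 2) D
  + (t * q i * (f D * f D) + t * nbr_sum i (fun E => f E * f E) D).
have -> : dirichlet i f / t + 2 * t * q i * ip f f = ftotal h.
  rewrite totalD; [|exact: fin_suppMl|]; last first.
    by apply: fin_suppD; [exact: fin_suppMl|apply: fin_suppMl; exact: fin_supp_nbr].
  rewrite totalD; [|exact: fin_suppMl|by apply: fin_suppMl; exact: fin_supp_nbr].
  rewrite !totalZ -dirichletE // total_nbr // -/(ip f f) -mulr_natl.
  by field; rewrite gt_eqF.
apply: ler_total; first exact: fin_supp_oscillation.
  apply: fin_suppD; first exact: fin_suppMl.
  by apply: fin_suppD; [exact: fin_suppMl|apply: fin_suppMl; exact: fin_supp_nbr].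
move=> D; rewrite /h -(valencyE eS e_onto finX homX C0 i D) -mulrA.
rewrite -(relsum_cst (adj_fin i)) -!relsumZ -!relsumD //.
apply: ler_relsum => // E _.
have main (a : R) : (a = 1 \/ a = -1) ->
    0 <= (2 * t)^-1 * (f D - f E) ^+ 2 + (t * (f D * f D) + t * (f E * f E)) +
    a * (f D * f D - f E * f E).
  move=> ha; rewrite (_ : _ + _ = (2 * t)^-1 * ((f D - f E) + a * t * (f D + f E)) ^+ 2
      + t / 2 * (f D - f E) ^+ 2).
    by rewrite addr_ge0 // mulr_ge0 ?sqr_ge0 ?invr_ge0 ?divr_ge0 ?mulr_ge0 // ltW.
  by case: ha => ->; field; rewrite gt_eqF.
rewrite ler_norml -subr_ge0 opprK addrC -[X in _ + X]mul1r main; last by left.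
by rewrite -subr_ge0 -[X in _ - X]mul1r -mulNr main //; right.
Qed.

(** A crude bound suffices: the gallery stays in the residue, and each step is charged with the
    oscillation over the whole residue. *)
Lemma path_oscillation (K : {set I}) f w D E : spherical K -> all (mem K) w ->
  gallery e w D E ->
  `|f E - f D| <= (size w)%:R *
    relsum (residue K) (fun F => \sum_(i in K) oscillation i f F) D.
Proof.
move=> sK; have fK F := spherical_finite homX F sK.
have v0 F : 0 <= \sum_(i in K) oscillation i f F.
  by apply: sumr_ge0 => i _; exact: oscillation_ge0.
elim: w D => [|i w IH] D /=; first by move=> _ ->; rewrite subrr normr0 mul0r.
move=> /andP[iK Kw] [F DF FE].
have := IH F Kw FE.
have KDF : residue K D F by exact: residue1 DF.
rewrite {1}/relsum -(residue_eq eS KDF) -/(relsum (residue K) _ D) => le1.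
rewrite (_ : f E - f D = (f E - f F) + (f F - f D)); last by ring.
rewrite (le_trans (ler_normD _ _)) // -natr1 mulrDl mul1r lerD //.
apply: (@le_trans _ _ (\sum_(i in K) oscillation i f D)); last first.
  apply: (@relsum_geD1 R X (residue K) fK _ D D) => //; exact: residue_refl.
rewrite (bigD1 i) //=.
apply: (@le_trans _ _ (oscillation i f D)); last first.
  by rewrite lerDl; apply: sumr_ge0 => j _; exact: oscillation_ge0.
rewrite distrC.
by apply: (@relsum_geD1 R X _ (adj_fin i) (fun E => `|f D - f E|) D F).
Qed.

(* Each [K]-residue has exactly one gate, which collects the average of [f] over
   the residue up to the oscillation of [f] along galleries inside it. *)
Lemma gate_average (K : {set I}) : spherical K ->
  exists n : nat, forall (base : X -> X) f,
    (forall D E, residue K D E -> base D = base E) -> fin_supp f ->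
    `|ftotal f / (residue_card K)%:R -
      ftotal (fun D => (`[< is_gate K (base D) D >])%:R * f D)| <=
    n%:R * ftotal (fun D => \sum_(i in K) oscillation i f D).
Proof.
move=> sK; have fK F := spherical_finite homX F sK.
have symK D E : residue K D E -> residue K E D by exact: residue_sym.
have [n nP] := spherical_word_bound eS e_onto sK; exists n => base f baseK ff.
set v := fun D => \sum_(i in K) oscillation i f D.
have fv : fin_supp v by apply: fin_supp_sum => i _; exact: fin_supp_oscillation.
pose g D : R := (`[< is_gate K (base D) D >])%:R.
rewrite -[X in ftotal f / _ - X]/(ftotal (fun D => g D * f D)).
have g0 D : 0 <= g D by rewrite ler0n.
have g1 D : relsum (residue K) g D = 1.
  have [E DE gE] := gate_ex e K (base D) D.
  rewrite /relsum (fsbigD1 E) /=; [|exact: fK|exact: DE].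
  rewrite fsbig1 => [|F [/= DF FE]].
    by rewrite addr0 /g -(baseK _ _ DE) asboolT.
  rewrite /g asboolF // -(baseK _ _ DF) => gF; apply: FE.
  apply: (gate_uniq eS e_onto thickX C0 gF gE).
  exact: residue_trans (symK _ _ DF) DE.
set N := residue_card K.
have N0 : 0 < N%:R :> R by rewrite ltr0n residue_card_gt0.
have NE D : set_card [set E | residue K D E] = N by exact: residue_cardE.
(* Since [g] selects one chamber in each residue, a total over chambers becomes a sum over gates of
   residue sums. *)
have tE h : fin_supp h -> ftotal h = ftotal (fun D => relsum (residue K) h D * g D).
  move=> fh; rewrite (total_relsum symK fK) //; congr ftotal; apply/funext => D.
  by rewrite g1 mulr1.
have key D : `|relsum (residue K) f D - N%:R * f D| <=
    N%:R * (n%:R * relsum (residue K) v D).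
  rewrite -mulrN -(NE D) -!(relsum_cst fK) -relsumD //.
  apply: le_trans (ler_norm_relsum fK _ _) _; apply: ler_relsum => // E DE.
  have [w [Kw rw gw _]] := residue_word eS e_onto thickX C0 DE.
  apply: le_trans (path_oscillation f sK Kw gw) _.
  apply: ler_wpM2r; last by rewrite ler_nat nP.
  by apply: relsum_ge0 => // F; apply: sumr_ge0 => i _; exact: oscillation_ge0.
have frf h : fin_supp h -> fin_supp (fun D => relsum (residue K) h D * g D).
  by move=> fh; apply: fin_suppMr; apply: fin_supp_relsum.
rewrite (tE _ ff) (tE _ fv) mulrC -!totalZ -totalB; last 2 first.
- exact/fin_suppMl/frf.
- exact: fin_suppMl.
have fl : fin_supp (fun D => N%:R^-1 * (relsum (residue K) f D * g D) - g D * f D).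
  by apply: fin_suppD; [exact/fin_suppMl/frf|apply: fin_suppN; exact: fin_suppMl].
apply: le_trans (ler_norm_total fl) _; apply: ler_total.
- by apply: fin_suppS fl => D; rewrite normr_eq0.
- exact/fin_suppMl/frf.
move=> D; rewrite (_ : _ - _ = g D * (N%:R^-1 * (relsum (residue K) f D - N%:R * f D))).
  rewrite normrM (ger0_norm (g0 D)) mulrCA [in leRHS]mulrA [leRHS]mulrC.
  apply: ler_wpM2l => //; rewrite normrM gtr0_norm ?invr_gt0 // ler_pdivrMl //.
  by rewrite [_ * n%:R]mulrC.
by field; rewrite gt_eqF.
Qed.

End Gap.

(** * The spectral gap of an infinite residue *)

Section Contraction.
Variables (R : realType).
Variables (W : coxeterSystem) (X : building W) (I : finType) (e : I -> W).
Hypothesis eS : forall i, cox_gens W (e i).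
Hypothesis e_onto : forall s, cox_gens W s -> exists i, e i = s.
Hypothesis thickX : thick X.
Hypothesis finX : locally_finite X.
Hypothesis homX : forall C D : X, exists f : X -> X,
  [/\ bijective f, forall E F, wdist (f E) (f F) = wdist E F & f C = D].
Variable C0 : X.
Local Notation spherical := (spherical e C0).
Local Notation residue_card := (residue_card e C0).
Local Notation valency := (valency e C0).
Local Notation is_gate := (@is_gate W X I e).
Local Notation residue := (@residue W X I e).
Local Notation dirichlet := (dirichlet e C0).
Local Notation oscillation := (oscillation e).
Local Notation nbr_sum := (nbr_sum e).
Local Notation ip := inner_prod.
Local Open Scope classical_set_scope.
Local Open Scope ring_scope.
Implicit Types f g Z : X -> R.
Local Notation q i := ((valency i)%:R : R).

(* In every [J]-residue, which is infinite, [base] picks a chamber where [f]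
   vanishes. A chamber at which no generator of [J] is ascending from [base] would
   make the residue finite; so the alternating sum over [K \subset J] of the
   indicators of [K]-gates is zero, and its term [K = J] meets [f] only at [base].
   What remains is the Euler sum times [ftotal f], up to oscillation. *)
Lemma gap_l1 (J : {set I}) : ~ spherical J ->
  (forall K : {set I}, K \proper J -> spherical K) ->
  exists2 c : R, 0 <= c & forall f, fin_supp f ->
    `|ftotal f| <= c * ftotal (fun D => \sum_(i in J) oscillation i f D).
Proof.
move=> nJ sK.
have /choice[n nP] (K : {set I}) : exists n : nat, K \proper J -> forall (base : X -> X) f,
    (forall D E, residue K D E -> base D = base E) -> fin_supp f ->
    `|ftotal f / (residue_card K)%:R -
      ftotal (fun D => (`[< is_gate K (base D) D >])%:R * f D)| <=
    n%:R * ftotal (fun D => \sum_(i in K) oscillation i f D).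
  have [/sK KJ|nK] := boolP (K \proper J); last by exists 0%N.
  have [n h] := gate_average R eS e_onto thickX finX homX KJ.
  by exists n.
pose chi : R := \sum_(K : {set I} | K \proper J) (-1) ^+ #|K| / (residue_card K)%:R.
have chi0 : chi != 0 by exact: euler_sum_neq0.
pose c : R := \sum_(K : {set I} | K \proper J) (n K)%:R.
have c0 : 0 <= c by exact: sumr_ge0.
exists (c / `|chi|) => [|f ff]; first by rewrite divr_ge0.
have exb D : exists E, (residue J D `&` [set E | f E = 0]) E.
  apply: contrapT => /forallNP h; apply: nJ.
  have [g [[h' gK hK] gd gC]] := homX D C0.
  suff : finite_set (residue J C0) by [].
  rewrite -gC (residue_image e gK hK gd); apply: finite_image.
  apply: sub_finite_set ff => E DE /=; apply/eqP => fE; exact: (h E).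
pose base D := xget C0 (residue J D `&` [set E | f E = 0]).
have baseP D : residue J D (base D) /\ f (base D) = 0.
  by rewrite /base; case: xgetP => [E _ []//|hn]; have [E /hn] := exb D.
have base_eq (K : {set I}) D E : K \subset J -> residue K D E -> base D = base E.
  move=> KJ /(residueS KJ) /(residue_eq eS) h; by rewrite /base h.
pose g (K : {set I}) D : R := (`[< is_gate K (base D) D >])%:R.
have alt D : \sum_(K : {set I} | K \subset J) (-1) ^+ #|K| * g K D = 0.
  have [s sJ gs] : exists2 s, s \in J & is_gate [set s] (base D) D.
    apply: contrapT => hn; apply: nJ.
    have fD : finite_set (residue J D).
      apply: (descents_finite eS e_onto thickX C0 finX (C := base D)) => i iJ gi.
      by apply: hn; exists i.
    have [h [[h' hK hK'] hd hD]] := homX D C0.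
    suff : finite_set (residue J C0) by [].
    by rewrite -hD (residue_image e hK hK' hd); exact: finite_image.
  apply: (alternating_toggle sJ) => K; rewrite /g; congr (nat_of_bool _)%:R.
  apply/asboolP/asboolP => gK.
    by apply: gateS gK; exact: finset.subsetUr.
  apply: (gate_local eS e_onto thickX C0) => i; rewrite !inE => /orP[/eqP ->//|iK].
  by apply: gateS gK; rewrite finset.sub1set.
have gJ D : g J D * f D = 0.
  rewrite /g; case: asboolP => [gD|]; last by rewrite mul0r.
  have [DB fB] := baseP D.
  suff -> : D = base D by rewrite fB mulr0.
  apply: (gate_uniq eS e_onto thickX C0 gD _ DB) => E _.
  by rewrite (distxx eS e_onto).
have fgf K : fin_supp (fun D => g K D * f D) by exact: fin_suppMl.
have sum0 : \sum_(K : {set I} | K \proper J) (-1) ^+ #|K| * ftotal (fun D => g K D * f D) = 0.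
  transitivity (ftotal (fun D => \sum_(K : {set I} | K \proper J) (-1) ^+ #|K| * (g K D * f D))).
    rewrite total_sum => [|K _]; last exact: fin_suppMl.
    by apply: eq_bigr => K _; rewrite totalZ.
  rewrite /ftotal fsbig1 // => D _; have := alt D.
  rewrite (bigD1 J) //= (eq_bigl (fun K : {set I} => K \proper J)); last first.
    by move=> K; rewrite finset.properEneq andbC.
  move=> /(congr1 (fun x => x * f D)); rewrite mulrDl mul0r -mulrA gJ mulr0 add0r.
  by rewrite mulr_suml => h; rewrite -[RHS]h; apply: eq_bigr => K _; rewrite mulrA.
set v := fun D => _.
have v0 (K : {set I}) D : 0 <= \sum_(i in K) oscillation i f D.
  by apply: sumr_ge0 => i _; apply: oscillation_ge0.
have fv (K : {set I}) : fin_supp (fun D => \sum_(i in K) oscillation i f D).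
  by apply: fin_supp_sum => i _; apply: fin_supp_oscillation.
have main : `|chi * ftotal f| <= c * ftotal v.
  have -> : chi * ftotal f = \sum_(K : {set I} | K \proper J)
      ((-1) ^+ #|K| / (residue_card K)%:R * ftotal f -
       (-1) ^+ #|K| * ftotal (fun D => g K D * f D)).
    by rewrite sumrB sum0 subr0 mulr_suml.
  apply: le_trans (ler_norm_sum _ _ _) _; rewrite /c mulr_suml; apply: ler_sum => K KJ.
  rewrite -mulrA -mulrBr normrM normrX normrN1 expr1n mul1r [_^-1 * _]mulrC.
  have KJ' := fintype.proper_sub KJ.
  have {}h := nP K KJ base f (fun D E => base_eq K D E KJ') ff.
  apply: le_trans h _; apply: ler_wpM2l => //.
  apply: ler_total; [exact: fv|exact: fv|move=> D].
  rewrite /v [leRHS](bigID (fun i => i \in K)) /=.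
  rewrite [X in _ <= X + _](eq_bigl (fun i => i \in K)) ?lerDl ?sumr_ge0 // => [i _|i].
    by apply: oscillation_ge0.
  by rewrite andbC; case: (boolP (i \in K)) => // /(fintype.subsetP KJ') ->.
by rewrite mulrAC ler_pdivlMr ?normr_gt0 // mulrC -normrM.
Qed.

(* [gap_l1] applied to the square of [Z]. *)
Lemma spectral_gap (J : {set I}) : ~ spherical J ->
  exists2 c : R, 0 < c & forall Z, fin_supp Z ->
    c * ip Z Z <= \sum_(i in J) dirichlet i Z.
Proof.
move=> nJ.
(* A minimal non-spherical subset, as [gap_l1] requires all proper subsets to be spherical. *)
have [J0 /minsetP[/asboolPn nJ0 minJ0] J0J] :
    {J0 : {set I} | minset (fun K => ~~ `[< spherical K >]) J0 & J0 \subset J}.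
  by apply: minset_exists; apply/asboolPn.
have [||C C0' hC] := @gap_l1 J0 => //.
  move=> K KJ0; apply: contrapT => nK.
  have KJ0' := minJ0 K (introT (asboolPn _) nK) (fintype.proper_sub KJ0).
  by move: KJ0; rewrite KJ0' /= fintype.properxx.
pose Q : R := \sum_(i in J0) q i.
have Q0 : 0 <= Q by exact: sumr_ge0.
have CQ : 0 <= C * Q by exact: mulr_ge0.
(* With this weight the term in [ip Z Z] on the right has coefficient at most [1 / 2] and is
   absorbed on the left. *)
pose t : R := (4 * (C * Q + 1))^-1.
have t0 : 0 < t by rewrite invr_gt0 mulr_gt0 // ltr_wpDl.
exists (t / (2 * (C + 1))) => [|Z fZ]; first by rewrite divr_gt0 // mulr_gt0 // ltr_wpDl.
have fZ2 : fin_supp (fun D => Z D * Z D) by exact: fin_suppMr.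
have d0 i : 0 <= dirichlet i Z by exact: dirichlet_ge0.
have a0 := ip_ge0 Z.
have := hC _ fZ2; rewrite -/(ip Z Z) ger0_norm // total_sum; last first.
  by move=> i _; apply: fin_supp_oscillation.
set S0 := \sum_(i in J0) dirichlet i Z.
have le1 : \sum_(i in J0) ftotal (oscillation i (fun D => Z D * Z D)) <=
    S0 / t + 2 * t * Q * ip Z Z.
  apply: le_trans (_ : _ <= \sum_(i in J0) (dirichlet i Z / t + 2 * t * q i * ip Z Z)) _.
    by apply: ler_sum => i _; apply: total_oscillation_sqr.
  rewrite big_split /= -mulr_suml lerD2l /Q; move: (ip Z Z) => a.
  by rewrite mulr_sumr mulr_suml.
have S0le : S0 <= \sum_(i in J) dirichlet i Z.
  rewrite [leRHS](bigID (fun i => i \in J0)) /=.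
  rewrite [X in _ <= X + _](eq_bigl (fun i => i \in J0)) ?lerDl ?sumr_ge0 // => i.
  by rewrite andbC; case: (boolP (i \in J0)) => // /(fintype.subsetP J0J) ->.
have S00 : 0 <= S0 by exact: sumr_ge0.
move=> /le_trans /(_ (ler_wpM2l C0' le1)) h.
apply: le_trans S0le.
have tQ : C * (2 * t * Q) <= 2^-1.
  rewrite (_ : C * _ = (C * Q) / (2 * (C * Q + 1))); last first.
    by rewrite /t; field; rewrite gt_eqF // ltr_wpDl.
  by rewrite ler_pdivrMr ?mulr_gt0 ?ltr_wpDl // mulrA mulVf // mul1r lerDl.
have h2 : ip Z Z / 2 <= (C + 1) / t * S0.
  have e1 : C * (S0 / t + 2 * t * Q * ip Z Z) = C / t * S0 + C * (2 * t * Q) * ip Z Z.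
    by field; rewrite gt_eqF.
  have := ler_wpM2r a0 tQ; rewrite e1 in h.
  have : 0 <= S0 / t by rewrite divr_ge0 // ltW.
  have -> : (C + 1) / t * S0 = C / t * S0 + S0 / t by ring.
  by lra.
rewrite (_ : _ * _ = (t / (C + 1)) * (ip Z Z / 2)); last first.
  by field; rewrite gt_eqF // ltr_wpDl.
apply: le_trans (ler_wpM2l _ h2) _; first by rewrite divr_ge0 ?ltW // ltr_wpDl.
by rewrite (_ : _ * _ = S0) //; field; rewrite !gt_eqF // ltr_wpDl.
Qed.

End Contraction.

(** * Contraction by averages along long reduced words *)

Section Averages.
Variables (R : realType).
Variables (W : coxeterSystem) (X : building W) (I : finType) (e : I -> W).
Hypothesis eS : forall i, cox_gens W (e i).
Hypothesis e_onto : forall s, cox_gens W s -> exists i, e i = s.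
Hypothesis thickX : thick X.
Hypothesis finX : locally_finite X.
Hypothesis homX : forall C D : X, exists f : X -> X,
  [/\ bijective f, forall E F, wdist (f E) (f F) = wdist E F & f C = D].
Variable C0 : X.
Local Notation spherical := (spherical e C0).
Local Notation valency := (valency e C0).
Local Notation dirichlet := (dirichlet e C0).
Local Notation nbr_sum := (nbr_sum e).
Local Notation ip := inner_prod.
Local Open Scope classical_set_scope.
Local Open Scope ring_scope.
Implicit Types f g Z : X -> R.
Local Notation q i := ((valency i)%:R : R).

Definition nbr_avg i f : X -> R := fun D => (q i)^-1 * nbr_sum i f D.

Definition word_avg (w : seq I) f : X -> R := foldr nbr_avg f w.

Let q2 i : 2 <= q i.
Proof. exact: valency_gt1R. Qed.

Lemma fin_supp_avg i f : fin_supp f -> fin_supp (nbr_avg i f).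
Proof. by move=> ff; apply: fin_suppMl; apply: fin_supp_nbr. Qed.

Lemma fin_supp_word_avg w f : fin_supp f -> fin_supp (word_avg w f).
Proof. by move=> ff; elim: w => //= i w IH; exact: fin_supp_avg. Qed.

Lemma word_avg_cat u w f : word_avg (u ++ w) f = word_avg u (word_avg w f).
Proof. by rewrite /word_avg foldr_cat. Qed.

Lemma ip_nbr_nbr i f : fin_supp f ->
  ip (nbr_sum i f) (nbr_sum i f) = q i * ip f f + (q i - 1) * ip (nbr_sum i f) f.
Proof.
move=> ff; have fn : fin_supp (nbr_sum i f) by exact: fin_supp_nbr.
rewrite (nbr_adj eS e_onto finX) // ipC.
transitivity (ip (fun D => q i * f D + (q i - 1) * nbr_sum i f D) f).
  congr ip; apply/funext => D; exact: nbr_sum_nbr_sum.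
by rewrite ipDl ?ipZl //; exact: fin_suppMl.
Qed.

(** By the quadratic relation averaging loses exactly a multiple of the Dirichlet form, positive by
    thickness; a small loss of norm thus means almost invariance. *)
Lemma ip_avg i f : fin_supp f ->
  ip (nbr_avg i f) (nbr_avg i f) = ip f f - (q i - 1) / q i ^+ 2 * dirichlet i f.
Proof.
move=> ff; rewrite /nbr_avg ipZl ipC ipZl ip_nbr_nbr // /dirichlet.
by field; rewrite gt_eqF // (lt_le_trans _ (q2 i)).
Qed.

Lemma ip_sub f g : fin_supp f -> fin_supp g ->
  ip (fun D => f D - g D) (fun D => f D - g D) = ip f f - 2 * ip f g + ip g g.
Proof.
move=> ff fg; have fN : fin_supp (fun D => - g D) by exact: fin_suppN.
rewrite ipDl // [X in X + _]ipC [X in _ + X]ipC !ipDl //.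
have NE h : ip (fun D => - g D) h = - ip g h.
  by rewrite -mulN1r -ipZl; congr ip; apply/funext => D; rewrite mulN1r.
by rewrite [ip f (fun D => - g D)]ipC !NE [ip g (fun D => - g D)]ipC NE [ip g f]ipC; ring.
Qed.

Lemma ip_avg_sub i f : fin_supp f ->
  ip (fun D => nbr_avg i f D - f D) (fun D => nbr_avg i f D - f D) =
  (q i + 1) / q i ^+ 2 * dirichlet i f.
Proof.
move=> ff; rewrite ip_sub //; last exact: fin_supp_avg.
rewrite ip_avg // /nbr_avg ipZl /dirichlet.
by field; rewrite gt_eqF // (lt_le_trans _ (q2 i)).
Qed.

Lemma ip_subD_le f g h : fin_supp f -> fin_supp g -> fin_supp h ->
  ip (fun D => f D - h D) (fun D => f D - h D) <=
  2 * ip (fun D => f D - g D) (fun D => f D - g D) +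
  2 * ip (fun D => g D - h D) (fun D => g D - h D).
Proof.
move=> ff fg fh; rewrite /ip -!totalZ.
have fs (u v : X -> R) : fin_supp u -> fin_supp v -> fin_supp (fun D => (u D - v D) * (u D - v D)).
  by move=> fu fv; apply: fin_suppMr; apply: fin_suppD => //; exact: fin_suppN.
rewrite -totalD; [|by apply: fin_suppMl; exact: fs|by apply: fin_suppMl; exact: fs].
apply: ler_total; [exact: fs| |move=> D].
  by apply: fin_suppD; apply: fin_suppMl; exact: fs.
have := sqr_ge0 ((f D - g D) - (g D - h D)); lra.
Qed.

(** The left-hand side of [ip_avg] is nonnegative, and [q i <= 2 * (q i - 1)] by thickness. *)
Lemma dirichlet_le i f : fin_supp f -> dirichlet i f <= 2 * q i * ip f f.
Proof.
move=> ff; have := ip_ge0 (nbr_avg i f); rewrite ip_avg // subr_ge0 => h.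
have qi := q2 i; have q0 : 0 < q i by rewrite (lt_le_trans _ qi).
have q1 : 0 < q i - 1 by rewrite subr_gt0 (lt_le_trans _ qi) // ltr1n.
rewrite mulrAC ler_pdivrMr ?exprn_gt0 // in h.
rewrite -(ler_pM2l q1); apply: le_trans h _.
have : 0 <= (q i - 2) * (ip f f * q i).
  by rewrite mulr_ge0 ?mulr_ge0 ?ip_ge0 ?subr_ge0 // ltW.
lra.
Qed.

Lemma dirichletD_le i f g : fin_supp f -> fin_supp g ->
  dirichlet i f <= 2 * dirichlet i g +
    4 * q i * ip (fun D => g D - f D) (fun D => g D - f D).
Proof.
move=> ff fg; have fgf : fin_supp (fun D => g D - f D).
  by apply: fin_suppD => //; exact: fin_suppN.
have h1 : dirichlet i f <= 2 * dirichlet i g + 2 * dirichlet i (fun D => g D - f D).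
  have fs (u : X -> R) : fin_supp u -> fin_supp (fun D =>
      relsum (fun D E => wdist D E = e i) (fun E => (u D - u E) ^+ 2) D).
    exact: (fin_supp_sqdiff eS e_onto finX homX C0 i).
  have dE (u : X -> R) : fin_supp u -> dirichlet i u *+ 2 = ftotal (fun D =>
      relsum (fun D E => wdist D E = e i) (fun E => (u D - u E) ^+ 2) D).
    exact: (dirichletE eS e_onto finX homX C0 i).
  have : dirichlet i f *+ 2 <= 2 * (dirichlet i g *+ 2) +
      2 * (dirichlet i (fun D => g D - f D) *+ 2).
    rewrite !dE // -!totalZ -totalD; [|exact: fin_suppMl (fs _ fg)|exact: fin_suppMl (fs _ fgf)].
    apply: ler_total; [exact: fs| |move=> D].
      by apply: fin_suppD; apply: fin_suppMl; exact: fs.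
    rewrite -!relsumZ -relsumD; last exact: finite_sphere.
    apply: ler_relsum => [D'|E _]; first exact: finite_sphere.
    have := sqr_ge0 ((g D - g E) + ((g D - f D) - (g E - f E))); lra.
  by rewrite !mulr2n; lra.
have := dirichlet_le i fgf; lra.
Qed.

(* If averaging along [w] hardly decreases the norm of [f], then [f] is almost
   invariant under every letter of [w]. *)
Lemma word_avg_defect w : exists2 c : R, 0 <= c & forall f, fin_supp f ->
  [/\ ip (word_avg w f) (word_avg w f) <= ip f f,
      ip (fun D => word_avg w f D - f D) (fun D => word_avg w f D - f D) <=
        c * (ip f f - ip (word_avg w f) (word_avg w f)) &
      forall i, i \in w -> dirichlet i f <=
        c * (ip f f - ip (word_avg w f) (word_avg w f))].
Proof.
elim: w => [|i w [c c0 IH]] /=.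
  exists 0 => // f ff; split => //; rewrite mul0r ip_sub //; lra.
have qi := q2 i; have q0 : 0 < q i by rewrite (lt_le_trans _ qi).
have q00 : 0 <= q i := ltW q0.
(* The loss splits into [d1], caused by the letter [i], and [d2], caused by [w]. In units of [d1],
   [q i ^+ 2] bounds [dirichlet i g] and [3] bounds the displacement of [g] by [nbr_avg i]; in units
   of [d2], [c] comes from the induction. *)
pose a := 2 * (q i ^+ 2 + 3 + c) + 4 * q i * c + c.
have a0 : 0 <= a.
  by rewrite !addr_ge0 ?mulr_ge0 ?addr_ge0 ?sqr_ge0 // ltW.
exists a => // f ff; have [h1 h2 h3] := IH f ff.
set g := word_avg w f in h1 h2 h3 *; have fg : fin_supp g by exact: fin_supp_word_avg.
have dg : 0 <= dirichlet i g by exact: dirichlet_ge0.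
have k1 : 0 <= (q i - 1) / q i ^+ 2 * dirichlet i g.
  by rewrite mulr_ge0 // divr_ge0 ?sqr_ge0 // subr_ge0 (le_trans _ qi) // ler1n.
have eqn := ip_avg i fg.
set d1 := ip g g - ip (nbr_avg i g) (nbr_avg i g).
have d1E : d1 = (q i - 1) / q i ^+ 2 * dirichlet i g by rewrite /d1 eqn; ring.
set d2 := ip f f - ip g g in h2 h3.
have dE : ip f f - ip (nbr_avg i g) (nbr_avg i g) = d1 + d2 by rewrite /d1 /d2; ring.
have d20 : 0 <= d2 by rewrite subr_ge0.
have d10 : 0 <= d1 by rewrite d1E.
have dgle : dirichlet i g <= q i ^+ 2 * d1.
  rewrite d1E (_ : _ * _ = (q i - 1) * dirichlet i g); last by field; rewrite gt_eqF.
  have : 0 <= (q i - 2) * dirichlet i g by rewrite mulr_ge0 // subr_ge0.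
  lra.
have stp : ip (fun D => nbr_avg i g D - g D) (fun D => nbr_avg i g D - g D) <= 3 * d1.
  rewrite ip_avg_sub // d1E.
  have -> : 3 * ((q i - 1) / q i ^+ 2 * dirichlet i g) = ((3 * q i - 3) / q i ^+ 2) * dirichlet i g.
    by field; rewrite gt_eqF.
  apply: ler_wpM2r => //; rewrite ler_pM2r ?invr_gt0 ?exprn_gt0 //; lra.
have sub1 := ip_subD_le (fin_supp_avg i fg) fg ff.
rewrite dE; split.
- by move: dE d10 d20; rewrite /d1 /d2; lra.
- apply: le_trans sub1 _; rewrite /a.
  have := mulr_ge0 (sqr_ge0 (q i)) (addr_ge0 d10 d20).
  have := mulr_ge0 (mulr_ge0 q00 c0) (addr_ge0 d10 d20).
  have := mulr_ge0 c0 d10.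
  have := mulr_ge0 c0 d20.
  lra.
move=> j; rewrite inE => /orP[/eqP ->|jw].
  apply: le_trans (dirichletD_le i ff fg) _; rewrite /a.
  have : 4 * q i * ip (fun D => g D - f D) (fun D => g D - f D) <= 4 * q i * (c * d2).
    by apply: ler_wpM2l h2; rewrite mulr_ge0 // ltW.
  have := mulr_ge0 (sqr_ge0 (q i)) d20.
  have := mulr_ge0 (mulr_ge0 q00 c0) d10.
  have := mulr_ge0 c0 d10.
  have := mulr_ge0 c0 d20.
  lra.
apply: le_trans (h3 j jw) _; rewrite /a.
have := mulr_ge0 (sqr_ge0 (q i)) (addr_ge0 d10 d20).
have := mulr_ge0 (mulr_ge0 q00 c0) (addr_ge0 d10 d20).
have := mulr_ge0 c0 d20.
have := mulr_ge0 c0 d10.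
lra.
Qed.

(** A word that hardly contracts [f] leaves it almost invariant under all its letters by
    [word_avg_defect], which [spectral_gap] excludes. *)
Lemma unit_word_contraction w : reduced e w ->
  ~ spherical [set i in w] ->
  exists2 r : R, 0 <= r < 1 & forall f, fin_supp f ->
    ip (word_avg w f) (word_avg w f) <= r * ip f f.
Proof.
move=> rw nsp; have [c c0 hc] := word_avg_defect w.
have [g g0 hg] := spectral_gap R eS e_onto thickX finX homX nsp.
(* The summand [g] makes [a] positive and the factor [1 - g / a] nonnegative. *)
pose a : R := #|[set i in w]|%:R * c + g.
have a0 : 0 < a by rewrite ltr_wpDl // mulr_ge0.
exists (1 - g / a) => [|f ff].
  rewrite subr_ge0 ler_pdivrMr // mul1r lerDr mulr_ge0 //=.
  by rewrite ltrBlDr ltrDl divr_gt0.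
have [h1 h2 h3] := hc f ff; have {}hg := hg f ff.
set d := ip f f - _ in h2 h3.
have d0 : 0 <= d by rewrite subr_ge0.
have le1 : g * ip f f <= #|[set i in w]|%:R * (c * d).
  apply: le_trans hg _; rewrite mulr_natl -sumr_const; apply: ler_sum => i.
  by rewrite inE; exact: h3.
have le2 : g * ip f f <= a * d.
  by rewrite /a mulrDl -mulrA; apply: le_trans le1 _; rewrite lerDl mulr_ge0 // ltW.
rewrite mulrBl mul1r mulrAC lerBrDr addrC -lerBrDr.
by rewrite ler_pdivrMr // [leRHS]mulrC -/d.
Qed.

(** Cut the word into blocks of length [L]. As [L] exceeds the size of every reduced word over a
    spherical set, the letters of a block generate an infinite residue and the block contracts.
    There are finitely many words of length [L], so one factor [rho < 1] serves them all. *)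
Lemma word_avg_contraction (eps : R) : 0 < eps ->
  exists n : nat, forall w, reduced e w -> (n <= size w)%N ->
    forall f, fin_supp f -> ip (word_avg w f) (word_avg w f) <= eps * ip f f.
Proof.
move=> eps0.
have /choice[b bP] (K : {set I}) : exists n : nat, spherical K ->
    forall w, all (mem K) w -> reduced e w -> (size w <= n)%N.
  have [sK|nK] := pselect (spherical K); last by exists 0%N.
  by have [n nP] := spherical_word_bound eS e_onto sK; exists n.
pose L := (\max_(K : {set I}) b K).+1.
have /choice[r rP] (w : L.-tuple I) : exists r : R, [/\ 0 <= r, r < 1 &
    reduced e w -> forall f, fin_supp f ->
      ip (word_avg w f) (word_avg w f) <= r * ip f f].
  have [rw|nrw] := boolP (reduced e w); last by exists 0.
  have [|r /andP[r0 r1] hr] := unit_word_contraction rw; last by exists r.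
  move=> sp; have := bP _ sp w; rewrite rw size_tuple.
  move=> /(_ _ isT) h; have : (L <= b [set i in w])%N.
    by apply: h; apply/allP => i iw; rewrite /= inE.
  rewrite leqNgt ltnS => /negP; apply; exact: leq_bigmax.
pose rho : R := \big[Num.max/0]_(w : L.-tuple I) r w.
have rho0 : 0 <= rho by apply: bigmax_ge_id.
have rho1 : rho < 1 by apply/bigmax_ltP; split => // w _; have [] := rP w.
have [m hm] : exists m, rho ^+ m <= eps.
  have : `|rho| < 1 by rewrite ger0_norm.
  move=> /cvg_expr /cvgrPdist_le /(_ _ eps0) [m _ /(_ m (leqnn m))] /=.
  by rewrite sub0r normrN ger0_norm ?exprn_ge0 //; exists m.
have pow k : forall w, reduced e w -> (k * L <= size w)%N ->
    forall f, fin_supp f -> ip (word_avg w f) (word_avg w f) <= rho ^+ k * ip f f.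
  elim: k => [|k IH] w rw sw f ff.
    rewrite expr0 mul1r; have [c _ h] := word_avg_defect w.
    by have [] := h f ff.
  have szt : size (take L w) == L.
    by rewrite size_takel // (leq_trans _ sw) // mulSn leq_addr.
  have rtd : reduced e (take L w ++ drop L w) by rewrite cat_take_drop.
  rewrite -(cat_take_drop L w) word_avg_cat exprS.
  have [_ _ h] := rP (Tuple szt); have fd := fin_supp_word_avg (drop L w) ff.
  apply: le_trans (h _ _ fd) _; first exact: (reduced_catl eS e_onto rtd).
  rewrite -mulrA; apply: ler_pM => //.
  - by have [] := rP (Tuple szt).
  - exact: ip_ge0.
  - exact: le_bigmax.
  apply: IH => //; first exact: (reduced_catr eS e_onto rtd).
  by rewrite size_drop leq_subRL ?(leq_trans _ sw) // mulSn // leq_addr.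
exists (m * L)%N => w rw sw f ff; apply: le_trans (pow m w rw sw f ff) _.
by apply: ler_wpM2r => //; exact: ip_ge0.
Qed.

End Averages.

(** * The topology of the group: neighbourhoods and compact open cosets *)

Section AutomorphismTopology.
Variables (W : coxeterSystem) (X : building W) (G : groupClosed (building_aut X)).
Local Open Scope classical_set_scope.
Local Notation GT := (subgrp G).

Definition sact (g : GT) (C : X) : X := aut_fun (val g) C.

Lemma sact1 C : sact 1%g C = C.
Proof. by []. Qed.

Lemma sactM g h C : sact (g * h)%g C = sact g (sact h C).
Proof. by []. Qed.

Lemma sactK g : cancel (sact g) (sact g^-1%g).
Proof. by move=> C; rewrite -sactM mulVg. Qed.

Lemma sactVK g : cancel (sact g^-1%g) (sact g).
Proof. by move=> C; rewrite -sactM mulgV. Qed.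

Lemma sact_eqV g C D : sact g C = D <-> sact g^-1%g D = C.
Proof. by split=> <-; rewrite ?sactK ?sactVK. Qed.

Lemma sact_near g C : nbhs g [set h | sact h C = sact g C].
Proof.
have c : {for g, continuous (val : GT -> building_aut X)} by exact: initial_continuous.
exact: (c _ (aut_near (val g) C)).
Qed.

Lemma sact_cvg (F : set_system GT) (FF : Filter F) (g : GT) :
  (forall C, F [set h | sact h C = sact g C]) -> F --> g.
Proof.
move=> hC U [_ /= [[_ [V oV <-] <-] Vg]] VU.
apply: (filterS VU) => /=.
suff : (fun h : GT => val (val h)) @ F -->
    (val (val g) : {ptws X -> discrete_topology X}).
  by apply; exact: open_nbhs_nbhs.
apply/cvg_sup => C A [_ [[B oB <-] BC]] BA /=.
change (F [set h : GT | A (val (val h))]); apply: filterS (hC C) => u /= huC; apply: BA.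
rewrite /= -[X in B X]/(sact u C) huC; exact: BC.
Qed.

(** The sets containing all elements that agree with [g] on some finite list of chambers form a
    filter, and it converges to [g] by [sact_cvg]. *)
Lemma sact_nbhs g (U : set GT) : nbhs g U ->
  exists s : seq X, forall h, {in s, forall C, sact h C = sact g C} -> U h.
Proof.
pose F : set_system GT := fun V => exists s : seq X,
  forall h, {in s, forall C, sact h C = sact g C} -> V h.
have FF : Filter F.
  split; first by exists [::].
  - move=> A B [s sA] [t tB]; exists (s ++ t) => h hst.
    by split; [apply: sA|apply: tB] => C Cs; apply: hst; rewrite mem_cat Cs ?orbT.
  - by move=> A B AB [s sA]; exists s => h /sA /AB.
by apply: (@sact_cvg F FF) => C; exists [:: C] => h /(_ C (mem_head _ _)).
Qed.

(** If nonempty, a coset of the stabiliser of [C]; these are the compact open sets used to compute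
    with the Haar measure. *)
Definition carrier (C D : X) : set GT := [set g | sact g C = D].

Lemma carrier_open C D : open (carrier C D).
Proof.
rewrite openE => g /= gC; rewrite /interior /=.
by apply: filterS (sact_near g C) => h /= gh; rewrite /carrier /= gh.
Qed.

Hypothesis tpG : type_preserving G.

Lemma sact_wdist g C D : wdist (sact g C) (sact g D) = wdist C D.
Proof. by apply: tpG; exact: set_valP g. Qed.

Variables (I : finType) (e : I -> W).
Hypothesis eS : forall i, cox_gens W (e i).
Hypothesis e_onto : forall s, cox_gens W s -> exists i, e i = s.
Hypothesis finX : locally_finite X.
Hypothesis clG : closed [set` G].

Lemma ultra_finite (T : topologicalType) (F : set_system T) (U : choiceType)
    (B : set U) (f : T -> U) : UltraFilter F -> finite_set B ->
  F (f @^-1` B) -> exists u, F [set x | f x = u].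
Proof.
move=> FU fB FfB; apply: contrapT => /forallNP hn.
have : F (\bigcap_(u in [set` fset_set B]) [set x | f x <> u]).
  apply: filter_bigI => u _; have [Fu|//] := in_ultra_setVsetC [set x | f x = u] FU.
  by case: (hn u).
move=> /(filterI FfB) /filter_ex [x [fx /(_ (f x))]] /=.
by rewrite in_fset_set // inE => /(_ fx).
Qed.

(** Along an ultrafilter on the carrier the images of a chamber under [g] and under [g^-1] stay in
    finite balls, hence become constant. The two limits [f] and [h] are inverse to each other and
    preserve [wdist], and [f] lies in [G] since [G] is closed. *)
Lemma carrier_compact C D : compact (carrier C D).
Proof.
rewrite compact_ultra => F FU FA.
have FP : ProperFilter F := ultra_proper.
have FF : Filter F := filter_filter.
have bnd E : exists u, F [set g | sact g E = u].
  apply: (ultra_finite FU (finite_ball eS e_onto finX (dist C E) D)).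
  by apply: filterS FA => g /= <-; rewrite /dist sact_wdist.
have bndV E : exists u, F [set g | sact g^-1%g E = u].
  apply: (ultra_finite FU (finite_ball eS e_onto finX (dist D E) C)).
  by apply: filterS FA => g /= <-; rewrite /dist -{2}(sactVK g E) sact_wdist.
have [f fP] := choice bnd; have [h hP] := choice bndV.
have fK : cancel f h.
  move=> E; have [g [/= g1 g2]] := filter_ex (filterI (fP E) (hP (f E))).
  by rewrite -g2 -g1 sactK.
have hK : cancel h f.
  move=> E; have [g [/= g1 g2]] := filter_ex (filterI (fP (h E)) (hP E)).
  by rewrite -g1 -g2 sactVK.
have fd E E' : wdist (f E) (f E') = wdist E E'.
  have [g [/= <- <-]] := filter_ex (filterI (fP E) (fP E')).
  exact: sact_wdist.
have fA : is_automorphism f.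
  split; first by exists h.
  exists id; split => //; first by exists id.
  by rewrite image_id.
have cv : (val : GT -> building_aut X) @ F --> mk_aut fA.
  move=> U [_ /= [[V oV <-] Vg]] VU.
  apply: (filterS VU) => /=.
  suff : (fun g : GT => val (val g)) @ F -->
      (f : {ptws X -> discrete_topology X}).
    by apply; exact: open_nbhs_nbhs.
  apply/cvg_sup => E A [_ [[B oB <-] BC]] BA /=.
  change (F [set h : GT | A (val (val h))]); apply: filterS (fP E) => u /= huC; apply: BA.
  by rewrite /= -[X in B X]/(sact u E) huC; exact: BC.
have fG : mk_aut fA \in G.
  apply: (closed_cvg _ clG _ _ cv).
  by apply: filterE => g /=; exact: set_valP g.
pose g0 : GT := exist (fun x => x \in [set` G]) (mk_aut fA) (mem_set fG).
exists g0; split.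
  have [g [/= <- g2]] := filter_ex (filterI FA (fP C)).
  by rewrite /carrier /= g2.
by apply: sact_cvg => E; exact: (fP E).
Qed.

End AutomorphismTopology.

(** * Haar measure of carriers *)

Section Haar.
Variables (R : realType) (W : coxeterSystem) (X : building W).
Variables (G : groupClosed (building_aut X)) (I : finType) (e : I -> W).
Local Notation GT := (subgrp G).
Variable mu : haar_measure R GT.
Hypothesis eS : forall i, cox_gens W (e i).
Hypothesis e_onto : forall s, cox_gens W s -> exists i, e i = s.
Hypothesis finX : locally_finite X.
Hypothesis clG : closed [set` G]%classic.
Hypothesis tpG : type_preserving G.
Hypothesis wtG : weyl_transitive G.
Variable C0 : X.
Local Open Scope classical_set_scope.
Local Open Scope ring_scope.

Lemma weyl_trans C D C' D' : wdist C D = wdist C' D' ->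
  exists g : GT, sact g C = C' /\ sact g D = D'.
Proof.
move=> h; have [g gG [gC gD]] := wtG h erefl.
by exists (exist (fun x => x \in [set` G]) g (mem_set gG)).
Qed.

Lemma chamber_trans C D : exists g : GT, sact g C = D.
Proof.
have [|g [gC _]] := @weyl_trans C C D D; first by rewrite !wdistxx.
by exists g.
Qed.

Lemma building_homogeneous C D : exists f : X -> X,
  [/\ bijective f, forall E F, wdist (f E) (f F) = wdist E F & f C = D].
Proof.
have [g gC] := chamber_trans C D; exists (sact g); split => //.
  by exists (sact g^-1%g); [exact: sactK|exact: sactVK].
by move=> E F; rewrite (sact_wdist tpG).
Qed.

Lemma open_measurable_borel (U : set GT) : open U -> measurable (U : set (borel GT)).
Proof. by move=> oU; apply: (@sub_sigma_algebra _ setT (@open GT)). Qed.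

Lemma carrier_measurable C D : measurable (carrier C D : set (borel GT)).
Proof. by apply: (@open_measurable_borel (carrier C D)); exact: carrier_open. Qed.

Lemma locally_constant_measurable (f : borel GT -> R) :
  (forall t : GT, nbhs t [set h | f h = f t]) -> measurable_fun setT f.
Proof.
move=> lc _ Y mY; rewrite setTI; apply: (@open_measurable_borel (f @^-1` Y)).
rewrite openE => t ft; rewrite /interior /=.
by apply: filterS (lc t) => h /= e1; rewrite /preimage /= e1.
Qed.

Lemma mu_ltrans (g : GT) (A : set (borel GT)) : measurable A ->
  mu [set t : borel GT | A (g * t)%g] = mu A.
Proof. exact: haar_lpreimage. Qed.

Let cm := carrier_measurable.

Lemma mu_carrier C D E : mu (carrier C D) = mu (carrier C E).
Proof.
have [g gD] := chamber_trans D E.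
rewrite -(mu_ltrans g (cm C E)); congr (mu _); apply/seteqP; split=> t /=.
  by rewrite /carrier /= sactM => ->.
rewrite /carrier /= sactM => h.
by apply: (can_inj (sactK g)); rewrite gD.
Qed.

Lemma mu_carrier_fin C D : (mu (carrier C D) < +oo)%E.
Proof. by apply: haar_compact; exact: (carrier_compact tpG eS e_onto finX clG). Qed.

Lemma mu_carrier_pair C D E F E' F' : wdist E F = wdist E' F' ->
  mu (carrier C E `&` carrier D F) = mu (carrier C E' `&` carrier D F').
Proof.
move=> /weyl_trans[g [gE gF]].
rewrite -(mu_ltrans g (measurableI _ _ (cm C E') (cm D F'))); congr (mu _).
apply/seteqP; split=> t /=; rewrite /carrier /= !sactM.
  by move=> [-> ->].
by rewrite -gE -gF => -[/(can_inj (sactK g)) -> /(can_inj (sactK g)) ->].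
Qed.

(** Split the carrier by the image of [D], which is one of the [valency i] chambers [i]-adjacent to
    [E]; by [mu_carrier_pair] all pieces have the same mass. *)
Lemma mu_carrier_split (C D E F : X) i : wdist C D = e i -> wdist E F = e i ->
  mu (carrier C E) = (mu (carrier C E `&` carrier D F) *+ valency e C0 i)%E.
Proof.
move=> CD EF; have fE := finite_sphere eS e_onto finX (e i) E.
rewrite -(valencyE eS e_onto finX building_homogeneous C0 i E) /set_card.
have cE : carrier C E = \bigcup_(F' in sphere (e i) E) (carrier C E `&` carrier D F') :> set GT.
  apply/seteqP; split=> [t tC|t [F' _ []]//].
  exists (sact t D); last by split.
  by rewrite /sphere /= -tC (sact_wdist tpG).
rewrite {1}cE measure_fin_bigcup //=; last 2 first.
- by move=> F' F'' _ _ [t [[_ <-] [_ <-]]].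
- by move=> F' _; apply: measurableI; exact: cm.
rewrite fsbig_finite // big_seq (eq_bigr (fun=> mu (carrier C E `&` carrier D F))).
  by rewrite -big_seq big_const_seq count_predT iter_addr_0.
move=> F'; rewrite in_fset_set // inE => EF'; apply: mu_carrier_pair.
by rewrite EF.
Qed.

(** Left invariance moves only the target of a carrier. To move the source, write both carriers as
    [valency i] times the mass of one common intersection. *)
Lemma mu_carrier_adj (C D E F : X) i : wdist C D = e i ->
  mu (carrier C E) = mu (carrier D F).
Proof.
move=> CD; have [F' EF'] := ex_wdist eS e_onto E (e i).
rewrite (mu_carrier D F F') (mu_carrier_split CD EF').
by rewrite (mu_carrier_split (wdist_gen_sym eS CD) (wdist_gen_sym eS EF')) setIC.
Qed.

Definition chamber_mass : R := fine (mu (carrier C0 C0)).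

(** In effect unimodularity: right translates of a chamber stabiliser have the same mass. *)
Lemma mu_carrierE C D : mu (carrier C D) = chamber_mass%:E.
Proof.
rewrite /chamber_mass fineK; last first.
  by rewrite ge0_fin_numE ?measure_ge0 // mu_carrier_fin.
have [w [_ gw _]] := ex_gallery eS e_onto C C0.
elim: w C D gw => [|i w IH] C D /=; first by move=> ->; exact: mu_carrier.
by move=> [E CE gE]; rewrite -(IH E D gE); exact: mu_carrier_adj CE.
Qed.

Lemma chamber_mass_ge0 : 0 <= chamber_mass.
Proof. by apply: fine_ge0; exact: measure_ge0. Qed.

Lemma carrier_inv C (t : GT) : carrier (sact t^-1%g C) C t.
Proof. exact: sactVK. Qed.

Lemma chamber_fun_measurable (f : X -> R) C :
  measurable_fun setT (fun t : borel GT => f (sact (t : GT)^-1%g C)).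
Proof.
apply: locally_constant_measurable => t.
apply: filterS (sact_near t (sact t^-1%g C)) => h /=.
by rewrite sactVK => /sact_eqV ->.
Qed.

(** The fibre over [D] of the map from [t] to [t^-1 C0] is [carrier D C0]. *)
Lemma integral_chamber (f : X -> R) : (forall D, 0 <= f D) -> fin_supp f ->
  (\int[mu]_t (f (sact (t : GT)^-1%g C0))%:E = (chamber_mass * ftotal f)%:E)%E.
Proof.
move=> f0 ff; have fE t : (f (sact (t : GT)^-1%g C0))%:E =
    (\sum_(D <- fset_set [set D | f D != 0%R]) (f D)%:E * (\1_(carrier D C0) t)%:E)%E.
  rewrite (eq_bigr (fun D => if D == sact t^-1%g C0 then (f D)%:E else 0%E)); last first.
    move=> D _; rewrite indicE; case: eqP => [->|DD].
      by rewrite mem_set ?mule1 //; exact: carrier_inv.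
    by rewrite memNset ?mule0 // => /sact_eqV /esym.
  rewrite -big_mkcond /=; have [f1|f1] := eqVneq (f (sact t^-1%g C0)) 0.
    rewrite f1 big_seq_cond big1 // => D /andP[]; rewrite in_fset_set // inE /= => fD /eqP DD.
    by move: fD; rewrite DD f1 eqxx.
  rewrite -big_filter filter_pred1_uniq ?fset_uniq ?big_seq1 //.
  by rewrite in_fset_set // inE.
under eq_integral do rewrite fE.
rewrite ge0_integral_sum //; last 2 first.
- by move=> D; apply: measurable_funeM; apply/measurable_EFinP; exact: measurable_indic.
- by move=> D t _; rewrite mule_ge0 // lee_fin.
rewrite (@totalE R X [set D | f D != 0]) // mulr_sumr -sumEFin; apply: eq_bigr => D _.
rewrite ge0_integralZl_EFin //; last first.
  by apply/measurable_EFinP; exact: measurable_indic.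
by rewrite integral_indic // setIT mu_carrierE -EFinM mulrC.
Qed.

End Haar.

(** * Locally constant functions and sums over a chamber stabiliser *)

Section Smooth.
Variables (R : realType) (W : coxeterSystem) (X : building W).
Variables (G : groupClosed (building_aut X)) (I : finType) (e : I -> W).
Local Notation GT := (subgrp G).
Variable mu : haar_measure R GT.
Hypothesis eS : forall i, cox_gens W (e i).
Hypothesis e_onto : forall s, cox_gens W s -> exists i, e i = s.
Hypothesis finX : locally_finite X.
Hypothesis tpG : type_preserving G.
Hypothesis wtG : weyl_transitive G.
Variable C0 : X.
Local Open Scope classical_set_scope.
Local Open Scope ring_scope.

Definition fixes (s : seq X) (m : GT) : Prop := {in s, forall C, sact m C = C}.

Lemma fixes1 s : fixes s 1%g.
Proof. by move=> C _; rewrite sact1. Qed.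

Lemma fixesM s (g h : GT) : fixes s g -> fixes s h -> fixes s (g * h)%g.
Proof. by move=> sg sh C Cs; rewrite sactM sh // sg. Qed.

Lemma fixesV s (g : GT) : fixes s g -> fixes s g^-1%g.
Proof. by move=> sg C Cs; apply/sact_eqV; rewrite invgK sg. Qed.

Lemma fixes_map s (g h : GT) : map (sact g) s = map (sact h) s -> fixes s (g^-1 * h)%g.
Proof.
move=> /eq_in_map gh C Cs; rewrite sactM -gh //; exact: sactK.
Qed.

Lemma near_all (s : seq X) (t : GT) :
  nbhs t [set h | {in s, forall C, sact h C = sact t C}].
Proof.
elim: s => [|C s IH]; first by apply: filterE => h /= C.
apply: filterS (filterI (sact_near t C) IH) => h [/= hC hs] D.
by rewrite inE => /orP[/eqP ->//|]; exact: hs.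
Qed.

(** The last clause puts the support into finitely many sets [carrier D C0]. The map to [t^-1 C0] is
    the right one here: functions left invariant under the stabiliser of [C0] factor through it. *)
Definition smooth (s : seq X) (z : borel GT -> R) : Prop :=
  [/\ forall t, 0 <= z t, forall m t : GT, fixes s m -> z (m * t)%g = z t &
      finite_set [set D | exists2 t : GT, z t != 0 & sact t^-1%g C0 = D]].

Lemma smoothS s s' z : {subset s <= s'} -> smooth s z -> smooth s' z.
Proof.
move=> ss [z0 zi fz]; split=> // m t fm; apply: zi => C Cs; apply: fm; exact: ss.
Qed.

Lemma smooth_measurable s z : smooth s z -> measurable_fun setT z.
Proof.
move=> [z0 zi fz]; apply: locally_constant_measurable => t.
apply: filterS (near_all (map (sact t^-1%g) s) t) => h /= ht.
rewrite -[h](mulgVK t) zi // => C Cs; rewrite sactM ht ?sactVK //.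
by rewrite map_f.
Qed.

Lemma ltrans_measurable (g : GT) (z : borel GT -> R) : measurable_fun setT z ->
  measurable_fun setT (fun t : borel GT => z (g * t : GT)%g).
Proof. by move=> mz; apply: (measurableT_comp mz); exact: lmul_measurable. Qed.

(** A coefficient of the regular representation at [h], meant for nonnegative functions; as an
    extended real it needs no integrability. *)
Definition pairing (h : GT) (u v : borel GT -> R) : \bar R :=
  (\int[mu]_t (u (h^-1 * t : GT)%g * v t)%:E)%E.

(** The orbit of the tuple [s] under the fixer of [s0]: a model for the cosets of the fixer of
    [s0 ++ s] in that of [s0]. *)
Definition orbit_tuples (s s0 : seq X) : set (seq X) :=
  [set map (sact b) s | b in [set b | fixes s0 b]].

Lemma finite_orbit_tuples s s0 : C0 \in s0 -> finite_set (orbit_tuples s s0).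
Proof.
move=> Cs0; elim: s => [|C s IH].
  apply: (@sub_finite_set _ _ [set [::]]); last exact: finite_set1.
  by move=> _ [b _ <-].
apply: (@sub_finite_set _ _ ((fun p => p.1 :: p.2) @`
    ([set D | (dist C0 D <= dist C0 C)%N] `*` orbit_tuples s s0))).
  move=> _ [b fb <-]; exists (sact b C, map (sact b) s) => //=; split => /=.
    by rewrite /dist -{1}(fb _ Cs0) (sact_wdist tpG).
  by exists b.
apply: finite_image; apply: finite_setX => //.
exact: finite_ball eS e_onto finX _ _.
Qed.

(** Multiplicativity of the index. The fibres of truncation to the first [size s0] entries are
    translates of the orbit under the fixer of [s0]. *)
Lemma orbit_tuples_card s s0 : C0 \in s0 ->
  set_card (orbit_tuples (s0 ++ s) [:: C0]) =
  (set_card (orbit_tuples s0 [:: C0]) * set_card (orbit_tuples (s0 ++ s) s0))%N.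
Proof.
move=> Cs0; have C00 := mem_head C0 [::].
rewrite (set_card_fibers (take (size s0)) (finite_orbit_tuples _ C00)).
have -> : take (size s0) @` orbit_tuples (s0 ++ s) [:: C0] = orbit_tuples s0 [:: C0].
  rewrite /orbit_tuples image_comp; apply: eq_imagel => b _ /=.
  by rewrite map_cat take_size_cat // size_map.
rewrite [X in _ = (X * _)%N]/set_card -[X in _ = (X * _)%N]sum1_size big_distrl /=.
apply: eq_big_seq => t; rewrite in_fset_set; last exact: finite_orbit_tuples.
rewrite inE mul1n => -[b0 fb0 <-].
rewrite -[RHS](@set_card_image _ _ (map (sact b0))); last 2 first.
- by apply: inj_map; exact: can_inj (sactK b0).
- exact: (finite_orbit_tuples (s0 ++ s) Cs0).
congr set_card; apply/seteqP; split=> [_ [[b fb <-] /=]|_ [_ [b fb <-] <-]].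
  rewrite map_cat take_size_cat ?size_map // => /esym /fixes_map h.
  exists (map (sact (b0^-1 * b)%g) (s0 ++ s)); first by exists (b0^-1 * b)%g.
  by rewrite -map_comp -map_cat; apply: eq_map => C /=; rewrite sactM sactVK.
split.
  exists (b0 * b)%g; last by rewrite -map_comp; apply: eq_map => C /=; rewrite sactM.
  move=> C; rewrite inE => /eqP ->; rewrite sactM fb // fb0 //.
rewrite /= -map_take map_cat take_size_cat ?size_map //.
by congr map; rewrite -[RHS]map_id; apply/eq_in_map => C /fb.
Qed.

Lemma orbit_tuples_gt0 s s0 : C0 \in s0 -> (0 < set_card (orbit_tuples s s0))%N.
Proof.
move=> Cs0; rewrite cardfs_gt0; apply/fset0Pn; exists (map (sact (1%g : GT)) s).
rewrite in_fset_set; last exact: finite_orbit_tuples.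
by rewrite inE; exists 1%g => //; exact: fixes1.
Qed.

Section Average.
Variables (s : seq X) (z : borel GT -> R).
Hypothesis zs : smooth s z.
Local Notation A := (orbit_tuples s [:: C0]).

Definition orbit_rep (t : seq X) : GT :=
  xget 1%g [set b : GT | fixes [:: C0] b /\ map (sact b) s = t].

Lemma orbit_repP t : A t -> fixes [:: C0] (orbit_rep t) /\ map (sact (orbit_rep t)) s = t.
Proof.
move=> [b fb bt]; rewrite /orbit_rep; case: xgetP => [b' _ //|/(_ b)].
by case; split.
Qed.

(** The unnormalised average of [z] over the stabiliser of [C0]; by [smooth_eq_map] the summand
    depends only on the coset of [orbit_rep r]. *)
Definition stab_sum (t : borel GT) : R :=
  \sum_(r \in A) z ((orbit_rep r)^-1 * t : GT)%g.

Let fA : finite_set A := finite_orbit_tuples s (mem_head _ _).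

Lemma smooth_eq_map (b b' t : GT) : map (sact b) s = map (sact b') s ->
  z (b^-1 * t)%g = z (b'^-1 * t)%g.
Proof.
move=> /fixes_map h; have [_ zi _] := zs.
by rewrite -[RHS](zi _ _ h) -mulgA mulVKg.
Qed.

Lemma stab_sum_inv (b t : GT) : sact b C0 = C0 -> stab_sum (b * t)%g = stab_sum t.
Proof.
move=> bC; have fb : fixes [:: C0] b by move=> C; rewrite inE => /eqP ->.
rewrite /stab_sum (reindex_fsbig (map (sact b)) A); last first.
  split.
  - move=> _ [c fc <-]; exists (b * c)%g; first exact: fixesM.
    by rewrite -map_comp; apply: eq_map => C /=; rewrite sactM.
  - by move=> x y _ _; apply: inj_map; exact: can_inj (sactK b).
  - move=> _ [c fc <-]; exists (map (sact (b^-1 * c)%g) s).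
      by exists (b^-1 * c)%g => //; apply: fixesM => //; exact: fixesV.
    by rewrite -map_comp; apply: eq_map => C /=; rewrite sactM sactVK.
apply: eq_fsbigr => r; rewrite inE => Ar; have [fr rE] := orbit_repP Ar.
have Abr : A (map (sact b) r).
  rewrite -rE; exists (b * orbit_rep r)%g; first exact: fixesM.
  by rewrite -map_comp; apply: eq_map => C /=; rewrite sactM.
have [_ brE] := orbit_repP Abr.
rewrite (@smooth_eq_map _ (b * orbit_rep r)%g); last first.
  rewrite brE -{1}rE -map_comp; apply: eq_map => C /=; by rewrite sactM.
by rewrite invgM -mulgA mulKg.
Qed.

Lemma stab_sum_ge0 t : 0 <= stab_sum t.
Proof. by apply: fsumr_ge0 => r _; have [z0 _ _] := zs. Qed.

(** The function on chambers through which [stab_sum] factors; by [stab_sum_inv] the choice of [t]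
    is immaterial. *)
Definition chamber_sum (D : X) : R := stab_sum (xget 1%g [set t : GT | sact t^-1%g C0 = D]).

Lemma stab_sumE t : stab_sum t = chamber_sum (sact (t : GT)^-1%g C0).
Proof.
rewrite /chamber_sum; case: xgetP => [t' _ /= h|/(_ t)/= //].
rewrite -[t' in RHS](mulgVK t) stab_sum_inv // sactM.
by rewrite -h sactVK.
Qed.

Lemma chamber_sum_ge0 D : 0 <= chamber_sum D.
Proof. exact: stab_sum_ge0. Qed.

Lemma fin_supp_chamber_sum : fin_supp chamber_sum.
Proof.
have [z0 _ fz] := zs; apply: sub_finite_set fz => D /=.
have [t tD] := chamber_trans wtG D C0.
have tD' : sact t^-1%g C0 = D by apply/sact_eqV; rewrite invgK.
rewrite -tD' -stab_sumE => h.
have [r Ar zr] := @fsbigN1 _ _ +%R _ _ A (fun (_ : unit) r => z ((orbit_rep r)^-1 * t : GT)%g) tt h.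
exists ((orbit_rep r)^-1 * t)%g => //.
have [fr _] := orbit_repP Ar.
by rewrite invgM invgK sactM fr // mem_head.
Qed.

End Average.

End Smooth.

(** * Sums over spheres as products of averages *)

Section RelationComposition.
Local Open Scope classical_set_scope.

Lemma relsum_comp (R : realFieldType) (T : choiceType) (r r1 r2 : T -> T -> Prop)
    (f : T -> R) x :
  (forall x, finite_set [set y | r x y]) ->
  (forall x, finite_set [set y | r1 x y]) ->
  (forall x, finite_set [set y | r2 x y]) ->
  (forall y z, r1 x y -> r2 y z -> r x z) ->
  (forall z, r x z -> exists2 y, r1 x y /\ r2 y z &
     forall y', r1 x y' -> r2 y' z -> y' = y) ->
  relsum r f x = relsum r1 (relsum r2 f) x.
Proof.
move=> fr fr1 fr2 h1 h2.
rewrite (@relsumE R T r [set y | r x y]%classic f) //.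
rewrite (@relsumE R T r1 [set y | r1 x y]%classic) //.
transitivity (\sum_(z <- fset_set [set z | r x z]) \sum_(y <- fset_set [set y | r1 x y])
    if `[< r2 y z >] then f z else 0)%R.
  apply: eq_big_seq => z; rewrite in_fset_set // inE => rxz.
  rewrite asboolT //; have [y [rxy ryz] uy] := h2 z rxz.
  rewrite (bigD1_seq y) ?fset_uniq //=; last by rewrite in_fset_set // inE.
  rewrite asboolT // big_seq_cond big1 ?addr0 // => y' /andP[].
  rewrite in_fset_set // inE => rxy' /eqP yy'.
  by rewrite asboolF // => /(uy _ rxy').
rewrite exchange_big /=; apply: eq_big_seq => y; rewrite in_fset_set // inE => rxy.
rewrite asboolT // (@relsumE R T r2 [set z | r x z]%classic) // => z ryz _.
exact: h1 ryz.
Qed.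

End RelationComposition.

Section SphereAverage.
Variables (R : realType).
Variables (W : coxeterSystem) (X : building W) (I : finType) (e : I -> W).
Hypothesis eS : forall i, cox_gens W (e i).
Hypothesis e_onto : forall s, cox_gens W s -> exists i, e i = s.
Hypothesis thickX : thick X.
Hypothesis finX : locally_finite X.
Hypothesis homX : forall C D : X, exists f : X -> X,
  [/\ bijective f, forall E F, wdist (f E) (f F) = wdist E F & f C = D].
Variable C0 : X.
Local Open Scope classical_set_scope.
Local Open Scope ring_scope.

(** By [sphere_step_uniq] the first step of a gallery of reduced type is determined by the two ends,
    so the Hecke operator of a reduced word is the product of those of its letters. *)
Lemma sphere_sum w (f : X -> R) D : reduced e w ->
  relsum (fun D E : X => wdist D E = word_val e w) f D =
  (\prod_(i <- w) (valency e C0 i)%:R) * word_avg e C0 w f D.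
Proof.
have fs v (E : X) : finite_set [set F | wdist E F = v].
  exact: (finite_sphere eS e_onto finX v E).
elim: w f D => [|i w IH] f D r.
  rewrite big_nil mul1r word_val_nil /relsum (_ : [set E | _] = [set D]) ?fsbig_set1 //.
  by apply/seteqP; split=> E /=; [move/wdist_eq1|move=> ->; rewrite wdistxx].
have rw := reduced_behead eS e_onto r.
rewrite (@relsum_comp R X _ (fun D E => wdist D E = e i)
    (fun D E => wdist D E = word_val e w)) //; last 2 first.
- move=> E F DE EF; rewrite word_val_cons -EF; apply: (wdist_up eS DE).
  by rewrite EF -word_val_cons (eqP r) (eqP rw).
- move=> F; rewrite word_val_cons => DF.
  have [||E [h1 h2] uE] := @sphere_step_uniq W X I e eS e_onto (word_val e w)^-1 i F D.
  - rewrite -(gen_inv eS i) -invgM !(wlen_inv eS e_onto) -word_val_cons.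
    by rewrite (eqP r) (eqP rw).
  - by rewrite (wdistV eS e_onto) DF invgM (gen_inv eS).
  exists E; first by split; [exact: wdist_gen_sym|rewrite (wdistV eS e_onto) h1 invgK].
  move=> E' DE' E'F; apply: uE; last exact: wdist_gen_sym.
  by rewrite (wdistV eS e_onto) E'F.
rewrite (eq_relsum (g := fun E => (\prod_(j <- w) (valency e C0 j)%:R) * word_avg e C0 w f E));
  last by move=> E _; exact: IH.
rewrite relsumZ big_cons /= /nbr_avg -/(nbr_sum e i _) [LHS]mulrC.
have q0 : (valency e C0 i)%:R != 0 :> R by rewrite gt_eqF // valency_gt0R.
rewrite -/(word_avg _ _ _ _); move: (nbr_sum e i _ D) (\prod_(_ <- _) _) => a b.
by field.
Qed.

Lemma prod_valency_gt0 w : 0 < \prod_(i <- w) (valency e C0 i)%:R :> R.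
Proof. by apply: prodr_gt0 => i _; exact: valency_gt0R. Qed.

Lemma sphere_card w D : reduced e w ->
  (set_card [set E : X | wdist D E = word_val e w])%:R =
  \prod_(i <- w) (valency e C0 i)%:R :> R.
Proof.
move=> r; have := sphere_sum (fun=> 1) D r.
rewrite relsum_cst ?mulr1 => [->|E]; last exact: (finite_sphere eS e_onto finX _ E).
rewrite (_ : word_avg e C0 w _ D = 1) ?mulr1 //.
suff -> : word_avg e C0 w (fun=> 1) = (fun=> 1 : R) by [].
elim: w {r} => //= i w ->; apply/funext => E; rewrite /nbr_avg /nbr_sum.
rewrite relsum_cst ?mulr1 => [|F]; last exact: (finite_sphere eS e_onto finX _ F).
rewrite [set_card _](valencyE eS e_onto finX homX C0 i E) mulVf //.
by rewrite gt_eqF // valency_gt0R.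
Qed.

End SphereAverage.

Lemma sqr_sum_le (R : realFieldType) (T : Type) (s : seq T) (a : T -> R) :
  ((\sum_(i <- s) a i) ^+ 2 <= (size s)%:R * \sum_(i <- s) a i ^+ 2)%R.
Proof.
elim: s => [|i s IH]; first by rewrite !big_nil expr0n mulr0.
rewrite !big_cons /=.
have h : (2 * a i * \sum_(j <- s) a j <=
    (size s)%:R * a i ^+ 2 + \sum_(j <- s) a j ^+ 2)%R.
  have -> : ((size s)%:R * a i ^+ 2 = \sum_(j <- s) a i ^+ 2)%R.
    by rewrite big_const_seq count_predT iter_addr_0 mulr_natl.
  rewrite mulr_sumr -big_split /=; apply: ler_sum => j _.
  by have := sqr_ge0 (a i - a j)%R; lra.
rewrite -natr1; lra.
Qed.

Lemma sume_const (R : realType) (T : Type) (s : seq T) (x : \bar R) :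
  (\sum_(i <- s) x = (size s)%:R%:E * x)%E.
Proof.
transitivity (\sum_(i <- s) 1%:E * x)%E; first by apply: eq_bigr => i _; rewrite mul1e.
rewrite -ge0_sume_distrl // sumEFin; congr ((_)%:E * _)%E.
by rewrite big_const_seq count_predT iter_addr_0.
Qed.

(** * Pairings of stabiliser sums as coefficients on chambers *)

Section PairingBound.
Variables (R : realType) (W : coxeterSystem) (X : building W).
Variables (G : groupClosed (building_aut X)) (I : finType) (e : I -> W).
Local Notation GT := (subgrp G).
Variable mu : haar_measure R GT.
Hypothesis eS : forall i, cox_gens W (e i).
Hypothesis e_onto : forall s, cox_gens W s -> exists i, e i = s.
Hypothesis thickX : thick X.
Hypothesis finX : locally_finite X.
Hypothesis clG : closed [set` G]%classic.
Hypothesis tpG : type_preserving G.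
Hypothesis wtG : weyl_transitive G.
Variable C0 : X.
Local Open Scope classical_set_scope.
Local Open Scope ring_scope.
Local Notation homX := (building_homogeneous tpG wtG).

Definition sqnorm (u : borel GT -> R) : \bar R := (\int[mu]_t (u t ^+ 2)%:E)%E.

Section One.
Variables (s : seq X) (z : borel GT -> R).
Hypothesis zs : smooth C0 s z.
Local Notation A := (orbit_tuples G s [:: C0]).
Local Notation rep := (@orbit_rep W X G C0 s).
Local Notation zbar := (stab_sum C0 s z).
Local Notation zeta := (chamber_sum C0 s z).

Let fA : finite_set A := finite_orbit_tuples eS e_onto finX tpG s (mem_head _ _).

Let mz : measurable_fun setT z := smooth_measurable zs.
Let z0 t : 0 <= z t. Proof. by have [] := zs. Qed.

Let stab_sumE' t : zbar t = \sum_(r <- fset_set A) z ((rep r)^-1 * t : GT)%g.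
Proof. by rewrite /stab_sum fsbig_finite. Qed.

Lemma pairing_stab_sum (g : GT) :
  pairing mu g zbar zbar =
  (\sum_(r <- fset_set A) \sum_(r' <- fset_set A)
     pairing mu ((rep r)^-1 * g * rep r')%g z z)%E.
Proof.
have mzt (h : GT) : measurable_fun setT (fun t : borel GT => z (h * t : GT)%g).
  exact: ltrans_measurable.
transitivity (\int[mu]_t (\sum_(r <- fset_set A) \sum_(r' <- fset_set A)
    (z ((rep r')^-1 * (g^-1 * t) : GT)%g * z ((rep r)^-1 * t : GT)%g)%:E))%E.
  apply: eq_integral => t _; rewrite !stab_sumE' mulr_sumr -sumEFin.
  by apply: eq_bigr => r _; rewrite mulr_suml -sumEFin.
have mprod (h h' : GT) : measurable_fun setT
    (fun t : borel GT => (z (h * t : GT)%g * z (h' * t : GT)%g)%:E).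
  by apply/measurable_EFinP; apply: measurable_funM; exact: mzt.
rewrite ge0_integral_sum //; last 2 first.
- move=> r; apply: emeasurable_sum => r'; under eq_fun do rewrite mulgA; exact: mprod.
- by move=> r t _; apply: sume_ge0 => r' _; rewrite lee_fin mulr_ge0.
apply: eq_bigr => r _; rewrite ge0_integral_sum //; last 2 first.
- move=> r'; under eq_fun do rewrite mulgA; exact: mprod.
- by move=> r' t _; rewrite lee_fin mulr_ge0.
apply: eq_bigr => r' _; rewrite /pairing.
pose F (t : borel GT) : \bar R :=
  (z (((rep r)^-1 * g * rep r')^-1 * t : GT)%g * z t)%:E.
rewrite -[RHS](@ge0_integral_ltrans R GT mu (rep r)^-1%g F); last 2 first.
- by apply/measurable_EFinP; apply: measurable_funM => //; exact: mzt.
- by move=> t; rewrite lee_fin mulr_ge0.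
apply: eq_integral => t _; rewrite /F; congr (z _ * _)%:E.
by rewrite !invgM invgK -!mulgA mulVKg.
Qed.

(** The stabiliser of [C0] is transitive on the sphere of [v] around [C0], so by invariance of
    [zbar] any chamber [E] of it may replace [sact g C0] (this is [PE]). Summing over the sphere
    turns the pairing into the sphere operator. *)
Lemma pairing_chamber_sum (g : GT) w : reduced e w ->
  wdist C0 (sact g C0) = word_val e w ->
  pairing mu g zbar zbar =
  (chamber_mass mu C0 * inner_prod (word_avg e C0 w zeta) zeta)%:E.
Proof.
move=> rw gw; set v := word_val e w in gw.
set P := pairing _ _ _ _; pose q : R := \prod_(i <- w) (valency e C0 i)%:R.
have q0 : 0 < q by exact: prod_valency_gt0.
have fz : fin_supp zeta := fin_supp_chamber_sum wtG zs.
have ze0 D : 0 <= zeta D := chamber_sum_ge0 zs D.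
have zbE t : zbar t = zeta (sact (t : GT)^-1%g C0) := stab_sumE zs t.
have fS := finite_sphere eS e_onto finX v C0.
have mz2 E E' : measurable_fun setT
    (fun t : borel GT => (zeta (sact (t : GT)^-1%g E) * zeta (sact (t : GT)^-1%g E'))%:E).
  by apply/measurable_EFinP; apply: measurable_funM; exact: chamber_fun_measurable.
have PE E : wdist C0 E = v ->
    (\int[mu]_t (zeta (sact (t : GT)^-1%g E) * zeta (sact (t : GT)^-1%g C0))%:E = P)%E.
  move=> C0E; have [|b [bC bE]] := @weyl_trans _ _ _ wtG C0 (sact g C0) C0 E.
    by rewrite C0E gw.
  rewrite -(@ge0_integral_ltrans R GT mu b) //; last by move=> t; rewrite lee_fin mulr_ge0.
  apply: eq_integral => t _; rewrite !zbE; congr (zeta _ * zeta _)%:E.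
    by rewrite !invgM !sactM -bE sactK invgK.
  by rewrite invgM sactM -{1}bC sactK.
have : (\sum_(E <- fset_set (sphere v C0)) P = (chamber_mass mu C0 *
    ftotal (fun D => relsum (fun D E : X => wdist D E = v) zeta D * zeta D))%:E)%E.
  rewrite -(integral_chamber mu eS e_onto finX clG tpG wtG); last 2 first.
  - by move=> D; rewrite mulr_ge0 //; apply: relsum_ge0.
  - exact: fin_suppMl.
  transitivity (\int[mu]_t (\sum_(E <- fset_set (sphere v C0))
      (zeta (sact (t : GT)^-1%g E) * zeta (sact (t : GT)^-1%g C0))%:E))%E.
    rewrite ge0_integral_sum //; last by move=> E t _; rewrite lee_fin mulr_ge0.
    by apply: eq_big_seq => E; rewrite in_fset_set // inE => /PE ->.
  apply: eq_integral => t _; rewrite sumEFin -mulr_suml; congr (_ * _)%:E.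
  rewrite /relsum -fsbig_finite //; apply: esym; apply: reindex_fsbig; split.
  - by move=> E h; rewrite /= (sact_wdist tpG).
  - by move=> E E' _ _; exact: (can_inj (sactK _)).
  - move=> E /= h; exists (sact t E); last by rewrite sactK.
    by rewrite /sphere /= -h -{1}(sactVK t C0) (sact_wdist tpG).
rewrite sume_const -/(set_card _).
have -> : ftotal (fun D => relsum (fun D E : X => wdist D E = v) zeta D * zeta D) =
    q * inner_prod (word_avg e C0 w zeta) zeta.
  rewrite -ipZl /inner_prod; congr ftotal; apply/funext => D.
  by rewrite (sphere_sum eS e_onto thickX finX C0).
have cq := sphere_card R eS e_onto thickX finX homX C0 C0 rw.
rewrite -[set_card _]/(set_card [set E : X | wdist C0 E = v]) cq -/q.
rewrite mulrCA EFinM => h.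
have : (q^-1%:E * (q%:E * P) =
    q^-1%:E * (q%:E * (chamber_mass mu C0 * inner_prod (word_avg e C0 w zeta) zeta)%:E))%E by rewrite h.
by rewrite !muleA -EFinM mulVf ?gt_eqF // !mul1e.
Qed.

Lemma sqnorm_stab_sum : sqnorm zbar = (chamber_mass mu C0 * inner_prod zeta zeta)%:E.
Proof.
have fz : fin_supp zeta := fin_supp_chamber_sum wtG zs.
have ze0 D : 0 <= zeta D := chamber_sum_ge0 zs D.
rewrite /inner_prod -(integral_chamber mu eS e_onto finX clG tpG wtG); last 2 first.
- by move=> D; rewrite mulr_ge0.
- exact: fin_suppMl.
by apply: eq_integral => t _; rewrite (stab_sumE zs) expr2.
Qed.

(** One factor [set_card A] comes from Cauchy-Schwarz, the other from the number of translates, all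
    of the same norm. *)
Lemma sqnorm_stab_sum_le : (sqnorm zbar <= (set_card A ^ 2)%:R%:E * sqnorm z)%E.
Proof.
have mzt (h : GT) : measurable_fun setT (fun t : borel GT => (z (h * t : GT)%g ^+ 2)%:E).
  by apply/measurable_EFinP; apply: measurable_funX; exact: ltrans_measurable.
have mz2 : measurable_fun setT (fun t : borel GT => (z t ^+ 2)%:E).
  by apply/measurable_EFinP; exact: measurable_funX.
apply: (@le_trans _ _ (\int[mu]_t ((set_card A)%:R%:E *
    \sum_(r <- fset_set A) (z ((rep r)^-1 * t : GT)%g ^+ 2)%:E))%E).
  apply: ge0_le_integral => //.
  - by move=> t _; rewrite lee_fin sqr_ge0.
  - apply/measurable_EFinP; apply: measurable_funX.
    have -> : zbar = (fun t => \sum_(r <- fset_set A) z ((rep r)^-1 * t : GT)%g) :> (borel GT -> R).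
      by apply/funext => t; exact: stab_sumE'.
    by apply: measurable_sum => r; exact: ltrans_measurable.
  - by apply: measurable_funeM; apply: emeasurable_sum => r; exact: mzt.
  - move=> t _; rewrite stab_sumE' sumEFin -EFinM lee_fin.
    exact: sqr_sum_le.
rewrite ge0_integralZl_EFin //; last 2 first.
- by move=> t _; apply: sume_ge0 => r _; rewrite lee_fin sqr_ge0.
- by apply: emeasurable_sum => r; exact: mzt.
rewrite ge0_integral_sum //; last by move=> r t _; rewrite lee_fin sqr_ge0.
rewrite (eq_bigr (fun=> sqnorm z)); last first.
  move=> r _; apply: (@ge0_integral_ltrans R GT mu _ (fun t => (z t ^+ 2)%:E)) => //.
  by move=> t; rewrite lee_fin sqr_ge0.
rewrite sume_const -/(set_card _) muleA.
by rewrite -EFinM -natrM mulnn.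
Qed.

End One.
End PairingBound.

(** * Passage from a small fixer to the stabiliser of a chamber *)

Section AveragedBound.
Variables (R : realType) (W : coxeterSystem) (X : building W).
Variables (G : groupClosed (building_aut X)) (I : finType) (e : I -> W).
Local Notation GT := (subgrp G).
Variable mu : haar_measure R GT.
Hypothesis eS : forall i, cox_gens W (e i).
Hypothesis e_onto : forall s, cox_gens W s -> exists i, e i = s.
Hypothesis thickX : thick X.
Hypothesis finX : locally_finite X.
Hypothesis clG : closed [set` G]%classic.
Hypothesis tpG : type_preserving G.
Hypothesis wtG : weyl_transitive G.
Variable C0 : X.
Local Open Scope classical_set_scope.
Local Open Scope ring_scope.

(** Cauchy-Schwarz without square roots: expand the norm of [T f - eps * f]. *)
Lemma ip_contraction (T : (X -> R) -> X -> R) (eps : R) f : 0 < eps ->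
  fin_supp f -> fin_supp (T f) ->
  inner_prod (T f) (T f) <= eps ^+ 2 * inner_prod f f ->
  inner_prod (T f) f <= eps * inner_prod f f.
Proof.
move=> eps0 ff fT h.
have fe : fin_supp (fun D => eps * f D) by exact: fin_suppMl.
have := ip_ge0 (fun D => T f D - eps * f D).
rewrite ip_sub // ipZl [inner_prod (T f) (fun D => eps * f D)]ipC ipZl.
rewrite [inner_prod f (fun D => eps * f D)]ipC ipZl [inner_prod f (T f)]ipC => h2.
rewrite -(ler_pM2l eps0); move: h h2; rewrite expr2; lra.
Qed.

(* Averaging [k1] and [k2] over the cosets of the stabiliser of [s0 ++ s] in that of
   [s0]; since the [z j] are nonnegative, the sum can be enlarged to the cosets in
   the stabiliser of [C0], where it becomes a coefficient of [word_avg]. *)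
Lemma averaged_bound (J : finType) (s0 s : seq X) (z : J -> borel GT -> R)
    (eps : R) (w : seq I) (g : GT) (c : R) :
  C0 \in s0 -> (forall j, smooth C0 s (z j)) -> 0 < eps -> reduced e w ->
  wdist C0 (sact g C0) = word_val e w ->
  (forall f : X -> R, fin_supp f ->
     inner_prod (word_avg e C0 w f) (word_avg e C0 w f) <= eps ^+ 2 * inner_prod f f) ->
  (forall k1 k2 : GT, fixes s0 k1 -> fixes s0 k2 ->
     (c%:E <= \sum_j pairing mu (k1^-1 * g * k2)%g (z j) (z j))%E) ->
  (c%:E <= (eps * (set_card (orbit_tuples G s0 [:: C0]) ^ 2)%:R)%:E *
     \sum_j sqnorm mu (z j))%E.
Proof.
move=> Cs0 zs eps0 rw gw hT hc.
pose s1 := s0 ++ s; pose AB := orbit_tuples G s1 [:: C0]; pose AK := orbit_tuples G s1 s0.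
have zs1 j : smooth C0 s1 (z j).
  by apply: smoothS (zs j) => C Cs; rewrite mem_cat Cs orbT.
have fAB : finite_set AB := finite_orbit_tuples eS e_onto finX tpG s1 (mem_head _ _).
have fAK : finite_set AK := finite_orbit_tuples eS e_onto finX tpG s1 Cs0.
have AKB : AK `<=` AB.
  by move=> _ [b fb <-]; exists b => // C; rewrite inE => /eqP ->; exact: fb.
pose rep := @orbit_rep W X G C0 s1.
have repK r : AK r -> fixes s0 (rep r).
  move=> Ar; have [_] := orbit_repP (AKB _ Ar); case: Ar => b fb <-.
  move=> /eq_in_map h C Cs; rewrite -/rep in h; rewrite h ?fb //.
  by rewrite mem_cat Cs.
pose N := set_card AK; pose n := set_card (orbit_tuples G s0 [:: C0]).
have NB : set_card AB = (n * N)%N := orbit_tuples_card eS e_onto finX tpG s Cs0.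
have N0 : (0 < N)%N := orbit_tuples_gt0 eS e_onto finX tpG s1 Cs0.
have p0 j h : (0 <= pairing mu h (z j) (z j))%E.
  have [zj0 _ _] := zs1 j.
  by apply: integral_ge0 => t _; rewrite lee_fin mulr_ge0.
have lower : ((N ^ 2)%:R%:E * c%:E <= \sum_(r <- fset_set AK) \sum_(r' <- fset_set AK)
    \sum_j pairing mu ((rep r)^-1 * g * rep r')%g (z j) (z j))%E.
  rewrite -mulnn natrM EFinM -muleA /N /set_card -sume_const big_seq [leRHS]big_seq.
  apply: lee_sum => r; rewrite in_fset_set // inE => Ar.
  rewrite -sume_const big_seq [leRHS]big_seq.
  apply: lee_sum => r'; rewrite in_fset_set // inE => Ar'.
  by apply: hc; exact: repK.
have upper : (\sum_(r <- fset_set AK) \sum_(r' <- fset_set AK)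
    \sum_j pairing mu ((rep r)^-1 * g * rep r')%g (z j) (z j) <=
    \sum_(r <- fset_set AB) \sum_(r' <- fset_set AB)
    \sum_j pairing mu ((rep r)^-1 * g * rep r')%g (z j) (z j))%E.
  have sub : {subset fset_set AK <= fset_set AB}.
    by move=> r; rewrite !in_fset_set // !inE; exact: AKB.
  apply: (@le_trans _ _ (\sum_(r <- fset_set AK) \sum_(r' <- fset_set AB)
    \sum_j pairing mu ((rep r)^-1 * g * rep r')%g (z j) (z j))%E).
    apply: lee_sum => r _; apply: lee_sum_nneg_subfset => // r' _ _.
    exact: sume_ge0.
  apply: lee_sum_nneg_subfset => // r _ _; apply: sume_ge0 => r' _.
  exact: sume_ge0.
have total_eq : (\sum_(r <- fset_set AB) \sum_(r' <- fset_set AB)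
    \sum_j pairing mu ((rep r)^-1 * g * rep r')%g (z j) (z j) =
    \sum_j pairing mu g (stab_sum C0 s1 (z j)) (stab_sum C0 s1 (z j)))%E.
  transitivity (\sum_(r <- fset_set AB) \sum_j \sum_(r' <- fset_set AB)
      pairing mu ((rep r)^-1 * g * rep r')%g (z j) (z j))%E.
    by apply: eq_bigr => r _; rewrite exchange_big.
  rewrite exchange_big /=; apply: eq_bigr => j _.
  by rewrite (pairing_stab_sum mu eS e_onto finX tpG (zs1 j)).
have bound j : (pairing mu g (stab_sum C0 s1 (z j)) (stab_sum C0 s1 (z j)) <=
    (eps * ((n * N) ^ 2)%:R)%:E * sqnorm mu (z j))%E.
  rewrite (pairing_chamber_sum mu eS e_onto thickX finX clG tpG wtG (zs1 j) rw gw).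
  have fz := fin_supp_chamber_sum wtG (zs1 j).
  have fTz := fin_supp_word_avg eS e_onto finX C0 w fz.
  apply: (@le_trans _ _ (eps%:E * sqnorm mu (stab_sum C0 s1 (z j)))%E).
    rewrite (sqnorm_stab_sum mu eS e_onto finX clG tpG wtG (zs1 j)) -EFinM lee_fin mulrCA.
    apply: ler_wpM2l; first exact: chamber_mass_ge0.
    exact: ip_contraction (hT _ fz).
  rewrite EFinM -muleA; apply: lee_wpmul2l; first by rewrite lee_fin ltW.
  by rewrite -NB; exact: sqnorm_stab_sum_le.
(* The index [N], which depends on the functions [z j], occurs squared on both sides and cancels;
   the remaining [n] depends on [s0] alone. *)
have Npos : (0 < (N ^ 2)%:R%:E :> \bar R)%E by rewrite lte_fin ltr0n expn_gt0 N0.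
rewrite -(@lee_pmul2l _ (N ^ 2)%:R%:E) //.
apply: (le_trans lower); apply: (le_trans upper); rewrite total_eq.
apply: (@le_trans _ _ (\sum_j (eps * ((n * N) ^ 2)%:R)%:E * sqnorm mu (z j))%E).
  by apply: lee_sum => j _; exact: bound.
rewrite -ge0_sume_distrr; last first.
  by move=> j _; apply: integral_ge0 => t _; rewrite lee_fin sqr_ge0.
by rewrite muleA -EFinM expnMn natrM mulrA [(N ^ 2)%:R * _]mulrC.
Qed.

End AveragedBound.

(** * Density of smooth functions among nonnegative square-integrable ones *)

Section Density.
Import HBNNSimple.
Variables (R : realType) (W : coxeterSystem) (X : building W).
Variables (G : groupClosed (building_aut X)).
Local Notation GT := (subgrp G).
Variable mu : haar_measure R GT.
Variable C0 : X.
Local Open Scope classical_set_scope.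
Local Open Scope ring_scope.
Implicit Types (u v : borel GT -> R).

Definition approximable u : Prop := forall eta : R, 0 < eta ->
  exists s z, smooth C0 s z /\ (sqnorm mu (fun t => u t - z t)%R <= eta%:E)%E.

Lemma sqnorm_measurable u : measurable_fun setT u ->
  measurable_fun setT (fun t => (u t ^+ 2)%:E).
Proof. by move=> mu_; apply/measurable_EFinP; exact: measurable_funX. Qed.

Lemma sqnorm_le2 (u v w : borel GT -> R) : measurable_fun setT u ->
  measurable_fun setT v -> measurable_fun setT w ->
  (forall t, u t = v t + w t) ->
  (sqnorm mu u <= 2%:E * sqnorm mu v + 2%:E * sqnorm mu w)%E.
Proof.
move=> mu_ mv mw h.
rewrite /sqnorm -!ge0_integralZl_EFin ?ler0n //; try exact: sqnorm_measurable;
  try by move=> t _; rewrite lee_fin sqr_ge0.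
rewrite -ge0_integralD //=; try (by apply: measurable_funeM; exact: sqnorm_measurable);
  try by move=> t _; rewrite mule_ge0 // lee_fin sqr_ge0.
apply: ge0_le_integral => //.
- by move=> t _; rewrite lee_fin sqr_ge0.
- exact: sqnorm_measurable.
- by apply: emeasurable_funD; apply: measurable_funeM; exact: sqnorm_measurable.
move=> t _; rewrite -!EFinM -EFinD lee_fin h.
by have := sqr_ge0 (v t - w t); lra.
Qed.

Lemma smooth_add s s' (z z' : borel GT -> R) : smooth C0 s z -> smooth C0 s' z' ->
  smooth C0 (s ++ s') (fun t => z t + z' t).
Proof.
move=> [z0 zi fz] [z0' zi' fz']; split.
- by move=> t; rewrite addr_ge0.
- move=> m t fm; rewrite zi ?zi' // => C Cs; apply: fm; by rewrite mem_cat Cs ?orbT.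
apply: (@sub_finite_set _ _ ([set D | exists2 t : GT, z t != 0 & sact t^-1%g C0 = D] `|`
    [set D | exists2 t : GT, z' t != 0 & sact t^-1%g C0 = D])); last by rewrite finite_setU.
move=> D [t zt tD]; have [z1|z1] := eqVneq (z t) 0; last by left; exists t.
by right; exists t => //; move: zt; rewrite z1 add0r.
Qed.

Lemma approximable_add u v : measurable_fun setT u -> measurable_fun setT v ->
  approximable u -> approximable v -> approximable (fun t => u t + v t).
Proof.
move=> mu_ mv au av eta eta0.
have e4 : 0 < eta / 4 by rewrite divr_gt0.
have [s [z [zs hz]]] := au _ e4; have [s' [z' [zs' hz']]] := av _ e4.
exists (s ++ s'), (fun t => z t + z' t); split; first exact: smooth_add.
have mz := smooth_measurable zs; have mz' := smooth_measurable zs'.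
apply: le_trans (sqnorm_le2 (v := fun t => u t - z t) (w := fun t => v t - z' t) _ _ _ _) _.
- by apply: measurable_funB; exact: measurable_funD.
- exact: measurable_funB.
- exact: measurable_funB.
- by move=> t; ring.
apply: (@le_trans _ _ (2%:E * (eta / 4)%:E + 2%:E * (eta / 4)%:E)%E).
  by apply: leeD; apply: lee_wpmul2l => //; rewrite lee_fin.
by rewrite -!EFinM -EFinD lee_fin; lra.
Qed.

Lemma approximable0 : approximable (fun=> 0).
Proof.
move=> eta eta0; exists [::], (fun=> 0); split.
  split=> //; apply: (@sub_finite_set _ _ set0) => // D [t]; by rewrite eqxx.
by rewrite /sqnorm integral0_eq ?lee_fin ?ltW // => t _; rewrite subr0 expr0n.
Qed.

Lemma approximable_scale (a : R) u : 0 <= a -> measurable_fun setT u ->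
  approximable u -> approximable (fun t => a * u t).
Proof.
move=> a0 mu_ au eta eta0.
have a1 : 0 < a ^+ 2 + 1 by rewrite ltr_wpDl // sqr_ge0.
have [s [z [zs hz]]] := au (eta / (a ^+ 2 + 1)) (divr_gt0 eta0 a1).
exists s, (fun t => a * z t); split.
  have [z0 zi fz] := zs; split.
  - by move=> t; rewrite mulr_ge0.
  - by move=> m t fm; rewrite zi.
  apply: sub_finite_set fz => D [t zt tD]; exists t => //.
  by move: zt; rewrite mulf_eq0 negb_or => /andP[].
have mz := smooth_measurable zs.
have -> : sqnorm mu (fun t => a * u t - a * z t) =
    ((a ^+ 2)%:E * sqnorm mu (fun t => u t - z t)%R)%E.
  rewrite /sqnorm -ge0_integralZl_EFin ?sqr_ge0 //.
  - by apply: eq_integral => t _; rewrite -EFinM; congr (_%:E); ring.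
  - by move=> t _; rewrite lee_fin sqr_ge0.
  - by apply: sqnorm_measurable; exact: measurable_funB.
apply: le_trans (lee_wpmul2l _ hz) _; first by rewrite lee_fin sqr_ge0.
rewrite -EFinM lee_fin mulrA ler_pdivrMr // mulrC ler_pM2l //; lra.
Qed.

Lemma approximable_lim u : measurable_fun setT u ->
  (forall eta : R, 0 < eta -> exists2 v, measurable_fun setT v /\ approximable v &
    (sqnorm mu (fun t => u t - v t)%R <= eta%:E)%E) -> approximable u.
Proof.
move=> mu_ h eta eta0; have e4 : 0 < eta / 4 by rewrite divr_gt0.
have [v [mv av] hv] := h _ e4; have [s [z [zs hz]]] := av _ e4.
exists s, z; split => //; have mz := smooth_measurable zs.
apply: le_trans (sqnorm_le2 (v := fun t => u t - v t) (w := fun t => v t - z t) _ _ _ _) _.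
- exact: measurable_funB.
- exact: measurable_funB.
- exact: measurable_funB.
- by move=> t; ring.
apply: (@le_trans _ _ (2%:E * (eta / 4)%:E + 2%:E * (eta / 4)%:E)%E).
  by apply: leeD; apply: lee_wpmul2l => //; rewrite lee_fin.
by rewrite -!EFinM -EFinD lee_fin; lra.
Qed.

Lemma subgrp_hausdorff : hausdorff_space GT.
Proof.
move=> g h gh; apply: val_inj; apply: aut_inj => C.
have [t [/= tg th]] := gh _ _ (sact_near g C) (sact_near h C).
by rewrite -[LHS]/(sact g C) -[RHS]/(sact h C) -tg -th.
Qed.

(** Cover [Q] by finitely many [V t] inside [U]. Each is a left coset of the fixer of [r' t], hence
    left invariant under the fixer of the translates of these chambers by [t], which [s]
    collects. *)
Lemma compact_thicken (Q U : set GT) : compact Q -> open U -> Q `<=` U ->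
  exists s (V : set GT), [/\ open V, Q `<=` V, V `<=` U & smooth C0 s (\1_V : borel GT -> R)].
Proof.
move=> cQ oU QU.
have /choice[r rP] (t : GT) : exists r : seq X, U t ->
    forall h, {in r, forall C, sact h C = sact t C} -> U h.
  have [Ut|nUt] := pselect (U t); last by exists [::].
  by have [r rP] := sact_nbhs (open_nbhs_nbhs (conj oU Ut)); exists r.
(* Including [t^-1 C0] makes [h^-1 C0] constant for [h] in [V t], as the support condition of
   [smooth] demands. *)
pose r' t := sact (t : GT)^-1%g C0 :: r t.
pose V (t : GT) : set GT := [set h | {in r' t, forall C, sact h C = sact t C}].
have oV t : open (V t).
  rewrite openE => h hV; rewrite /interior /=.
  apply: filterS (near_all (r' t) h) => h' /= hh' C Cr.
  by rewrite hh' // hV.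
have [D' D'Q QD'] : finite_subset_cover Q V Q.
  move: cQ; rewrite compact_cover; apply => // t Qt; exists t => //.
have VU t : Q t -> V t `<=` U.
  by move=> Qt h hV; apply: (rP t (QU _ Qt)) => C Cr; apply: hV; rewrite inE Cr orbT.
exists (flatten [seq map (sact t) (r' t) | t <- enum_fset D']), (\bigcup_(t in [set` D']) V t).
split.
- by apply: bigcup_open => t _.
- exact: QD'.
- by move=> h [t /D'Q]; rewrite inE => /VU; apply.
split.
- by move=> t; rewrite indicE.
- move=> m t fm; rewrite !indicE; congr (nat_of_bool _)%:R.
  apply/idP/idP; rewrite !inE => -[t' tD h]; exists t' => // C Cr.
    have := h C Cr; rewrite sactM => hm.
    apply: (can_inj (sactK m)); rewrite hm fm //.
    by apply/flattenP; exists (map (sact t') (r' t')); [exact: map_f|exact: map_f].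
  rewrite sactM h // fm //.
  by apply/flattenP; exists (map (sact t') (r' t')); [exact: map_f|exact: map_f].
apply: (@sub_finite_set _ _ ((fun t : GT => sact t^-1%g C0) @` [set` D'])).
  move=> D [t]; rewrite indicE pnatr_eq0 eqb0 negbK inE => -[t' tD h] <-.
  exists t' => //; apply/esym/sact_eqV; rewrite invgK.
  by rewrite h ?mem_head // sactVK.
by apply: finite_image; exact: finite_fset.
Qed.

(** Regularity gives an open [U] around [A] and a compact [Q] in [U]. The set [V] between [Q] and
    [U] is smooth, and both [A] and [V] miss at most mass [eta / 2] of [U]. *)
Lemma approximable_indic (A : set (borel GT)) : measurable A -> (mu A < +oo)%E ->
  approximable (\1_A).
Proof.
move=> mA Afin eta eta0; have e2 : 0 < eta / 2 by rewrite divr_gt0.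
have fA : mu A \is a fin_num by rewrite ge0_fin_numE ?measure_ge0.
have infA := haar_outer_regular mu mA.
have [|_ [U [oU AU] <-]] := lb_ereal_inf_adherent (S := [set mu U | U in
    [set U : set GT | open U /\ A `<=` U]]) e2; first by rewrite -infA.
rewrite -infA => hU.
have mU : measurable (U : set (borel GT)) := open_measurable_borel oU.
have fU : mu U \is a fin_num.
  rewrite ge0_fin_numE ?measure_ge0 //; apply: lt_trans hU _.
  by rewrite -(fineK fA) -EFinD ltey.
have supU := haar_inner_regular mu oU.
have [|_ [Q [cQ QU] <-]] := ub_ereal_sup_adherent (S := [set mu Q | Q in
    [set Q : set GT | compact Q /\ Q `<=` U]]) e2; first by rewrite -supU.
rewrite -supU => hQ.
have [s [V [oV QV VU Vs]]] := compact_thicken cQ oU QU.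
have mV : measurable (V : set (borel GT)) := open_measurable_borel oV.
have mQ : measurable (Q : set (borel GT)).
  rewrite -[Q]setCK; apply: measurableC; apply: (@open_measurable_borel _ _ _ (~` Q)).
  by apply: closed_openC; apply: compact_closed => //; exact: subgrp_hausdorff.
exists s, (\1_V); split => //.
have hV : (mu Q <= mu V)%E by apply: le_measure; rewrite ?inE.
have fV : mu V \is a fin_num.
  rewrite ge0_fin_numE ?measure_ge0 //; apply: (@le_lt_trans _ _ (mu U)).
    by apply: le_measure; rewrite ?inE.
  by rewrite -ge0_fin_numE ?measure_ge0.
apply: (@le_trans _ _ (\int[mu]_t ((\1_(U `\` A) t)%:E + (\1_(U `\` V) t)%:E))%E).
  apply: ge0_le_integral => //.
  - by move=> t _; rewrite lee_fin sqr_ge0.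
  - by apply: sqnorm_measurable; apply: measurable_funB; exact: measurable_indic.
  - by apply: emeasurable_funD; apply/measurable_EFinP; apply: measurable_indic;
      exact: measurableD.
  move=> t _; rewrite -EFinD lee_fin !indicE !in_setD.
  have [tA|tA] := boolP (t \in A); have [tV|tV] := boolP (t \in V).
  - by rewrite subrr expr0n /= !andbF addr0.
  - have -> : t \in U by rewrite inE; apply: AU; rewrite inE in tA.
    by rewrite /= subr0 expr1n add0r.
  - have -> : t \in U by rewrite inE; apply: VU; rewrite inE in tV.
    by rewrite /= sub0r sqrrN expr1n addr0.
  - by rewrite subrr expr0n /= addr_ge0.
rewrite ge0_integralD //; try (by move=> t _; rewrite lee_fin);
  try (by apply/measurable_EFinP; apply: measurable_indic; exact: measurableD).
rewrite !integral_indic ?setIT; try exact: measurableD; try exact: measurableT.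
rewrite !measureD //; try by rewrite -ge0_fin_numE ?measure_ge0.
rewrite (setIidr AU) (setIidr VU).
have fQ : mu Q \is a fin_num.
  rewrite ge0_fin_numE ?measure_ge0 //; exact: haar_compact.
have hU' : (fine (mu U) < fine (mu A) + eta / 2)%R by rewrite -lte_fin EFinD !fineK.
have hQ' : (fine (mu U) - eta / 2 < fine (mu Q))%R by rewrite -lte_fin EFinB !fineK.
have hV' : (fine (mu Q) <= fine (mu V))%R by exact: fine_le.
have -> : (mu U - mu A + (mu U - mu V) =
    ((fine (mu U) - fine (mu A)) + (fine (mu U) - fine (mu V)))%R%:E)%E.
  by rewrite EFinD !EFinB !fineK.
by rewrite lee_fin; move: hU' hQ' hV'; move: (fine _) (fine _) (fine _) (fine _) => *; lra.
Qed.

(** Increasing simple functions converge to [u] in L2 by dominated convergence; their level sets at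
    positive values have finite mass by Chebyshev's inequality. *)
Lemma approximable_sqnorm u : (forall t, 0 <= u t) -> measurable_fun setT u ->
  (sqnorm mu u < +oo)%E -> approximable u.
Proof.
move=> u0 mu_ ufin; apply: approximable_lim => // eta eta0.
have muE : measurable_fun setT (EFin \o u) by exact/measurable_EFinP.
have uE0 t : setT t -> (0 <= (EFin \o u) t)%E by move=> _; rewrite lee_fin.
pose f n : {nnsfun (borel GT) >-> R} := nnsfun_approx measurableT muE n.
have fle n t : f n t <= u t.
  by have := le_approx n uE0 (x := t) I; rewrite -nnsfun_approxE lee_fin.
have f0 n t : 0 <= f n t by exact: fun_ge0.
have mf n : measurable_fun setT (f n) by exact: measurable_funPT.
have fapp n : approximable (f n).
  have fsum : forall s : seq R, (forall y, y \in s -> 0 <= y) ->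
      measurable_fun setT (fun t => \sum_(y <- s) y * \1_(f n @^-1` [set y]) t) /\
      approximable (fun t => \sum_(y <- s) y * \1_(f n @^-1` [set y]) t).
    have my y : measurable (f n @^-1` [set y]).
      by rewrite -[_ @^-1` _]setTI; apply: mf => //; exact: measurable_set1.
    elim=> [|y s IH] sy.
      have -> : (fun t => \sum_(y <- [::]) y * \1_(f n @^-1` [set y]) t) =
          (fun=> 0) :> (borel GT -> R).
        by apply/funext => t; rewrite big_nil.
      by split; [exact: measurable_cst|exact: approximable0].
    have [|ms aps] := IH; first by move=> x xs; apply: sy; rewrite inE xs orbT.
    have -> : (fun t => \sum_(x <- y :: s) x * \1_(f n @^-1` [set x]) t) =
        (fun t => y * \1_(f n @^-1` [set y]) t +
           \sum_(x <- s) x * \1_(f n @^-1` [set x]) t) :> (borel GT -> R).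
      by apply/funext => t; rewrite big_cons.
    have mi : measurable_fun setT (\1_(f n @^-1` [set y]) : borel GT -> R).
      exact: measurable_indic.
    have mi2 : measurable_fun setT (fun t : borel GT => y * \1_(f n @^-1` [set y]) t).
      exact: measurable_funM.
    split; first exact: measurable_funD.
    apply: approximable_add => //.
    have := sy y (mem_head _ _); rewrite le_eqVlt => /orP[/eqP <-|y0].
      have -> : (fun t => 0 * \1_(f n @^-1` [set 0]) t) = (fun=> 0) :> (borel GT -> R).
        by apply/funext => t; rewrite mul0r.
      exact: approximable0.
    apply: approximable_scale => //; first exact: ltW.
    apply: approximable_indic => //.
    have y2 : 0 < y ^+ 2 by rewrite exprn_gt0.
    have : ((y ^+ 2)%:E * mu (f n @^-1` [set y]) <= sqnorm mu u)%E.
      rewrite -[X in mu X]setIT -integral_indic // -ge0_integralZl_EFin //;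
        try (exact: ltW); try (by move=> t _; rewrite lee_fin); try exact/measurable_EFinP.
      apply: ge0_le_integral => //.
      - by move=> t _; rewrite mule_ge0 ?lee_fin // ltW.
      - by apply: measurable_funeM; exact/measurable_EFinP.
      - exact: sqnorm_measurable.
      move=> t _; rewrite -EFinM lee_fin indicE.
      have [|_] := boolP (t \in _); last by rewrite mulr0 sqr_ge0.
      rewrite inE /= => <-; rewrite mulr1; apply: lerXn2r => //; rewrite ?nnegrE //.
    move=> /le_lt_trans /(_ ufin); rewrite ltNge [X in _ -> is_true X]ltNge.
    by apply: contraNN; rewrite !leye_eq => /eqP ->; rewrite gt0_muley.
  have -> : (f n : borel GT -> R) =
      (fun t => \sum_(y <- fset_set (range (f n))) y * \1_(f n @^-1` [set y]) t).
    by apply/funext => t; rewrite fimfunE fsbig_finite.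
  apply: (fsum _ _).2 => y; rewrite in_fset_set // inE => -[t _ <-]; exact: f0.
have lim0 : (\int[mu]_t ((u t - f n t) ^+ 2)%:E @[n --> \oo] --> \int[mu]_t (cst 0%E t))%E.
  apply: (@dominated_cvg _ _ _ mu setT measurableT (fun n t => ((u t - f n t) ^+ 2)%:E)
    (cst 0%E) (fun t => (u t ^+ 2)%:E)) => //.
  - by move=> n; apply: sqnorm_measurable; exact: measurable_funB.
  - move=> t _.
    have := cvg_nnsfun_approx measurableT muE uE0 (x := t) I.
    move=> /fine_cvgP[_ h]; apply/fine_cvgP; split; first exact: nearW.
    suff : ((u t - f n t) * (u t - f n t) @[n --> \oo] --> ((u t - u t) * (u t - u t) : R)).
      by rewrite subrr mulr0; exact.
    by apply: cvgM; apply: cvgB => //; exact: cvg_cst.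
  - apply/integrableP; split; first exact: sqnorm_measurable.
    rewrite (eq_integral (fun t => (u t ^+ 2)%:E)) // => t _.
    by rewrite gee0_abs // lee_fin sqr_ge0.
  - move=> n t _; rewrite gee0_abs ?lee_fin ?sqr_ge0 //.
    apply: lerXn2r; rewrite ?nnegrE ?subr_ge0 //.
    by rewrite lerBlDr lerDl.
rewrite integral0 in lim0.
move/fine_cvgP: lim0 => [fin /cvgrPdist_le /(_ _ eta0) lim0].
have [n _ /(_ n (leqnn n)) [/= fn hn]] := filterI fin lim0.
exists (f n) => //; rewrite /sqnorm -(fineK fn) lee_fin.
by move: hn; rewrite sub0r normrN; apply: le_trans; exact: ler_norm.
Qed.

End Density.

(** * Stability of pairings under L2-perturbation *)

Section PairingEstimates.
Variables (R : realType) (W : coxeterSystem) (X : building W).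
Variables (G : groupClosed (building_aut X)).
Local Notation GT := (subgrp G).
Variable mu : haar_measure R GT.
Local Open Scope classical_set_scope.
Local Open Scope ring_scope.
Implicit Types (u z : borel GT -> R).

Lemma sqnorm_ltrans u (h : GT) : measurable_fun setT u ->
  (\int[mu]_t (u (h * t : GT)%g ^+ 2)%:E)%E = sqnorm mu u.
Proof.
move=> mu_; apply: (@ge0_integral_ltrans R GT mu h (fun t => (u t ^+ 2)%:E)).
  exact: sqnorm_measurable.
by move=> t; rewrite lee_fin sqr_ge0.
Qed.

(** Expand along [u = z + r]. Young's inequality treats the two mixed terms with weight [th] on [z],
    and the term in [r] alone with weight [1]. *)
Lemma pairing_perturb u z (th : R) (h : GT) : 0 < th ->
  (forall t, 0 <= u t) -> (forall t, 0 <= z t) ->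
  measurable_fun setT u -> measurable_fun setT z ->
  (pairing mu h u u <= pairing mu h z z +
    (th%:E * sqnorm mu z + (th^-1 + 1)%:E * sqnorm mu (fun t => u t - z t)%R))%E.
Proof.
move=> th0 u0 z0 mu_ mz.
pose r := (fun t : borel GT => u t - z t).
have mr : measurable_fun setT r by exact: measurable_funB.
have mt (f : borel GT -> R) : measurable_fun setT f ->
    measurable_fun setT (fun t : borel GT => f (h^-1 * t : GT)%g).
  exact: ltrans_measurable.
have msq (f : borel GT -> R) : measurable_fun setT f ->
    measurable_fun setT (fun t : borel GT => (f (h^-1 * t : GT)%g ^+ 2)%:E).
  by move=> mf; apply: (@sqnorm_measurable _ _ _ _ (fun t => f (h^-1 * t : GT)%g)); exact: mt.
have mprod (f : borel GT -> R) : measurable_fun setT f ->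
    measurable_fun setT (fun t : borel GT => (f (h^-1 * t : GT)%g * f t)%:E).
  by move=> mf; apply/measurable_EFinP; apply: measurable_funM => //; exact: mt.
pose F (f : borel GT -> R) (t : borel GT) : \bar R :=
  ((f (h^-1 * t : GT)%g ^+ 2)%:E + (f t ^+ 2)%:E)%E.
have mF (f : borel GT -> R) : measurable_fun setT f -> measurable_fun setT (F f).
  by move=> mf; apply: emeasurable_funD; [exact: msq|exact: sqnorm_measurable].
have F0 (f : borel GT -> R) t : (0 <= F f t)%E by rewrite adde_ge0 // lee_fin sqr_ge0.
have intF (f : borel GT -> R) : measurable_fun setT f -> (\int[mu]_t F f t = 2%:E * sqnorm mu f)%E.
  move=> mf; rewrite ge0_integralD //=; [|by move=> t _; rewrite lee_fin sqr_ge0|exact: msq|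
    by move=> t _; rewrite lee_fin sqr_ge0|exact: sqnorm_measurable].
  by rewrite sqnorm_ltrans // -mule2n -mule_natl.
have c1 : 0 <= th / 2 by rewrite divr_ge0 // ltW.
have c2 : 0 <= (th^-1 + 1) / 2 by rewrite divr_ge0 // addr_ge0 // invr_ge0 ltW.
apply: (@le_trans _ _ (\int[mu]_t ((z (h^-1 * t : GT)%g * z t)%:E +
    ((th / 2)%:E * F z t + ((th^-1 + 1) / 2)%:E * F r t)))%E).
  apply: ge0_le_integral => //.
  - by move=> t _; rewrite lee_fin mulr_ge0.
  - exact: mprod.
  - apply: emeasurable_funD; first exact: mprod.
    by apply: emeasurable_funD; apply: measurable_funeM; exact: mF.
  move=> t _; rewrite /F /= !(=^~ EFinD, =^~ EFinM) lee_fin /r.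
  move: (u _) (u t) (z _) (z t) => A B Z Y.
  have s1 := sqr_ge0 (th * Z - (B - Y)); have s2 := sqr_ge0 (th * Y - (A - Z)).
  have s3 := sqr_ge0 ((A - Z) - (B - Y)).
  have -> : A * B = Z * Y + (Z * (B - Y) + (A - Z) * Y + (A - Z) * (B - Y)) by ring.
  rewrite lerD2l.
  have e1 : Z * (B - Y) <= th / 2 * Z ^+ 2 + th^-1 / 2 * (B - Y) ^+ 2.
    rewrite -subr_ge0 (_ : _ - _ = (th * Z - (B - Y)) ^+ 2 / (2 * th)).
      by rewrite divr_ge0 // mulr_ge0 // ltW.
    by field; rewrite gt_eqF.
  have e2 : (A - Z) * Y <= th / 2 * Y ^+ 2 + th^-1 / 2 * (A - Z) ^+ 2.
    rewrite -subr_ge0 (_ : _ - _ = (th * Y - (A - Z)) ^+ 2 / (2 * th)).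
      by rewrite divr_ge0 // mulr_ge0 // ltW.
    by field; rewrite gt_eqF.
  have e3 : (A - Z) * (B - Y) <= ((A - Z) ^+ 2 + (B - Y) ^+ 2) / 2 by lra.
  apply: le_trans (lerD (lerD e1 e2) e3) _.
  by rewrite le_eqVlt; apply/orP; left; apply/eqP; field; rewrite gt_eqF.
rewrite ge0_integralD //=; last 4 first.
- by move=> t _; rewrite lee_fin mulr_ge0.
- exact: mprod.
- by move=> t _; rewrite adde_ge0 // mule_ge0 // lee_fin.
- by apply: emeasurable_funD; apply: measurable_funeM; exact: mF.
rewrite ge0_integralD //=; last 4 first.
- by move=> t _; rewrite mule_ge0 // lee_fin.
- by apply: measurable_funeM; exact: mF.
- by move=> t _; rewrite mule_ge0 // lee_fin.
- by apply: measurable_funeM; exact: mF.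
rewrite !ge0_integralZl_EFin //; try exact: mF.
rewrite !intF // !muleA -!EFinM.
by rewrite !divfK.
Qed.

End PairingEstimates.

(** * Bounds for coefficients of the regular representation *)

Section RegularCoefficients.
Variables (R : realType) (G : topGroupType) (mu : haar_measure R G).
Local Open Scope classical_set_scope.
Local Open Scope ring_scope.
Local Open Scope complex_scope.
Local Open Scope quotient_scope.
Local Notation Re := (@complex.Re R).
Local Notation Im := (@complex.Im R).

(** The norm of [R[i]] takes its values in [R[i]]; this is the same number in [R]. *)
Definition cabs (z : R[i]) : R := Re `|z|.

Lemma cabsE z : `|z| = (cabs z)%:C.
Proof. by rewrite /cabs normc_def. Qed.

Lemma cabs_ge0 z : 0 <= cabs z.
Proof. by rewrite /cabs normc_def /= sqrtr_ge0. Qed.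

Lemma cabsD z w : cabs (z + w) <= cabs z + cabs w.
Proof. by rewrite -lecR -cabsE rmorphD /= -!cabsE ler_normD. Qed.

Lemma cabs_sum (T : Type) (s : seq T) (F : T -> R[i]) :
  cabs (\sum_(i <- s) F i) <= \sum_(i <- s) cabs (F i).
Proof.
elim: s => [|i s IH]; first by rewrite !big_nil /cabs normr0.
by rewrite !big_cons (le_trans (cabsD _ _)) // lerD2l.
Qed.

Lemma cabs_ReIm z : cabs z <= `|Re z| + `|Im z|.
Proof.
rewrite /cabs normc_def /= -[leRHS]ger0_norm ?addr_ge0 // -sqrtr_sqr.
apply: ler_wsqrtr; rewrite sqrrD !real_normK ?num_real // -addrA lerD2l lerDr.
by rewrite mulrn_wge0 ?mulr_ge0.
Qed.

Lemma Re_le_cabs z : Re z <= cabs z.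
Proof.
rewrite /cabs normc_def /=; apply: le_trans (ler_norm _) _.
by rewrite -sqrtr_sqr; apply: ler_wsqrtr; rewrite lerDl sqr_ge0.
Qed.

(** Used in place of the modulus, which it dominates: no square root occurs under the integral, at
    the price of the factor [2] in [sqnorm_abs_repr]. *)
Definition abs_repr (y : L2 mu) (t : borel G) : R :=
  `|Re (sqint_fun (repr y) t)| + `|Im (sqint_fun (repr y) t)|.

Lemma abs_repr_ge0 y t : 0 <= abs_repr y t.
Proof. by rewrite addr_ge0. Qed.

Lemma Lfun_measurable (f : borel G -> R) : f \in Lfun mu 2%:E -> measurable_fun setT f.
Proof. by rewrite inE => /andP[+ _]; rewrite inE. Qed.

Lemma abs_repr_measurable y : measurable_fun setT (abs_repr y).
Proof.
have [fr fi] := sqintP (repr y).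
apply: measurable_funD; apply: measurableT_comp; try exact: normr_measurable.
  exact: (Lfun_measurable fr).
exact: (Lfun_measurable fi).
Qed.

Lemma sqnorm_abs_repr (y : L2 mu) :
  (\int[mu]_t (abs_repr y t ^+ 2)%:E <= (2 * Re (inner y y))%:E)%E.
Proof.
have [fr fi] := sqintP (repr y).
pose F (x : borel G) := Re (sqint_fun (repr y) x) ^+ 2 + Im (sqint_fun (repr y) x) ^+ 2.
have int2 : mu.-integrable setT (EFin \o F).
  have := integrableD measurableT
    (Lfun2_integrable_sqr fr) (Lfun2_integrable_sqr fi).
  by congr integrable; apply/funext.
have e1 : Re (inner y y) = (\int[mu]_x F x)%R.
  rewrite -[inner y y]/(L2_inner y y) /L2_inner /cintegral /=.
  by apply: eq_Rintegral => x _; rewrite /F; case: (sqint_fun _ x) => ? ? /=;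
    rewrite mulrN opprK !expr2.
have e2 : ((Re (inner y y))%:E = \int[mu]_x (F x)%:E)%E.
  by rewrite e1 /Rintegral fineK //; exact: integrable_fin_num.
have F0 x : 0 <= F x by rewrite addr_ge0 ?sqr_ge0.
rewrite EFinM e2 -ge0_integralZl_EFin //; last 2 first.
- by move=> x _; rewrite lee_fin.
- exact: (measurable_int _ int2).
apply: ge0_le_integral => //.
- by move=> x _; rewrite lee_fin sqr_ge0.
- by apply/measurable_EFinP; apply: measurable_funX; exact: abs_repr_measurable.
- by apply: measurable_funeM; exact: (measurable_int _ int2).
move=> x _; rewrite -EFinM lee_fin /abs_repr /F.
move: (Re _) (Im _) => a b.
have := sqr_ge0 (`|a| - `|b|); rewrite -(real_normK (num_real a)) -(real_normK (num_real b)); lra.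
Qed.

Lemma le_norm_fine (x : \bar R) : ((`|fine x|)%:E <= `|x|)%E.
Proof. by case: x => [r| |] //=; rewrite normr0 ?leey. Qed.

(** Real and imaginary part are each bounded by the same integral, whence the factor [2]. *)
Lemma regular_coefficient_le (h : G) (y : L2 mu) :
  ((cabs (coefficient (regular_rep mu) y y h))%:E <=
   2%:E * \int[mu]_t (abs_repr y (h^-1 * t : G)%g * abs_repr y t)%:E)%E.
Proof.
set f := repr y.
have -> : coefficient (regular_rep mu) y y h =
    cintegral mu (fun t => sqint_fun f (h^-1 * t : G)%g * (sqint_fun f t)^*).
  rewrite /coefficient -[LHS]/(L2_inner (reg_act h y) y) -{1 2}[y]reprK.
  by rewrite reg_actE L2_innerE.
have [ir ii] := sqint_mul (sqint_ltransf h f) f.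
set P := (\int[mu]_t _)%E.
have mu_ := abs_repr_measurable y.
have mP : measurable_fun setT (fun t : borel G => (abs_repr y (h^-1 * t : G)%g * abs_repr y t)%:E).
  apply/measurable_EFinP; apply: measurable_funM => //.
  by apply: (measurableT_comp mu_); exact: lmul_measurable.
have bnd (F : borel G -> R) : measurable_fun setT F ->
    (forall t, `|F t| <= abs_repr y (h^-1 * t : G)%g * abs_repr y t) ->
    ((`| \int[mu]_t F t |%R)%:E <= P)%E.
  move=> mF hF; apply: le_trans (le_norm_fine _) _.
  have mF' : measurable_fun setT (EFin \o F) by exact/measurable_EFinP.
  apply: le_trans (le_abse_integral mu measurableT mF') _.
  apply: ge0_le_integral => //.
  - exact: measurableT_comp.
  - by move=> t _; rewrite /= lee_fin.
apply: (@le_trans _ _ (P + P)%E); last by rewrite -mule2n mule_natl.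
rewrite /cintegral.
apply: (@le_trans _ _ (`|\int[mu]_t Re (sqint_fun f (h^-1 * t : G)%g * (sqint_fun f t)^*)|%R%:E +
   `|\int[mu]_t Im (sqint_fun f (h^-1 * t : G)%g * (sqint_fun f t)^*)|%R%:E)%E).
  by rewrite -EFinD lee_fin; exact: cabs_ReIm.
apply: leeD; apply: bnd.
- exact: (Lfun1_meas ir).
- move=> t; rewrite /abs_repr -/f; case: (sqint_fun f _) => a b; case: (sqint_fun f t) => c d /=.
  rewrite mulrN opprK (le_trans (ler_normD _ _)) // !normrM.
  by rewrite mulrDl !mulrDr lerD // ?lerDl ?lerDr mulr_ge0.
- exact: (Lfun1_meas ii).
- move=> t; rewrite /abs_repr -/f; case: (sqint_fun f _) => a b; case: (sqint_fun f t) => c d /=.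
  rewrite mulrN addrC (le_trans (ler_normD _ _)) // normrN !normrM.
  by rewrite mulrDl !mulrDr addrC lerD // ?lerDl ?lerDr mulr_ge0.
Qed.

End RegularCoefficients.

(** * Inner products and coefficients of unitary actions *)

Section PreHilbertTheory.
Local Open Scope ring_scope.
Local Open Scope complex_scope.
Variables (R : realType) (H : prehilbertType R).
Implicit Types x y z : H.

Lemma innerDl x y z : inner (x + y) z = inner x z + inner y z.
Proof. exact: linearDl. Qed.

Lemma innerDr x y z : inner x (y + z) = inner x y + inner x z.
Proof. exact: linearDr. Qed.

Lemma innerZl a x y : inner (a *: x) y = a * inner x y.
Proof. exact: linearZl. Qed.

Lemma innerZr a x y : inner x (a *: y) = conjc a * inner x y.
Proof. exact: linearZr. Qed.

Lemma innerBl x y z : inner (x - y) z = inner x z - inner y z.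
Proof. exact: linearBl. Qed.

Lemma innerBr x y z : inner x (y - z) = inner x y - inner x z.
Proof. exact: linearBr. Qed.

Lemma innerC x y : inner x y = conjc (inner y x).
Proof. by rewrite [LHS]hermC expr0 mul1r. Qed.

Lemma inner_ge0 x : 0 <= inner x x.
Proof. exact: dnorm_ge0. Qed.

Lemma inner_cauchy_schwarz x y : `|inner x y| ^+ 2 <= inner x x * inner y y.
Proof.
have [->|y0] := eqVneq y 0.
  by rewrite [inner x 0]linear0r normr0 expr0n /= [inner 0 0]linear0r mulr0.
have d0 : 0 < inner y y by rewrite [_ < _]dnorm_gt0.
have dR : conjc (inner y y) = inner y y by rewrite -innerC.
have := inner_ge0 (inner y y *: x + (- inner x y) *: y).
rewrite !(innerDl, innerDr, innerZl, innerZr) dR [inner y x]innerC rmorphN /=.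
set b := inner x y; set d := inner y y; set a := inner x x.
rewrite (_ : _ + _ = d * (a * d - b * conjc b)); last by ring.
by rewrite pmulr_rge0 // subr_ge0 -[b * conjc b]normCK.
Qed.

Lemma polarization (f : {linear H -> H}) x y :
  let p c := inner (f (x + c *: y)) (x + c *: y) in
  4 * inner (f x) y = p 1 - p (-1) + 'i%C * (p 'i%C - p (- 'i%C)).
Proof.
move=> p; have pE c : p c = inner (f x) x + conjc c * inner (f x) y +
    (c * inner (f y) x + c * conjc c * inner (f y) y).
  have -> : p c = inner (f x + c *: f y) (x + c *: y).
    by rewrite /p (raddfD f); congr (inner (_ + _) _); exact: linearZ_LR.
  by rewrite innerDl !innerDr !innerZl !innerZr mulrA.
have i2 : 'i%C ^+ 2 = -1 :> R[i] by exact: sqr_i.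
have ic : conjc ('i%C : R[i]) = - 'i%C by apply/eqP; rewrite eq_complex /= oppr0 !eqxx.
have c1 : conjc (1 : R[i]) = 1 by exact: rmorph1.
have cN c : conjc (- c : R[i]) = - conjc c by exact: rmorphN.
rewrite !pE !cN ic c1.
move: (inner _ _) (inner _ _) (inner _ _) (inner _ _) => A B C D.
by ring: i2.
Qed.

End PreHilbertTheory.

Section HilbertTheory.
Local Open Scope ring_scope.
Local Open Scope complex_scope.
Variables (R : realType) (H : hilbertType R).
Implicit Types x y z : H.

Lemma inner_le_norm x y : `|inner x y| <= `|x| * `|y|.
Proof.
rewrite -(@ler_pXn2r _ 2) ?nnegrE ?mulr_ge0 // exprMn -!inner_norm.
exact: inner_cauchy_schwarz.
Qed.

Definition hnorm x : R := cabs `|x|.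

Lemma hnormE x : `|x| = (hnorm x)%:C.
Proof. by rewrite /hnorm -cabsE normr_id. Qed.

Lemma hnorm_ge0 x : 0 <= hnorm x.
Proof. exact: cabs_ge0. Qed.

Lemma cabs_inner_le x y : cabs (inner x y) <= hnorm x * hnorm y.
Proof. by rewrite -lecR -cabsE rmorphM /= -!hnormE inner_le_norm. Qed.

Variables (G : topGroupType).

Lemma act_norm (pi : unitary_action G H) g x : `|pi g x| = `|x|.
Proof.
apply/eqP; rewrite -(@eqrXn2 _ 2) //; apply/eqP.
by rewrite -!inner_norm act_inner.
Qed.

Lemma hnorm_act (pi : unitary_action G H) g x : hnorm (pi g x) = hnorm x.
Proof. by rewrite /hnorm act_norm. Qed.

(** The coefficient at [k1^-1 * g * k2] is that of [pi k2 x] and [pi k1 x] at [g], so it hardly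
    changes along the double coset when [k1] and [k2] almost fix [x]. *)
Lemma coefficient_perturb (pi : unitary_action G H) g k1 k2 x :
  cabs (coefficient pi x x g) <=
  cabs (coefficient pi x x (k1^-1 * g * k2)%g) +
  (hnorm (pi k2 x - x) + hnorm (pi k1 x - x)) * hnorm x.
Proof.
have e1 : coefficient pi x x (k1^-1 * g * k2)%g = inner (pi g (pi k2 x)) (pi k1 x).
  rewrite /coefficient -(act_inner pi k1) -(actM pi k1) -(actM pi g); congr (inner (pi _ x) _).
  by rewrite -mulgA mulVKg.
have e2 : coefficient pi x x g = inner (pi g (pi k2 x)) (pi k1 x) +
    (- inner (pi g (pi k2 x - x)) (pi k1 x) - inner (pi g x) (pi k1 x - x)).
  rewrite /coefficient (raddfB (pi g)) innerBl innerBr.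
  by move: (inner _ _) (inner _ _) (inner _ _) => a b c; ring.
rewrite e1 e2; apply: le_trans (cabsD _ _) _; rewrite lerD2l.
apply: le_trans (cabsD _ _) _; rewrite /cabs !normrN -!/(cabs _) mulrDl.
apply: lerD; apply: le_trans (cabs_inner_le _ _) _; rewrite !hnorm_act //.
by rewrite mulrC.
Qed.

Lemma coefficient_continuous (pi : unitary_rep G H) x y :
  continuous (coefficient pi x y : G -> R[i]^o).
Proof.
move=> g; apply/cvgrPdist_lt => eps eps0.
have y1 : 0 < `|y| + 1 by rewrite ltr_wpDl.
have /cvgrPdist_lt /(_ (eps / (`|y| + 1)) (divr_gt0 eps0 y1)) := @rep_continuous _ _ _ pi x g.
apply: filterS => h hg; rewrite /coefficient.
have -> : inner (pi g x) y - inner (pi h x) y = inner (pi g x - pi h x) y.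
  by rewrite innerBl.
apply: le_lt_trans (inner_le_norm _ _) _.
apply: (@le_lt_trans _ _ (eps / (`|y| + 1) * `|y|)).
  by apply: ler_wpM2r => //; exact: ltW.
by rewrite -mulrA gtr_pMr // mulrC ltr_pdivrMr // mul1r ltrDl.
Qed.

End HilbertTheory.

(** * Decay of diagonal coefficients *)

Section Vanishing.
Local Open Scope classical_set_scope.
Local Open Scope ring_scope.
Local Open Scope complex_scope.
Variables (R : realType) (W : coxeterSystem) (X : building W).
Variables (G : groupClosed (building_aut X)) (I : finType) (e : I -> W).
Local Notation GT := (subgrp G).
Variable mu : haar_measure R GT.
Hypothesis eS : forall i, cox_gens W (e i).
Hypothesis e_onto : forall s, cox_gens W s -> exists i, e i = s.
Hypothesis thickX : thick X.
Hypothesis finX : locally_finite X.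
Hypothesis clG : closed [set` G]%classic.
Hypothesis tpG : type_preserving G.
Hypothesis wtG : weyl_transitive G.
Variable C0 : X.
Variables (H : hilbertType R) (pi : unitary_rep GT H).
Hypothesis wc : weakly_contained pi (regular_rep mu).
Local Notation Re := (@complex.Re R).

Lemma compact_finite_displacement (B : set X) : finite_set B ->
  compact [set g : GT | B (sact g C0)].
Proof.
move=> fB; rewrite compact_ultra => F FU FA.
have FP : ProperFilter F := ultra_proper.
have [D FD] := ultra_finite FU fB FA.
have := carrier_compact tpG eS e_onto finX clG (C := C0) (D := D).
rewrite compact_ultra => /(_ F FU FD) [g [gD Fg]]; exists g; split => //.
have [h [/= hB hD]] := filter_ex (filterI FA FD).
by move: gD; rewrite /carrier /= => ->; rewrite -hD.
Qed.

(* The approximants [y_j] provided by weak containment are replaced by smooth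
   functions [z_j] close to [|y_j|]; the tolerance is spread over the stages. *)
Lemma diagonal_coefficient_vanish (x : H) (E : R) : 0 < E ->
  exists2 Q : set GT, compact Q & forall g, ~ Q g -> cabs (coefficient pi x x g) < E.
Proof.
move=> E0; pose a := cabs (inner x x); have a0 : 0 <= a := cabs_ge0 _.
(* Two displacements below [d1], multiplied by [hnorm x], cost at most [E / 4]. *)
pose d1 := E / (8 * (hnorm x + 1)).
have hx1 : 0 < hnorm x + 1 by rewrite ltr_wpDl // hnorm_ge0.
have d10 : 0 < d1 by rewrite divr_gt0 // mulr_gt0.
have d10C : 0 < d1%:C :> R[i] by rewrite ltcR.
have [s1 s1P] : exists s : seq X, forall k : GT, fixes s k -> hnorm (pi k x - x) < d1.
  have /cvgrPdist_lt /(_ _ d10C) := @rep_continuous _ _ _ pi x 1%g.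
  move=> /sact_nbhs [s sP]; exists s => k ks.
  have := sP k; rewrite act1 => /(_ ks).
  by rewrite distrC hnormE ltcR.
pose s0 := C0 :: s1; have Cs0 : C0 \in s0 := mem_head _ _.
have small k : fixes s0 k -> hnorm (pi k x - x) < d1.
  by move=> fk; apply: s1P => C Cs; apply: fk; rewrite inE Cs orbT.
pose n := set_card (orbit_tuples G s0 [:: C0]).
have n0 : (0 < n)%N := orbit_tuples_gt0 eS e_onto finX tpG s0 (mem_head C0 [::]).
(* Bounds the total [sqnorm] of the [z j] for every [g]: [a + 1] bounds the total norm of the
   approximants, the factors [2] come from [sqnorm_abs_repr] and [sqnorm_le2], and the summand [2]
   covers the smoothing errors. *)
pose M0 := 4 * (a + 1) + 2; have M00 : 0 < M0 by rewrite /M0; lra.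
pose n2 : R := (n ^ 2)%:R.
have n20 : 0 < n2 by rewrite ltr0n expn_gt0 n0.
(* Fixed before [g] and before the approximants, since [n2] and [M0] depend only on [x] and [E]; it
   makes the final bound [E / 64]. *)
pose ee := E / (64 * n2 * M0).
have ee0 : 0 < ee by rewrite divr_gt0 // !mulr_gt0.
have [nL nLP] := word_avg_contraction eS e_onto thickX finX
  (building_homogeneous tpG wtG) C0 (exprn_gt0 2 ee0).
exists [set g | [set D | (dist C0 D <= nL)%N] (sact g C0)].
  exact: (compact_finite_displacement (finite_ball eS e_onto finX nL C0)).
move=> g /= /negP; rewrite -ltnNge => gL.
have [w [rw gw sw]] := ex_gallery eS e_onto C0 (sact g C0).
have gwd : wdist C0 (sact g C0) = word_val e w := gallery_wdist eS e_onto gw rw.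
have hT f : fin_supp f -> inner_prod (word_avg e C0 w f) (word_avg e C0 w f) <=
    ee ^+ 2 * inner_prod f f.
  by apply: nLP => //; rewrite sw ltnW.
(* The sphere covers all the elements [k1^-1 * g * k2]. Adding [C0] brings in the identity, where
   the approximation bounds the total norm of the [y j] ([sumy]). *)
pose B := sphere (word_val e w) C0 `|` [set C0].
have fB : finite_set B.
  by rewrite finite_setU; split; [exact: finite_sphere|exact: finite_set1].
pose del := Num.min (E / 8) 1.
have del0 : 0 < del by rewrite lt_min ltr01 divr_gt0.
have [s sP] := wc x (compact_finite_displacement fB) del0.
have {}sP h : B (sact h C0) ->
    cabs (coefficient pi x x h - \sum_(y <- s) coefficient (regular_rep mu) y y h) < del.
  by move=> /sP; rewrite cabsE ltcR.
pose y (j : 'I_(size s)) := tnth (in_tuple s) j.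
pose u j := abs_repr (y j).
have u0 j t : 0 <= u j t by exact: abs_repr_ge0.
have mu_ j : measurable_fun setT (u j) by exact: abs_repr_measurable.
have su j : (sqnorm mu (u j) <= (2 * Re (inner (y j) (y j)))%:E)%E.
  exact: sqnorm_abs_repr.
have ry0 j : 0 <= Re (inner (y j) (y j)).
  have : (0 <= (2 * Re (inner (y j) (y j)))%:E)%E.
    by apply: le_trans (su j); apply: integral_ge0 => t _; rewrite lee_fin sqr_ge0.
  by rewrite lee_fin pmulr_rge0.
have sumy : \sum_j Re (inner (y j) (y j)) <= a + 1.
  have := sP 1%g (or_intror erefl).
  have -> : coefficient pi x x 1%g = inner x x by rewrite /coefficient Defs.act1.
  have -> : \sum_(y <- s) coefficient (regular_rep mu) y y 1%g = \sum_j inner (y j) (y j).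
    by rewrite big_tnth; apply: eq_bigr => j _; rewrite /coefficient Defs.act1.
  set S := \sum_j inner _ _ => hS.
  have -> : \sum_j Re (inner (y j) (y j)) = Re S by rewrite /S raddf_sum.
  apply: le_trans (Re_le_cabs _) _.
  have -> : S = inner x x + (- (inner x x - S)) by ring.
  apply: le_trans (cabsD _ _) _; rewrite lerD2l /cabs normrN -/(cabs _).
  by rewrite ltW // (lt_le_trans hS) // ge_min lexx orbT.
(* [th] and [eta] let each of the two error terms of [pairing_perturb] add up to at most [E / 32];
   the [1] in [eta] keeps the summed smoothing errors within what [M0] allows. *)
pose th := E / (32 * M0); have th0 : 0 < th by rewrite divr_gt0 // mulr_gt0.
pose c1 := th^-1 + 1; have c10 : 0 < c1 by rewrite addr_gt0 // invr_gt0.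
pose m : R := (size s)%:R; have m0 : 0 < m + 1 by rewrite ltr_wpDl.
pose eta := Num.min 1 (E / (32 * c1)) / (m + 1).
have eta0 : 0 < eta.
  by rewrite divr_gt0 // lt_min ltr01 divr_gt0 // mulr_gt0.
have meta : m * eta <= Num.min 1 (E / (32 * c1)).
  rewrite mulrCA ger_pMr ?ler_pdivrMr ?mul1r ?lerDl //.
  by rewrite lt_min ltr01 divr_gt0 // mulr_gt0.
have /choice[zz zzP] j : exists sz : seq X * (borel GT -> R), smooth C0 sz.1 sz.2 /\
    (sqnorm mu (fun t => u j t - sz.2 t)%R <= eta%:E)%E.
  have [|s' [z [h1 h2]]] := @approximable_sqnorm R W X G mu C0 (u j) (u0 j) (mu_ j) _ eta eta0.
    exact: le_lt_trans (su j) (ltey _).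
  by exists (s', z).
pose z j := (zz j).2; pose st := flatten [seq (zz j).1 | j <- enum 'I_(size s)].
have zs j : smooth C0 st (z j).
  apply: smoothS (zzP j).1 => C Cs; apply/flattenP; exists (zz j).1 => //.
  by apply: map_f; rewrite mem_enum.
have z0 j t : 0 <= z j t by have [] := zs j.
have mz j : measurable_fun setT (z j) := smooth_measurable (zs j).
have hr j : (sqnorm mu (fun t => u j t - z j t)%R <= eta%:E)%E by have [] := zzP j.
have sumr_ : (\sum_j sqnorm mu (fun t => u j t - z j t)%R <= (m * eta)%:E)%E.
  apply: (@le_trans _ _ (\sum_(j < size s) eta%:E)%E); first exact: lee_sum.
  by rewrite sumEFin sumr_const card_ord mulr_natl.
have sumz : (\sum_j sqnorm mu (z j) <= M0%:E)%E.
  apply: (@le_trans _ _ (\sum_j (4 * Re (inner (y j) (y j)) + 2 * eta)%:E)%E).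
    apply: lee_sum => j _.
    apply: le_trans (@sqnorm_le2 R W X G mu (z j) (u j) (fun t => z j t - u j t) _ _ _ _) _ => //.
    - exact: measurable_funB.
    - by move=> t; ring.
    have -> : sqnorm mu (fun t => z j t - u j t)%R = sqnorm mu (fun t => u j t - z j t)%R.
      by apply: eq_integral => t _; congr (_%:E); ring.
    rewrite [leRHS]EFinD; apply: leeD.
      apply: le_trans (lee_wpmul2l _ (su j)) _; first by rewrite lee_fin.
      by rewrite -EFinM lee_fin mulrA -natrM.
    by rewrite EFinM; apply: lee_wpmul2l.
  rewrite sumEFin lee_fin big_split /= -mulr_sumr sumr_const card_ord -[_ *+ size s]mulr_natl.
  have m1 : m * eta <= 1 by apply: le_trans meta _; rewrite ge_min lexx.
  rewrite -/m /M0; apply: lerD; first by rewrite ler_pM2l.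
  by rewrite mulrCA -[leRHS]mulr1 ler_pM2l.
(* The losses are [E / 4] for moving [g], [E / 8] for weak containment and twice [E / 16] for
   smoothing, [E / 2] in all; the division undoes the factor [2] of [regular_coefficient_le]. *)
pose c := (cabs (coefficient pi x x g) - E / 2) / 2.
have key k1 k2 : fixes s0 k1 -> fixes s0 k2 ->
    (c%:E <= \sum_j pairing mu (k1^-1 * g * k2)%g (z j) (z j))%E.
  move=> f1 f2; set h := (k1^-1 * g * k2)%g.
  have Bh : B (sact h C0).
    left; rewrite /sphere /= /h !sactM (f2 _ Cs0) -gwd.
    by rewrite -[LHS](sact_wdist tpG k1) sactVK (f1 _ Cs0).
  have hpert : cabs (coefficient pi x x g) <= cabs (coefficient pi x x h) + E / 4.
    apply: le_trans (coefficient_perturb pi g k1 k2 x) _; rewrite lerD2l.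
    apply: (@le_trans _ _ ((d1 + d1) * hnorm x)).
      apply: ler_wpM2r; first exact: hnorm_ge0.
      by apply: lerD; apply: ltW; exact: small.
    rewrite (_ : _ * _ = E / 4 * (hnorm x / (hnorm x + 1))); last first.
      by rewrite /d1; field; rewrite gt_eqF.
    rewrite ler_piMr //; first by rewrite divr_ge0 // ltW.
    by rewrite ler_pdivrMr // mul1r lerDl.
  have hsum : cabs (coefficient pi x x h) <=
      E / 8 + \sum_j cabs (coefficient (regular_rep mu) (y j) (y j) h).
    have -> : coefficient pi x x h = (coefficient pi x x h -
        \sum_(y <- s) coefficient (regular_rep mu) y y h) +
        \sum_(y <- s) coefficient (regular_rep mu) y y h by ring.
    apply: le_trans (cabsD _ _) _; apply: lerD.
      by apply: ltW; apply: lt_le_trans (sP h Bh) _; rewrite ge_min lexx.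
    rewrite [X in cabs X](big_tnth _ _ s); exact: cabs_sum.
  have hreg : ((\sum_j cabs (coefficient (regular_rep mu) (y j) (y j) h))%:E <=
      2%:E * (\sum_j pairing mu h (z j) (z j) + (E / 16)%:E))%E.
    rewrite -sumEFin.
    apply: (@le_trans _ _ (\sum_j 2%:E * pairing mu h (u j) (u j))%E).
      by apply: lee_sum => j _; exact: regular_coefficient_le.
    have p0 j : (0 <= pairing mu h (u j) (u j))%E.
      by apply: integral_ge0 => t _; rewrite lee_fin mulr_ge0.
    have sq0 v : (0 <= sqnorm mu v)%E.
      by apply: integral_ge0 => t _; rewrite lee_fin sqr_ge0.
    rewrite -ge0_sume_distrr //; apply: lee_wpmul2l; first by rewrite lee_fin.
    apply: (@le_trans _ _ (\sum_j (pairing mu h (z j) (z j) + (th%:E * sqnorm mu (z j) +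
        c1%:E * sqnorm mu (fun t => u j t - z j t)%R)))%E).
      by apply: lee_sum => j _; exact: pairing_perturb.
    rewrite big_split /=; apply: leeD => //; rewrite big_split /=.
    rewrite -!ge0_sume_distrr //.
    have -> : (E / 16)%:E = (th%:E * M0%:E + c1%:E * (E / (32 * c1))%:E)%E :> \bar R.
      rewrite -!EFinM -EFinD; congr (_%:E); rewrite /th; field.
      by rewrite !gt_eqF.
    apply: leeD; apply: lee_wpmul2l => //; [by rewrite lee_fin ltW..|].
    apply: le_trans sumr_ _; rewrite lee_fin; apply: le_trans meta _.
    by rewrite ge_min lexx orbT.
  have tot : ((cabs (coefficient pi x x g) - 3 * E / 8)%:E <=
      2%:E * (\sum_j pairing mu h (z j) (z j) + (E / 16)%:E))%E.
    apply: le_trans hreg; rewrite lee_fin.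
    rewrite lerBlDr; apply: (le_trans hpert).
    rewrite (_ : 3 * E / 8 = E / 8 + E / 4) ?addrA ?lerD2r; last by field.
    by rewrite addrC in hsum.
  have : ((cabs (coefficient pi x x g) - 3 * E / 8)%:E * 2^-1%:E <=
      \sum_j pairing mu h (z j) (z j) + (E / 16)%:E)%E.
    by rewrite muleC lee_pdivrMl.
  rewrite -leeBlDr // -EFinM -EFinB; congr (_%:E <= _)%E.
  by rewrite /c; field.
have een2 : (0 <= (ee * n2)%:E)%E by rewrite lee_fin mulr_ge0 // ltW.
have := averaged_bound eS e_onto thickX finX clG tpG wtG Cs0 zs ee0 rw gwd hT key.
rewrite -/n -/n2 => /le_trans /(_ (lee_wpmul2l een2 sumz)).
rewrite -EFinM lee_fin (_ : ee * n2 * M0 = E / 64); last first.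
  rewrite /ee -(mulrA 64) -(mulrA _ n2) invfM -!mulrA mulVf ?mulr1 //.
  by rewrite gt_eqF // mulr_gt0.
rewrite /c ler_pdivrMr // lerBlDr => hA; apply: le_lt_trans hA _.
rewrite (_ : _ + _ = E * (17 / 32)); last by field.
by rewrite gtr_pMr // ltr_pdivrMr // mul1r ltr_nat.
Qed.

End Vanishing.

(** * From diagonal coefficients to mixing *)

Section Mixing.
Local Open Scope classical_set_scope.
Local Open Scope ring_scope.
Local Open Scope complex_scope.
Variables (R : realType) (G : topGroupType) (H : hilbertType R) (pi : unitary_rep G H).

(** Weak containment speaks of diagonal coefficients only; [polarization] expresses any coefficient
    by four of them. *)
Lemma mixing_diagonal :
  (forall x (E : R), 0 < E -> exists2 Q : set G, compact Q &
     forall g, ~ Q g -> cabs (coefficient pi x x g) < E) -> mixing pi.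
Proof.
move=> diag x y; split; first exact: coefficient_continuous.
move=> E E0; pose z c := x + c *: y.
have [Q1 cQ1 Q1P] := diag (z 1) E E0.
have [Q2 cQ2 Q2P] := diag (z (-1)) E E0.
have [Q3 cQ3 Q3P] := diag (z 'i%C) E E0.
have [Q4 cQ4 Q4P] := diag (z (- 'i%C)) E E0.
exists (Q1 `|` Q2 `|` (Q3 `|` Q4)); first by do !apply: compactU.
move=> g /not_orP[/not_orP[n1 n2] /not_orP[n3 n4]].
have {}Q1P : cabs (coefficient pi (z 1) (z 1) g) < E by exact: Q1P.
have {}Q2P : cabs (coefficient pi (z (-1)) (z (-1)) g) < E by exact: Q2P.
have {}Q3P : cabs (coefficient pi (z 'i%C) (z 'i%C) g) < E by exact: Q3P.
have {}Q4P : cabs (coefficient pi (z (- 'i%C)) (z (- 'i%C)) g) < E by exact: Q4P.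
rewrite -(@ltr_pM2l _ 4) // -[X in X * `|_|]ger0_norm // -normrM polarization.
rewrite -!/(z _) -!/(coefficient pi _ _ g).
have normi : `|'i%C : R[i]| = 1 by exact: normCi.
apply: le_lt_trans (ler_normD _ _) _; rewrite normrM normi mul1r.
apply: (@le_lt_trans _ _ ((cabs (coefficient pi (z 1) (z 1) g) +
    cabs (coefficient pi (z (-1)) (z (-1)) g) + (cabs (coefficient pi (z 'i%C) (z 'i%C) g) +
    cabs (coefficient pi (z (- 'i%C)) (z (- 'i%C)) g)))%:C)).
  by rewrite !rmorphD /= -!cabsE; apply: lerD; exact: ler_normB.
have -> : 4 * E%:C = (E + E + (E + E))%:C.
  by rewrite !rmorphD /=; ring.
by rewrite ltcR; do !apply: ltrD.
Qed.

End Mixing.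

Theorem corollary6 (R : realType) (W : coxeterSystem) (X : building W)
  (G : groupClosed (building_aut X)) :
  finite_rank W -> thick X -> locally_finite X ->
  closed [set` G]%classic -> type_preserving G -> weyl_transitive G ->
  forall (mu : haar_measure R (subgrp G)) (H : hilbertType R)
    (pi : unitary_rep (subgrp G) H),
    weakly_contained pi (regular_rep mu) -> mixing pi.
Proof.
move=> frW thX lfX clG tpG wtG mu H pi wc; apply: mixing_diagonal => x E E0.
(* Without chambers the group is trivial, hence compact. *)
have [[C0 _]|noC] := pselect (exists C0 : X, True); last first.
  exists [set: subgrp G]%classic; last by move=> g [].
  rewrite (_ : setT = [set 1%g]%classic); first exact: compact_set1.
  apply/seteqP; split=> // g _ /=; apply: val_inj; apply: aut_inj => C.
  by case: noC; exists C.
pose I : finType := fset_set (cox_gens W); pose e (i : I) : W := fsval i.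
have eS i : cox_gens W (e i) by have := fsvalP i; rewrite in_fset_set // inE.
have e_onto s : cox_gens W s -> exists i, e i = s.
  by move=> Ss; have sI : s \in fset_set (cox_gens W) by
    [rewrite in_fset_set // inE]; exists [` sI]%fset.
exact: (diagonal_coefficient_vanish eS e_onto thX lfX clG tpG wtG C0 wc x E0).
Qed.
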